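(* Let $n\ge3$. If $q\in[1,2]$ and $a,s\in\mathbb R$ satisfy $|s|\le1$ and $|a|+|s|<\frac n2$, then there is a constant $C$ such that for all $f$ $$\|f\|_{\ell^{2,0}_D\ell^{q,a}_x\dot H^s}\le C\,\|f\|_{\ell^{q,a}_x\dot H^s}.$$
   Context: $\dot H^s=\dot H^s(\mathbb R^n)$ with norm $\|g\|_{\dot H^s}=\||D|^sg\|_{L^2}$, $|D|^s$ the Fourier multiplier $|\xi|^s$. Let $\varphi\in C_0^\infty((1/2,2))$ be nonnegative with $\sum_{k\in\mathbb Z}\varphi(r/2^k)=1$ for $r>0$; $Q_k(x)=\varphi(|x|/2^k)$ is the Paley-Littlewood partition in $x$ (acting by multiplication) and $P_k(\xi)=\varphi(|\xi|/2^k)$ is the Paley-Littlewood partition in frequency, $P_k(D)$ being the Fourier multiplier with symbol $P_k$. The norms are $$\|f\|_{\ell^{q,a}_x\dot H^s}=\Big(\sum_{k\in\mathbb Z}2^{kqa}\|Q_kf\|_{\dot H^s}^q\Big)^{1/q},\qquad \|f\|_{\ell^{r,\sigma}_DB}=\Big(\sum_{k\in\mathbb Z}2^{kr\sigma}\|P_k(D)f\|_B^r\Big)^{1/r},$$ so that $$\|f\|_{\ell^{2,0}_D\ell^{q,a}_x\dot H^s}=\Big(\sum_{k_2\in\mathbb Z}\Big(\sum_{k_1\in\mathbb Z}2^{k_1qa}\||D|^sQ_{k_1}P_{k_2}(D)f\|_{L^2}^q\Big)^{2/q}\Big)^{1/2}.$$ The space $\ell^{q,a}_x\dot H^s$ is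 the closure of $C_0^\infty(\mathbb R^n\setminus\{0\})$ in its norm. *)

(* Defs.v *)
From HB Require Import structures.
From mathcomp Require Import all_boot all_order all_algebra.
From mathcomp Require Import complex.
From mathcomp Require Import all_classical all_reals all_analysis.

Set Implicit Arguments.
Unset Strict Implicit.
Unset Printing Implicit Defensive.

Import Order.TTheory GRing.Theory Num.Theory.
Import numFieldNormedType.Exports.

Local Open Scope classical_set_scope.
Local Open Scope ring_scope.

(* Lebesgue measure on R^n.  The library has product measures but no Lebesgue
   measure on R^n; it is built here by recursion on n, as the image of
   lebesgue_measure \x lebn n under (x, t) |-> x :: t. *)
Section lebn_step.
Context {R : realType} {n : nat}.
Variable mu : {sigma_finite_measure set (n.-tuple (measurableTypeR R)) -> \bar R}.

Definition tcons (p : measurableTypeR R * n.-tuple (measurableTypeR R)) :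
  n.+1.-tuple (measurableTypeR R) := [tuple of p.1 :: p.2].

Lemma measurable_tcons : measurable_fun [set: _] tcons.
Proof. by apply: measurable_cons. Qed.

Definition lebcons : set (n.+1.-tuple (measurableTypeR R)) -> \bar R :=
  pushforward (@lebesgue_measure R \x mu)%E tcons.

Let mpre (A : set (n.+1.-tuple (measurableTypeR R))) :
  measurable A -> measurable (tcons @^-1` A).
Proof.
by move=> mA; rewrite -[X in measurable X]setTI; apply: measurable_tcons.
Qed.

Let lebcons0 : lebcons set0 = 0%E.
Proof. by rewrite /lebcons /pushforward preimage_set0; exact: measure0. Qed.

Let lebcons_ge0 A : (0 <= lebcons A)%E.
Proof. by rewrite /lebcons /pushforward; apply: measure_ge0. Qed.

Let lebcons_sigma_additive : semi_sigma_additive lebcons.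
Proof.
move=> F mF tF mUF; rewrite /lebcons /pushforward preimage_bigcup.
apply: measure_semi_sigma_additive.
- by move=> i; exact: mpre.
- apply/trivIsetP => /= i j _ _ ij; rewrite -preimage_setI.
  by move/trivIsetP : tF => /(_ _ _ _ _ ij) ->//; rewrite preimage_set0.
- by rewrite -preimage_bigcup; exact: mpre.
Qed.

HB.instance Definition _ := isMeasure.Build _ _ _ lebcons
  lebcons0 lebcons_ge0 lebcons_sigma_additive.

Let lebcons_sigma_finite : sigma_finite setT lebcons.
Proof.
pose m1 : {sigma_finite_measure set (measurableTypeR R) -> \bar R} :=
  @lebesgue_measure R.
have /sigma_finiteP[F [TF ndF Foo]] := sigma_finiteT m1.
have /sigma_finiteP[G [TG ndG Goo]] := sigma_finiteT mu.
pose hd_tl (t : n.+1.-tuple (measurableTypeR R)) :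
  measurableTypeR R * n.-tuple (measurableTypeR R) :=
  (tnth t ord0, [tuple of behead t]).
have tconsK : cancel tcons hd_tl.
  by move=> [x t]; rewrite /hd_tl /tcons; congr pair; apply/val_inj.
have mhd_tl : measurable_fun [set: _] hd_tl.
  apply: measurable_fun_pair; first exact: measurable_tnth.
  exact: measurable_behead.
have FGT : \bigcup_k (F k `*` G k) = setT.
  rewrite -setXTT TF TG predeqE => -[x y]; split.
    by move=> [k _ [/= ? ?]]; split; exists k.
  move=> [/= [i _ Fix] [j _ Gjy]]; exists (maxn i j) => //; split => /=.
  - by move: x Fix; exact/subsetPset/ndF/leq_maxl.
  - by move: y Gjy; exact/subsetPset/ndG/leq_maxr.
exists (fun k => hd_tl @^-1` (F k `*` G k)).
  by rewrite -preimage_bigcup FGT preimage_setT.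
move=> k; have [mFk Fk] := Foo k; have [mGk Gk] := Goo k; split.
  rewrite -[X in measurable X]setTI; apply: mhd_tl => //.
  exact: measurableX.
rewrite /lebcons /pushforward.
have -> : tcons @^-1` (hd_tl @^-1` (F k `*` G k)) = F k `*` G k.
  rewrite -comp_preimage (_ : hd_tl \o tcons = id) ?preimage_id//.
  by apply/funext => p; exact: tconsK.
by rewrite product_measure1E// lte_mul_pinfty// ge0_fin_numE.
Qed.

HB.instance Definition _ := Measure_isSigmaFinite.Build _ _ _ lebcons
  lebcons_sigma_finite.

End lebn_step.

Fixpoint lebn (R : realType) (n : nat) :
    {sigma_finite_measure set (n.-tuple (measurableTypeR R)) -> \bar R} :=
  if n is m.+1 then lebcons (lebn R m)
  else \d_([tuple] : 0.-tuple (measurableTypeR R)).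

Section defs.
Context {R : realType} {n : nat}.
Implicit Types (x y xi : 'rV[R]_n) (f g u psi : 'rV[R]_n -> R[i]) (k : int).
Local Notation Re := (@complex.Re R).
Local Notation Im := (@complex.Im R).
Local Notation cabs := (@ComplexField.Normc.normc R).

Definition rV_of_tuple (t : n.-tuple (measurableTypeR R)) : 'rV[R]_n :=
  \row_i (tnth t i : R).

(* The library norm `|x| on 'rV[R]_n is the sup norm. *)
Definition dot x y : R := \sum_i x 0 i * y 0 i.
Definition enorm x : R := Num.sqrt (dot x x).

Definition cint f : R[i] :=
  ((\int[lebn R n]_t Re (f (rV_of_tuple t))) +i* (\int[lebn R n]_t Im (f (rV_of_tuple t))))%C.

Definition expi (t : R) : R[i] := (cos t +i* sin t)%C.

Definition pder (l : seq 'I_n) (h : 'rV[R]_n -> R) : 'rV[R]_n -> R :=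
  foldr (fun i h' => 'D_(delta_mx 0 i) h') h l.

Definition smooth (h : 'rV[R]_n -> R) : Prop :=
  forall l, continuous (pder l h) /\
    forall x i, derivable (pder l h) x (delta_mx 0 i).

Definition csmooth f : Prop := smooth (Re \o f) /\ smooth (Im \o f).

Definition test_function_off0 f : Prop :=
  csmooth f /\
  exists r1 r2 : R, 0 < r1 /\ forall x, f x != 0 -> r1 <= enorm x <= r2.

Definition schwartz_seminorm (N : nat) f : \bar R :=
  ereal_sup [set y | exists l m x, [/\ (size l <= N)%N, (m <= N)%N &
    y = (enorm x ^+ m *
         (`|pder l (Re \o f) x| + `|pder l (Im \o f) x|))%:E]].

Definition schwartz f : Prop :=
  csmooth f /\ forall N, (schwartz_seminorm N f < +oo)%E.

(* A distribution is represented by a functional on all functions, of which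
   only the values on Schwartz functions are constrained. *)
Definition functional := ('rV[R]_n -> R[i]) -> R[i].
Implicit Types T : functional.

Definition tempered T : Prop :=
  (forall (c : R[i]) f g, schwartz f -> schwartz g ->
     T (fun x => c * f x + g x) = c * T f + T g) /\
  exists (N : nat) (M : R), forall f, schwartz f ->
    ((cabs (T f))%:E <= M%:E * schwartz_seminorm N f)%E.

Definition regular u : functional := fun psi => cint (fun x => u x * psi x).

Definition fourier_cst : R := (2 * pi) `^ (- (n%:R / 2)).

Definition fourier f xi : R[i] :=
  (fourier_cst)%:C%C * cint (fun x => expi (- dot x xi) * f x).

Definition inv_fourier f x : R[i] :=
  (fourier_cst)%:C%C * cint (fun xi => expi (dot x xi) * f xi).

Variable phi : R -> R.

Definition dyadic k x : R := phi (enorm x / (2 : R) ^ k).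

Definition PkD_fun k f : 'rV[R]_n -> R[i] :=
  inv_fourier (fun xi => (dyadic k xi)%:C%C * fourier f xi).

(* Action of Q_k and P_k(D) on distributions by transposition; the symbol of
   P_k(D) is even, so P_k(D) is its own transpose. *)
Definition Qk k T : functional := fun psi => T (fun x => (dyadic k x)%:C%C * psi x).
Definition PkD k T : functional := fun psi => T (PkD_fun k psi).

(* Fourier transform of a compactly supported distribution: the function
   xi |-> (2 pi)^(-n/2) <T, e^{-i x.xi}>.  It is only applied below to
   distributions of the form Qk k T, for which the pairing with the exponential
   is T evaluated at a smooth compactly supported function. *)
Definition dfourier T xi : R[i] :=
  (fourier_cst)%:C%C * T (fun x => expi (- dot x xi)).

(* || |D|^s T ||_{L^2}, computed on the Fourier side: the Fourier transform is
   normalised to be unitary, and |D|^s is multiplication by |xi|^s.  The value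
   of |xi|^s at xi = 0 is irrelevant. *)
Definition Hdot (s : R) T : \bar R :=
  ('N[lebn R n]_2%:E[(fun t => (enorm (rV_of_tuple t) `^ s *
                               cabs (dfourier T (rV_of_tuple t)))%:E)])%E.

Definition lx (q a : R) (B : functional -> \bar R) T : \bar R :=
  ((\esum_(k in [set: int]) ((2 `^ (k%:~R * q * a))%:E * B (Qk k T) `^ q)) `^ q^-1)%E.

Definition lD (r sigma : R) (B : functional -> \bar R) T : \bar R :=
  ((\esum_(k in [set: int]) ((2 `^ (k%:~R * r * sigma))%:E * B (PkD k T) `^ r)) `^ r^-1)%E.

(* The closure of C_0^oo(R^n \ {0}) in the norm lx q a (Hdot s), realised
   inside the tempered distributions.  Convergence in the sense of
   distributions is required as well since the norm vanishes on
   distributions supported at the origin (such as the Dirac mass), which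
   do not belong to the completion. *)
Definition lx_Hdot_space (q a s : R) T : Prop :=
  tempered T /\
  exists u : nat -> 'rV[R]_n -> R[i],
  [/\ forall j, test_function_off0 (u j),
      forall psi, schwartz psi ->
        (fun j => cabs (regular (u j) psi - T psi)) @ \oo --> (0 : R) &
      (fun j => lx q a (Hdot s) (fun psi => regular (u j) psi - T psi))
        @ \oo --> 0%E].

End defs.

Arguments functional : clear implicits.

Definition dyadic_generator (R : realType) (phi : R -> R) : Prop :=
  [/\ forall (j : nat) (r : R), derivable (phi^`(j))%classic r 1,
      exists c d : R, [/\ 1 / 2 < c, d < 2 & forall r, phi r != 0 -> c <= r <= d],
      forall r : R, 0 <= phi r &
      forall r : R, 0 < r ->
        \esum_(k in [set: int]) (phi (r / (2 : R) ^ k))%:E = 1%E].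

(* Main.v *)
(* Everything is computed on the Fourier side, where [Q_k] is convolution with
   the transform of an annulus and [P_l] is multiplication by an annulus. Write a
   test function as [u = \sum_j Q_j u] and estimate [Q_k P_l Q_j].
   If [|k - j| <= 2], a Schur test with the weight [|xi|^(2 s)] bounds [Q_k] on
   the homogeneous space (this uses [2 |s| < n]), and [\sum_l phi(|.|/2^l)^2 <= 1]
   allows summing the squares over [l].
   If [|k - j| >= 3], the points [x], [y] in the two shells satisfy
   [|x - y| ~ 2^m] with [m = max(k, j)], so the convolution kernel of [P_l] may be
   cut off to [|z| ~ 2^m]. The transform of the truncated kernel has size
   [2^(-|l + m|)] with rapid decay, and Cauchy-Schwarz against the weight gives
   [\sum_l ||Q_k P_l Q_j u||^2 <= C 2^(-(n - 2 |s|) |k - j|) ||Q_j u||^2].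
   As [2 |a| < n - 2 |s|] and [q <= 2], the claim follows for test functions by a
   discrete Young inequality and Minkowski's inequality in l^(2/q); the general
   case follows by pointwise convergence of the transforms and Fatou's lemma. *)
From HB Require Import structures.
Require Import Defs.
From mathcomp Require Import all_boot all_order all_algebra.
From mathcomp Require Import complex.
From mathcomp Require Import all_classical all_reals all_analysis.
From mathcomp Require Import measurable_realfun.
From mathcomp Require Import ring lra zify.

Set Implicit Arguments.
Unset Strict Implicit.
Unset Printing Implicit Defensive.

Import Order.TTheory GRing.Theory Num.Theory.
Import numFieldNormedType.Exports.

Local Open Scope classical_set_scope.
Local Open Scope ring_scope.

(** * Integration over row vectors *)

(** The Fourier transform is handled through real integrals against cosines with a phase. This
    suffices because all symbols and cut-offs are radial, hence even: convolution with their
    transforms acts separately on real and imaginary parts. For the same reason Fourier inversion is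
    needed only for even functions and only up to a nonzero constant, whose value disappears into
    [C]. The price is that localisation in space must be expressed by identities in frequency: a
    reproducing formula for data living in one shell, and the vanishing of certain integrals for
    separated shells. Half of the gap n - 2 |s| - 2 |a| pays for adding the pieces Q_j u by a
    weighted Cauchy-Schwarz inequality, the other half for Young's inequality in k - j. The limit is
    taken in the inequality for fixed k and finitely many l, before any sum over k, so that no
    continuity of the mixed norm enters; the discrete inequality is then applied to f itself. *)

Section affine_line.
Context {R : realType}.
Local Notation leb := (@lebesgue_measure R).

Definition affine_line (a b : R) (x : measurableTypeR R) : measurableTypeR R :=
  a * x + b.

Lemma measurable_affine_line a b : measurable_fun setT (affine_line a b).
Proof. by apply: measurable_funD => //; exact: measurable_funM. Qed.

Definition affine_measure (a b : R) : {measure set (measurableTypeR R) -> \bar R} :=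
  measure_function_pushforward__canonical__measure_function_Measure leb
    (measurable_affine_line a b).

(** By uniqueness of Lebesgue measure it is enough to compare both sides on half-open intervals. For
    negative [a] the preimage is closed at the other end, which does not change its length. *)
Lemma lebesgue_measure_affine (a b : R) (A : set (measurableTypeR R)) :
  a != 0 -> measurable A ->
  leb A = (`|a|%:E * pushforward leb (affine_line a b) A)%E.
Proof.
move=> a0 mA.
pose mu := mscale (NngNum (normr_ge0 a)) (affine_measure a b).
rewrite -[RHS]/(mu A).
apply: lebesgue_measure_unique => // _ [[c d]] _ <-.
rewrite /= /mu /mscale /= /pushforward /=.
have -> : affine_line a b @^-1` `]c, d] = if 0 < a then `](c - b) / a, (d - b) / a]%classic
   else `[(d - b) / a, (c - b) / a[%classic.
  have [a_gt0|a_le0] := ltP 0 a; apply/seteqP; split => x /=; rewrite !in_itv/=.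
  - by rewrite ltr_pdivrMr// ler_pdivlMr// ltrBlDr lerBrDr mulrC.
  - by rewrite ltr_pdivrMr// ler_pdivlMr// ltrBlDr lerBrDr mulrC.
  - have a_lt0 : a < 0 by rewrite lt_neqAle a0.
    by rewrite ler_ndivrMr// ltr_ndivlMr// ltrBlDr lerBrDr andbC mulrC.
  - have a_lt0 : a < 0 by rewrite lt_neqAle a0.
    by rewrite ler_ndivrMr// ltr_ndivlMr// ltrBlDr lerBrDr andbC mulrC.
rewrite lebesgue_measure_itv/= lte_fin.
have [a_gt0|a_le0] := ltP 0 a.
  rewrite lebesgue_measure_itv/= lte_fin ltr_pM2r ?invr_gt0// ltrD2r gtr0_norm//.
  case: ifP => _; last by rewrite mule0.
  rewrite -EFinB -EFinM; congr EFin; field.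
  by rewrite a0.
have a_lt0 : a < 0 by rewrite lt_neqAle a0.
rewrite lebesgue_measure_itv/= lte_fin ltr_nM2r ?invr_lt0// ltrD2r ltr0_norm//.
case: ifP => _; last by rewrite mule0.
rewrite -EFinB -EFinM; congr EFin; field.
by rewrite a0.
Qed.

Lemma ge0_integral_affine_line (a b : R) (f : R -> \bar R) :
  a != 0 -> measurable_fun [set: measurableTypeR R] f -> (forall x, 0 <= f x)%E ->
  (\int[leb]_x f (affine_line a b x) = `|a|^-1%:E * \int[leb]_x f x)%E.
Proof.
move=> a0 mf f0.
have -> : (\int[leb]_x f x = \int[mscale (NngNum (normr_ge0 a)) (affine_measure a b)]_x f x)%E.
  apply: eq_measure_integral => A mA _; first [exact: (lebesgue_measure_affine b a0 mA) | exact: (esym (lebesgue_measure_affine b a0 mA))].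
rewrite ge0_integral_mscale//=.
rewrite [X in (_ * (_ * X))%E](ge0_integral_pushforward (measurable_affine_line a b))//=.
rewrite muleA -EFinM mulVf ?mul1e// normr_eq0//.
Qed.

End affine_line.

(** * Iterated integrals and affine changes of variables *)

Section lebn_theory.
Context {R : realType}.
Local Notation leb := (@lebesgue_measure R).
Local Notation T n := (n.-tuple (measurableTypeR R)).
Local Open Scope ereal_scope.

Lemma ge0_integral_lebnS n (f : T n.+1 -> \bar R) :
  measurable_fun setT f -> (forall t, 0 <= f t) ->
  \int[lebn R n.+1]_t f t = \int[leb]_x \int[lebn R n]_t f (tcons (x, t)).
Proof.
move=> mf f0.
rewrite /= (ge0_integral_pushforward (@measurable_tcons R n))//= fubini_tonelli1//.
exact: measurableT_comp (@measurable_tcons R n).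
Qed.

Lemma measurable_lebn_section n (f : T n.+1 -> \bar R) :
  measurable_fun setT f -> (forall t, 0 <= f t) ->
  measurable_fun [set: measurableTypeR R] (fun x => \int[lebn R n]_t f (tcons (x, t))).
Proof.
move=> mf f0.
apply: (measurable_fun_fubini_tonelli_F (f \o (@tcons R n))).
  exact: measurableT_comp (@measurable_tcons R n).
by move=> z; exact: f0.
Qed.

Lemma ge0_integral_lebn0 (f : T 0 -> \bar R) :
  measurable_fun setT f -> (forall t, 0 <= f t) ->
  \int[lebn R 0]_t f t = f [tuple].
Proof.
by move=> mf f0; rewrite /= integral_dirac// diracT mul1e.
Qed.

Definition tuple_of_rV n (v : 'rV[R]_n) : T n :=
  [tuple v ord0 i : measurableTypeR R | i < n].

Lemma tuple_of_rVK n : cancel (@tuple_of_rV n) rV_of_tuple.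
Proof. by move=> v; apply/rowP => i; rewrite mxE tnth_mktuple. Qed.

Lemma rV_of_tupleK n : cancel rV_of_tuple (@tuple_of_rV n).
Proof.
by move=> t; apply: eq_from_tnth => i; rewrite tnth_mktuple mxE.
Qed.

Definition affine n (a : R) (b : 'rV[R]_n) (t : T n) : T n :=
  tuple_of_rV (a *: rV_of_tuple t + b)%R.

Lemma measurable_affine n a b : measurable_fun setT (@affine n a b).
Proof.
apply/measurable_fun_tnthP => i.
rewrite (_ : _ \o _ = fun t : T n => (a * tnth t i + b ord0 i)%R); last first.
  by apply/funext => t /=; rewrite tnth_mktuple !mxE.
apply: measurable_funD => //; apply: measurable_funM => //.
exact: measurable_tnth.
Qed.

Lemma affine_tcons n a (b : 'rV[R]_n.+1) x (t : T n) :
  affine a b (tcons (x, t)) =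
  tcons (affine_line a (b ord0 ord0) x, affine a (\row_i b ord0 (lift ord0 i)) t).
Proof.
apply: eq_from_tnth => i; rewrite tnth_mktuple !mxE.
case: (unliftP ord0 i) => [j ->|->]; last by rewrite !tnth0.
by rewrite !tnthS tnth_mktuple !mxE.
Qed.

(** Induction on the dimension: [affine_tcons] splits off the first coordinate, and each coordinate
    contributes one factor |a|^-1. *)
Lemma ge0_integral_affine n a b (f : T n -> \bar R) : a != 0%R ->
  measurable_fun setT f -> (forall t, 0 <= f t) ->
  \int[lebn R n]_t f (affine a b t) =
  (`|a| ^- n)%:E * \int[lebn R n]_t f t.
Proof.
move=> a0; elim: n b f => [|n IH] b f mf f0.
  rewrite !ge0_integral_lebn0// ?expr0 ?invr1 ?mul1e; last first.
    exact: measurableT_comp mf (measurable_affine _ _).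
  by congr f; apply: eq_from_tnth => -[].
rewrite !ge0_integral_lebnS//; last first.
  exact: measurableT_comp mf (measurable_affine _ _).
under eq_integral do under eq_integral do rewrite affine_tcons.
have mfx x : measurable_fun setT (fun t : T n => f (tcons (x, t))).
  apply: (measurableT_comp mf); apply: measurableT_comp (@measurable_tcons R n) _.
  exact: measurable_pair1.
under eq_integral => x _ do rewrite (IH _ (fun t => f (tcons (_, t)))) ?mfx//.
rewrite ge0_integralZl; first last.
- by rewrite lee_fin invr_ge0 exprn_ge0.
- by move=> x _; exact: integral_ge0.
- have := measurableT_comp (measurable_lebn_section mf f0) (measurable_affine_line a (b ord0 ord0)).
  exact.
- exact: measurableT.
rewrite (ge0_integral_affine_line _ a0 (measurable_lebn_section mf f0)); last first.
  by move=> x; exact: integral_ge0.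
by rewrite muleA -EFinM exprS invfM mulrC.
Qed.

(** Serves to compute the measure of cubes, whose indicator is a product over the coordinates. *)
Lemma ge0_integral_lebn_prod n (g : R -> \bar R) :
  measurable_fun [set: measurableTypeR R] g -> (forall x, 0 <= g x) ->
  \int[lebn R n]_t (\prod_(i < n) g (tnth t i)) = (\int[leb]_x g x) ^+ n.
Proof.
move=> mg g0.
have mp m : measurable_fun setT (fun t : T m => \prod_(i < m) g (tnth t i)).
  elim: m => [|m IH].
    by under eq_fun do rewrite big_ord0; exact: measurable_cst.
  under eq_fun do rewrite big_ord_recl.
  apply: emeasurable_funM.
    exact: measurableT_comp mg (measurable_tnth _).
  rewrite (_ : (fun x => _) = (fun t : T m => \prod_(i < m) g (tnth t i)) \o
     (fun t : T m.+1 => [tuple of behead t])).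
    exact: measurableT_comp IH (@measurable_behead _ _ _).
  apply/funext => t /=; apply: eq_bigr => i _; rewrite tnth_behead; congr (g (tnth t _)).
  by apply: val_inj; rewrite /= inordK//= /bump ltnS.
have p0 m (t : T m) : 0 <= \prod_(i < m) g (tnth t i) by exact: prode_ge0.
elim: n => [|n IH].
  by rewrite ge0_integral_lebn0// big_ord0 expe0.
rewrite ge0_integral_lebnS//.
have E x : \int[lebn R n]_t (\prod_(i < n.+1) g (tnth (tcons (x, t)) i)) =
    g x * (\int[leb]_x g x) ^+ n.
  rewrite -IH -ge0_integralZl//; last exact: mp.
  apply: eq_integral => t _; rewrite big_ord_recl tnth0; congr (_ * _).
  by apply: eq_bigr => i _; rewrite tnthS.
under eq_integral do rewrite E.
rewrite expeS ge0_integralZr//.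
by apply: expe_ge0; exact: integral_ge0.
Qed.

End lebn_theory.

(** * The Euclidean norm and the bracket weight *)

Section euclidean.
Context {R : realType} {n : nat}.
Implicit Types x y z : 'rV[R]_n.

Lemma dotC x y : dot x y = dot y x.
Proof. by apply: eq_bigr => i _; rewrite mulrC. Qed.

Lemma dotDl x y z : dot (x + y) z = dot x z + dot y z.
Proof.
by rewrite -big_split; apply: eq_bigr => i _; rewrite mxE mulrDl.
Qed.

Lemma dotZl a x y : dot (a *: x) y = a * dot x y.
Proof. by rewrite /dot mulr_sumr; apply: eq_bigr => i _; rewrite mxE mulrA. Qed.

Lemma dotDr x y z : dot z (x + y) = dot z x + dot z y.
Proof. by rewrite dotC dotDl !(dotC z). Qed.

Lemma dotZr a x y : dot x (a *: y) = a * dot x y.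
Proof. by rewrite dotC dotZl dotC. Qed.

Lemma dotNl x y : dot (- x) y = - dot x y.
Proof. by rewrite -scaleN1r dotZl mulN1r. Qed.

Lemma dotNr x y : dot x (- y) = - dot x y.
Proof. by rewrite dotC dotNl dotC. Qed.

Lemma dot0l y : dot 0 y = 0.
Proof. by rewrite -(scale0r 0) dotZl mul0r. Qed.

Lemma dot_delta x i : dot x (delta_mx 0 i) = x 0 i.
Proof.
rewrite /dot (bigD1 i)//= mxE !eqxx mulr1 big1 ?addr0// => j ji.
by rewrite mxE eqxx (negbTE ji) mulr0.
Qed.

Lemma dot_ge0 x : 0 <= dot x x.
Proof. by apply: sumr_ge0 => i _; rewrite -expr2 sqr_ge0. Qed.

Lemma enorm_ge0 x : 0 <= enorm x.
Proof. exact: sqrtr_ge0. Qed.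

Lemma sqr_enorm x : enorm x ^+ 2 = dot x x.
Proof. by rewrite sqr_sqrtr// dot_ge0. Qed.

Lemma enormZ a x : enorm (a *: x) = `|a| * enorm x.
Proof.
rewrite /enorm dotZl dotZr mulrA -expr2 sqrtrM ?sqr_ge0//.
by rewrite sqrtr_sqr.
Qed.

Lemma enormN x : enorm (- x) = enorm x.
Proof. by rewrite -scaleN1r enormZ normrN1 mul1r. Qed.

Lemma enorm0 : enorm (0 : 'rV[R]_n) = 0.
Proof. by rewrite /enorm dot0l sqrtr0. Qed.

Lemma coord_le_enorm x i : `|x 0 i| <= enorm x.
Proof.
rewrite -sqrtr_sqr ler_sqrt ?dot_ge0// /dot (bigD1 i)//= expr2 lerDl.
by apply: sumr_ge0 => j _; rewrite -expr2 sqr_ge0.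
Qed.

Lemma enorm_eq0 x : (enorm x == 0) = (x == 0).
Proof.
apply/eqP/eqP => [x0|->]; last exact: enorm0.
apply/rowP => i; rewrite mxE; apply/eqP.
by rewrite -normr_le0 (le_trans (coord_le_enorm _ _))// x0.
Qed.

Lemma enorm_gt0 x : (0 < enorm x) = (x != 0).
Proof. by rewrite lt_neqAle enorm_ge0 andbT eq_sym enorm_eq0. Qed.

Lemma dot_le_enorm x y : dot x y <= enorm x * enorm y.
Proof.
have [->|y0] := eqVneq y 0; first by rewrite dotC dot0l enorm0 mulr0.
have yy : 0 < dot y y by rewrite -sqr_enorm exprn_gt0// enorm_gt0.
(* The squared norm of |y|^2 x - (x.y) y equals |y|^2 (|x|^2 |y|^2 - (x.y)^2). *)
have : 0 <= dot (dot y y *: x - dot x y *: y) (dot y y *: x - dot x y *: y).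
  exact: dot_ge0.
rewrite !(dotDl, dotDr, dotNl, dotNr, dotZl, dotZr) (dotC y x).
set a := dot x x; set b := dot x y; set c := dot y y => h.
have : 0 <= c * (a * c - b ^+ 2) by move: h; lra.
rewrite pmulr_rge0// subr_ge0 => bac.
rewrite -sqrtrM ?dot_ge0// -/a -/c.
rewrite (le_trans (ler_norm b))// -sqrtr_sqr ler_wsqrtr//.
Qed.

Lemma enorm_triangle x y : enorm (x + y) <= enorm x + enorm y.
Proof.
rewrite -(@ler_pXn2r _ 2)// ?nnegrE ?addr_ge0 ?enorm_ge0//.
rewrite sqrrD !sqr_enorm dotDl !dotDr (dotC y x).
have := dot_le_enorm x y; lra.
Qed.

Lemma enorm_sub_ge x y : enorm x - enorm y <= enorm (x - y).
Proof. by rewrite lerBlDr (le_trans _ (enorm_triangle _ _))// subrK. Qed.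

Lemma enorm_subr_le x y : enorm (x - y) <= enorm x + enorm y.
Proof. by rewrite (le_trans (enorm_triangle _ _))// enormN. Qed.

Lemma enormB x y : enorm (x - y) = enorm (y - x).
Proof. by rewrite -opprB enormN. Qed.

Lemma dot_normE_le x y : `|dot x y| <= enorm x * enorm y.
Proof.
rewrite ler_norml dot_le_enorm andbT -lerN2 opprK -dotNl -(enormN x).
exact: dot_le_enorm.
Qed.

Lemma rV_norm_le x (e : R) : 0 <= e -> (forall i, `|x 0 i| <= e) -> `|x| <= e.
Proof.
move=> e0 xe; rewrite [leLHS]/Num.norm /= mx_normrE; apply/bigmax_leP; split => //.
by move=> /= [i j] _ /=; rewrite ord1.
Qed.

Lemma rV_norm_le_enorm x : `|x| <= enorm x.
Proof. by apply: rV_norm_le => [|i]; [exact: enorm_ge0|exact: coord_le_enorm]. Qed.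

(** The square of the Japanese bracket, so that its natural powers are polynomials. *)
Definition bracket x : R := 1 + dot x x.

Lemma bracket_ge1 x : 1 <= bracket x.
Proof. by rewrite lerDl dot_ge0. Qed.

Lemma bracket_gt0 x : 0 < bracket x.
Proof. exact: lt_le_trans ltr01 (bracket_ge1 x). Qed.

Lemma bracketN x : bracket (- x) = bracket x.
Proof. by rewrite /bracket dotNl dotNr opprK. Qed.

Lemma bracketB x y : bracket (x - y) = bracket (y - x).
Proof. by rewrite -bracketN opprB. Qed.

Lemma bracketE x : bracket x = 1 + enorm x ^+ 2.
Proof. by rewrite sqr_enorm. Qed.

(** Peetre's inequality: it converts decay at [x - y] into decay at [x] at the price of a factor
    [bracket y]. The first step is the positivity of |x - 2 y|^2. *)
Lemma bracket_peetre x y : bracket x <= 2 * bracket y * bracket (x - y).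
Proof.
have h : dot x x <= 2 * dot y y + 2 * dot (x - y) (x - y).
  have := dot_ge0 (x - 2 *: y).
  rewrite !(dotDl, dotDr, dotNl, dotNr, dotZl, dotZr) (dotC y x); lra.
have := mulr_ge0 (dot_ge0 y) (dot_ge0 (x - y)).
rewrite /bracket; have := dot_ge0 y; have := dot_ge0 (x - y); nra.
Qed.

Lemma bracketZ_le (a b : R) x : 0 <= a <= b -> bracket (a *: x) <= bracket (b *: x).
Proof.
move=> /andP[a0 ab]; rewrite /bracket lerD2l !dotZl !dotZr !mulrA ler_wpM2r ?dot_ge0//.
exact: ler_pM.
Qed.

Lemma continuous_coord i : continuous (fun x => x 0 i : R).
Proof. exact: coord_continuous. Qed.

Lemma continuous_dot (T : topologicalType) (f g : T -> 'rV[R]_n) :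
  continuous f -> continuous g -> continuous (fun t => dot (f t) (g t)).
Proof.
move=> cf cg; rewrite /dot; apply: continuous_big => [|i _].
  by move=> z; apply: cvgD; [exact: cvg_fst|exact: cvg_snd].
have cc (h : T -> 'rV[R]_n) : continuous h -> continuous (fun t => h t 0 i : R).
  move=> ch t; apply: (@continuous_comp _ _ _ h (fun x : 'rV[R]_n => x 0 i)).
    exact: ch.
  exact: coord_continuous.
by move=> t; apply: cvgM; exact: cc.
Qed.

Lemma continuous_enorm : continuous (@enorm R n).
Proof.
move=> x; apply: (@continuous_comp _ _ _ (fun x => dot x x) Num.sqrt).
  by apply: continuous_dot => y; exact: cvg_id.
exact: sqrt_continuous.
Qed.

Lemma continuous_bracket : continuous bracket.
Proof.
have cd : continuous (fun x : 'rV[R]_n => dot x x).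
  by apply: continuous_dot => y; exact: cvg_id.
by move=> x; apply: (cvgD (cvg_cst (1 : R)) (cd x)).
Qed.

End euclidean.

(** * Measurability of functions of a row vector *)

Section measurable_rV.
Context {R : realType} {n : nat}.
Local Notation T := (n.-tuple (measurableTypeR R)).
Local Notation X := (@rV_of_tuple R n).
Implicit Types x y : 'rV[R]_n.

Definition meas_rV (f : 'rV[R]_n -> R) := measurable_fun [set: T] (f \o X).
Definition emeas_rV (f : 'rV[R]_n -> \bar R) := measurable_fun [set: T] (f \o X).

Definition rounding (N : nat) x : 'rV[R]_n :=
  \row_i ((Num.floor (N.+1%:R * x 0 i))%:~R / N.+1%:R).

Lemma cvg_rounding x : rounding N x @[N --> \oo] --> x.
Proof.
apply/cvgrPdist_le => e e0.
have [N0 _ hN] : \forall N \near \oo, N.+1%:R^-1 <= e.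
  by near=> N; apply/ltW; near: N; exact: (near_infty_natSinv_lt (PosNum e0)).
exists N0 => // N /hN Ne.
apply: rV_norm_le => [|j]; [exact: ltW|rewrite !mxE; apply: le_trans Ne].
have N0' : 0 < N.+1%:R :> R by [].
have /andP[h1 h2] := floor_itv (N.+1%:R * x 0 j).
rewrite -[X in `|X - _|](mulfK (lt0r_neq0 N0')) -mulrBl normrM.
rewrite (gtr0_norm (x := _^-1)) ?invr_gt0// -[leRHS]mul1r ler_pM2r ?invr_gt0//.
rewrite mulrC ger0_norm ?subr_ge0//.
by move: h2; rewrite intrD => h2; rewrite lerBlDl ltW.
Unshelve. all: by end_near. Qed.

(** Measurability refers to the product sigma-algebra on tuples, continuity to the topology of row
    vectors. The link is rounding to the grid of mesh 1 / (N + 1): the rounded function is constant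
    on each of countably many boxes and converges pointwise to [f]. *)
Lemma continuous_meas_rV (f : 'rV[R]_n -> R) : continuous f -> meas_rV f.
Proof.
move=> cf.
apply: (@measurable_fun_cvg _ _ _ _ (fun N t => f (rounding N (X t)))); last first.
  move=> t _; apply: (@cvg_comp _ _ _ (fun N => rounding N (X t)) f).
    exact: cvg_rounding.
  exact: cf.
move=> N _ Y mY; rewrite setTI.
pose F (z : n.-tuple int) : set T :=
  \big[setI/setT]_(i < n) [set t : T | Num.floor (N.+1%:R * (tnth t i : R)) = tnth z i].
pose g (z : n.-tuple int) := f (\row_i ((tnth z i)%:~R / N.+1%:R)).
have mF z : measurable (F z).
  apply: bigsetI_measurable => i _.
  rewrite (_ : [set _ | _] = (fun t : T => N.+1%:R * (tnth t i : R)) @^-1`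
    `[(tnth z i)%:~R, (tnth z i + 1)%:~R[%classic); last first.
    apply/seteqP; split => t /=; rewrite in_itv/=.
      by move=> <-; rewrite floor_itv.
    by move=> h; apply/eqP; rewrite floor_eq.
  rewrite -[X in measurable X]setTI.
  have : measurable_fun [set: T] (fun t : T => N.+1%:R * (tnth t i : R)).
    by apply: measurable_funM => //; exact: measurable_tnth.
  by apply => //; exact: measurable_itv.
rewrite (_ : _ @^-1` _ = \bigcup_z (if `[< Y (g z) >] then F z else set0)).
  apply: countable_bigcupT_measurable => // z.
  by case: ifP => _ //; exact: measurable0.
apply/seteqP; split => t /=.
  pose z := [tuple Num.floor (N.+1%:R * (tnth t i : R)) | i < n].
  have gz : g z = f (rounding N (X t)).
    by congr f; apply/rowP => i; rewrite !mxE tnth_mktuple.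
  move=> Yt; exists z => //; rewrite gz; case: asboolP => // _.
  by rewrite /F -bigcap_seq/= => i _ /=; rewrite tnth_mktuple.
move=> [z _]; case: asboolP => // Yg Fz.
suff -> : rounding N (X t) = \row_i ((tnth z i)%:~R / N.+1%:R) by [].
apply/rowP => i; rewrite !mxE; congr (_%:~R / _).
by move: Fz; rewrite /F -bigcap_seq/= => /(_ i (mem_index_enum _)).
Qed.

Lemma measurable_lincomb (a b : R) :
  measurable_fun [set: T * T] (fun st => tuple_of_rV (a *: X st.1 + b *: X st.2)).
Proof.
apply/measurable_fun_tnthP => i.
rewrite (_ : _ \o _ = fun st : T * T => a * tnth st.1 i + b * tnth st.2 i); last first.
  by apply/funext => t /=; rewrite tnth_mktuple !mxE.
have h1 := measurableT_comp (@measurable_tnth _ (measurableTypeR R) n i)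
  (@measurable_fst _ _ T T).
have h2 := measurableT_comp (@measurable_tnth _ (measurableTypeR R) n i)
  (@measurable_snd _ _ T T).
by apply: (@measurable_funD _ _ R) => //; exact: (@measurable_funM _ _ R).
Qed.

Lemma measurable_lincomb_comp d (Y : measurableType d) (f : 'rV[R]_n -> Y) a b :
  measurable_fun [set: T] (f \o X) ->
  measurable_fun [set: T * T] (fun st => f (a *: X st.1 + b *: X st.2)).
Proof.
move=> mf; rewrite (_ : (fun _ => _) = (f \o X) \o
    (fun st => tuple_of_rV (a *: X st.1 + b *: X st.2))).
  exact: measurableT_comp mf (measurable_lincomb _ _).
by apply/funext => st /=; rewrite tuple_of_rVK.
Qed.

Lemma measurable_sub_comp d (Y : measurableType d) (f : 'rV[R]_n -> Y) :
  measurable_fun [set: T] (f \o X) ->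
  measurable_fun [set: T * T] (fun st => f (X st.1 - X st.2)).
Proof.
move=> /(measurable_lincomb_comp 1 (-1)).
by under eq_fun do rewrite scale1r scaleN1r.
Qed.

Lemma measurable_affine_comp d (Y : measurableType d) (f : 'rV[R]_n -> Y) a b :
  measurable_fun [set: T] (f \o X) ->
  measurable_fun [set: T] (fun t => f (a *: X t + b)).
Proof.
move=> mf; rewrite (_ : (fun _ => _) = (f \o X) \o affine a b).
  exact: measurableT_comp mf (measurable_affine _ _).
by apply/funext => st /=; rewrite tuple_of_rVK.
Qed.

Lemma measurable_dot2 : measurable_fun [set: T * T] (fun st => dot (X st.1) (X st.2)).
Proof.
rewrite (_ : (fun _ => _) = fun st : T * T => \sum_(i < n) (tnth st.1 i * tnth st.2 i)%R).
  apply: measurable_sum => i; apply: (@measurable_funM _ _ R).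
    exact: (measurableT_comp (@measurable_tnth _ (measurableTypeR R) n i)
      (@measurable_fst _ _ T T)).
  exact: (measurableT_comp (@measurable_tnth _ (measurableTypeR R) n i)
    (@measurable_snd _ _ T T)).
by apply/funext => st; apply: eq_bigr => i _; rewrite !mxE.
Qed.

End measurable_rV.

(** * Invariance of the integral and integrability of power weights *)

Section rV_integral.
Context {R : realType} {n : nat}.
Local Notation T := (n.-tuple (measurableTypeR R)).
Local Notation X := (@rV_of_tuple R n).
Local Notation lebn := (lebn R n).
Implicit Types x y : 'rV[R]_n.

Section ge0.
Local Open Scope ereal_scope.
Variable f : 'rV[R]_n -> \bar R.
Hypothesis mf : emeas_rV f.
Hypothesis f0 : forall x, 0 <= f x.

Lemma eint_affine a b : a != 0%R ->
  \int[lebn]_t f (a *: X t + b)%R = (`|a| ^- n)%:E * \int[lebn]_t f (X t).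
Proof.
move=> a0; rewrite -(ge0_integral_affine b a0 mf)//; last by move=> t; exact: f0.
by apply: eq_integral => t _ /=; rewrite tuple_of_rVK.
Qed.

Lemma eint_scale a : a != 0%R ->
  \int[lebn]_t f (a *: X t)%R = (`|a| ^- n)%:E * \int[lebn]_t f (X t).
Proof.
move=> a0; rewrite -(eint_affine 0 a0).
by apply: eq_integral => t _ /=; rewrite addr0.
Qed.

Lemma eint_subl b : \int[lebn]_t f (b - X t)%R = \int[lebn]_t f (X t).
Proof.
have := eint_affine b (a := -1)%R; rewrite oppr_eq0 oner_eq0 normrN1 expr1n invr1 mul1e.
by move=> <-//; apply: eq_integral => t _ /=; rewrite scaleN1r addrC.
Qed.

Lemma eint_subr b : \int[lebn]_t f (X t - b)%R = \int[lebn]_t f (X t).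
Proof.
have := eint_affine (- b) (a := 1)%R; rewrite oner_eq0 normr1 expr1n invr1 mul1e.
by move=> <-//; apply: eq_integral => t _ /=; rewrite scale1r.
Qed.

End ge0.

Definition integrable_rV (g : 'rV[R]_n -> R) :=
  lebn.-integrable [set: T] (fun t => (g (X t))%:E).

Lemma integrable_rVP g : integrable_rV g <->
  meas_rV g /\ (\int[lebn]_t (`|g (X t)|)%:E < +oo)%E.
Proof.
split => [/integrableP[/measurable_EFinP mg gi]|[mg gi]]; first by split.
by apply/integrableP; split => //; exact/measurable_EFinP.
Qed.

Lemma integrable_rV_affine g a b : a != 0 -> integrable_rV g ->
  integrable_rV (fun x => g (a *: x + b)).
Proof.
move=> a0 /integrable_rVP[mg gi]; apply/integrable_rVP; split.
  exact: (measurable_affine_comp a b mg).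
rewrite (eint_affine (f := fun x => (`|g x|)%:E))//.
  by rewrite lte_mul_pinfty// lee_fin invr_ge0 exprn_ge0.
by apply/measurable_EFinP; exact: measurableT_comp mg.
Qed.

Lemma Rint_affine g a b : a != 0 -> integrable_rV g ->
  \int[lebn]_t g (a *: X t + b) = `|a| ^- n * \int[lebn]_t g (X t).
Proof.
move=> a0 gi; have [mg _] := (integrable_rVP g).1 gi.
have ga := integrable_rV_affine b a0 gi.
have E (h : \bar R -> \bar R) : measurable_fun setT h -> (forall r, 0 <= h r)%E ->
    (\int[lebn]_t h (g (a *: X t + b))%:E = (`|a| ^- n)%:E * \int[lebn]_t h (g (X t))%:E)%E.
  move=> mh h0; apply: (eint_affine (f := fun x => h (g x)%:E)) => //.
  by apply: measurableT_comp => //; exact/measurable_EFinP.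
have max0 (r : \bar R) : (0 <= maxe r 0)%E by rewrite le_max lexx orbT.
have Ep := E (fun r => maxe r 0) (measurable_maxe (@measurable_id _ _ _) (measurable_cst _))
  (fun r => max0 r).
have En := E (fun r => maxe (- r) 0)%E (measurable_maxe (@oppe_measurable _ _)
  (measurable_cst _)) (fun r => max0 (- r)%E).
rewrite /Rintegral integralE [in RHS]integralE.
pose gE := fun t : T => (g (X t))%:E.
transitivity (fine ((`|a| ^- n)%:E * (\int[lebn]_t (gE^\+ t)) -
    (`|a| ^- n)%:E * (\int[lebn]_t (gE^\- t)))%E).
  congr (fine (_ - _)%E).
    under eq_integral do rewrite funeposE.
    by rewrite Ep; congr (_ * _)%E; apply: eq_integral => t _; rewrite funeposE.
  under eq_integral do rewrite funenegE.
  by rewrite En; congr (_ * _)%E; apply: eq_integral => t _; rewrite funenegE.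
have fp := integrable_pos_fin_num measurableT gi.
have fn := integrable_neg_fin_num measurableT gi.
rewrite -muleBr//; last by rewrite fin_num_adde_defl// fin_numN.
by rewrite fineM// fin_numB fp fn.
Qed.

Lemma Rint_subl g b : integrable_rV g ->
  \int[lebn]_t g (b - X t) = \int[lebn]_t g (X t).
Proof.
move=> gi; have := Rint_affine b (a := -1) _ gi.
rewrite oppr_eq0 oner_eq0 normrN1 expr1n invr1 mul1r => <-//.
by apply: eq_Rintegral => t _; rewrite scaleN1r addrC.
Qed.

Lemma Rint_opp g : integrable_rV g ->
  \int[lebn]_t g (- X t) = \int[lebn]_t g (X t).
Proof.
by move=> gi; rewrite -(Rint_subl 0 gi); apply: eq_Rintegral => t _; rewrite sub0r.
Qed.

Definition cube (r : R) : set T := [set t | forall i, `|tnth t i : R| <= r].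

Lemma cube_indicE r (t : T) :
  (\1_(cube r) t)%:E = (\prod_(i < n) (\1_(`[- r, r]%classic : set R) (tnth t i : R))%:E)%E :> \bar R.
Proof.
rewrite indicE; have [tr|tr] := boolP (t \in cube r).
  rewrite big1// => i _; rewrite indicE mem_set//= in_itv/= -ler_norml.
  by move: tr; rewrite inE => /(_ i).
move: tr; rewrite notin_setE /cube /= -existsNE => -[i /negP ir].
rewrite (bigD1 i)//= indicE memNset ?mul0e//= in_itv/= -ler_norml.
exact/negP.
Qed.

Lemma measurable_cube r : measurable (cube r).
Proof.
rewrite (_ : cube r = \big[setI/setT]_(i < n) [set t : T | `|tnth t i : R| <= r]); last first.
  rewrite -bigcap_seq; apply/seteqP; split => t /= h i; first by move=> _; exact: h.
  by apply: h; rewrite /= mem_index_enum.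
apply: bigsetI_measurable => i _.
have : measurable_fun setT (fun t : T => `|tnth t i : R|).
  by apply: measurableT_comp => //; exact: measurable_tnth.
move=> /(_ measurableT `]-oo, r]%classic (measurable_itv _)).
rewrite setTI (_ : _ @^-1` _ = [set t : T | `|tnth t i : R| <= r])//.
Qed.

Lemma lebn_cube r : 0 <= r -> lebn (cube r) = ((r *+ 2) ^+ n)%:E.
Proof.
move=> r0; rewrite -[LHS]mul1e -(setIT (cube r)) -integral_cst//; last first.
  by rewrite setIT; exact: measurable_cube.
rewrite setIT integral_mkcond.
under eq_integral => t _.
  rewrite (_ : _ t = (\1_(cube r) t)%:E); last by rewrite patchE indicE; case: ifP.
  rewrite cube_indicE; over.
rewrite /= (@ge0_integral_lebn_prod R n (fun x : R => (\1_(`[- r, r]%classic : set R) x)%:E))//.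
- rewrite integral_indic//= setIT lebesgue_measure_itv/= lte_fin.
  case: ltP => [_|h]; first by rewrite opprK -EFin_expe mulr2n.
  have -> : r = 0 by lra.
  by rewrite mul0rn EFin_expe.
- by apply/measurable_EFinP; exact: measurable_indic.
Qed.

Definition eball (r : R) : set T := [set t | enorm (X t) <= r].

Lemma measurable_eball r : measurable (eball r).
Proof.
have := continuous_meas_rV (@continuous_enorm R n).
move=> /(_ measurableT `]-oo, r]%classic (measurable_itv _)).
rewrite setTI (_ : _ @^-1` _ = [set t : T | enorm (X t) <= r])//.
Qed.

Lemma lebn_eball_lty r : (lebn (eball r) < +oo)%E.
Proof.
have mB := measurable_eball r.
have [r0|r0] := leP 0 r; last first.
  rewrite (_ : eball r = set0) ?measure0//.
  by apply/seteqP; split => // t; rewrite /eball/= leNgt (lt_le_trans r0 (enorm_ge0 _)).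
apply: le_lt_trans (_ : lebn (cube r) < +oo)%E; last by rewrite lebn_cube// ltry.
apply: le_measure; rewrite ?inE//; first exact: measurable_cube.
move=> t /= tr i; apply: le_trans tr.
by have := coord_le_enorm (X t) i; rewrite mxE.
Qed.

Definition origin : set T := [set t | X t = 0].

(** The dilation by 2 fixes the origin, so its measure v satisfies v = 2^-n v; as v is finite, it is
    0. *)
Lemma lebn_origin : (0 < n)%N -> lebn origin = 0%E.
Proof.
move=> n0; have E0 : origin = eball 0.
  apply/seteqP; split => t /=; first by rewrite /eball/= => ->; rewrite enorm0.
  move=> h; apply/eqP; rewrite -enorm_eq0 eq_le enorm_ge0 andbT; exact: h.
have m0 : measurable origin by rewrite E0; exact: measurable_eball.
pose f x : \bar R := (x == 0)%:R%:E.
have fE : (\int[lebn]_t f (X t) = lebn origin)%E.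
  rewrite -[in RHS](setIT origin) -integral_indic//.
  apply: eq_integral => t _; rewrite /f indicE.
  by case: eqVneq => h; [rewrite mem_set|rewrite memNset//=; apply/eqP].
have mf : emeas_rV f.
  rewrite /emeas_rV (_ : _ \o _ = EFin \o (\1_origin)).
    by apply/measurable_EFinP; exact: measurable_indic.
  apply/funext => t /=; rewrite /f indicE.
  by case: eqVneq => h; [rewrite mem_set|rewrite memNset//=; apply/eqP].
have f0 x : (0 <= f x)%E by rewrite lee_fin.
have := eint_scale mf f0 (lt0r_neq0 (ltr0n R 2)).
have -> : (\int[lebn]_t f (2 *: X t))%E = (\int[lebn]_t f (X t))%E.
  by apply: eq_integral => t _; rewrite /f scaler_eq0 pnatr_eq0.
rewrite fE.
have fin : lebn origin \is a fin_num.
  by rewrite ge0_fin_numE// E0 lebn_eball_lty.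
rewrite -(fineK fin) -EFinM => -[].
set v := fine _; rewrite normr_nat => vE; congr EFin.
have : (1 - 2 ^- n) * v = 0 by rewrite mulrBl mul1r -vE subrr.
move=> /eqP; rewrite mulf_eq0 => /orP[|/eqP//].
rewrite subr_eq0 eq_sym invr_eq1 => /eqP h.
have : (1 < 2 ^+ n :> R) by rewrite exprn_egt1 ?ltr1n// -lt0n.
by rewrite h ltxx.
Qed.

Lemma ae_neq0 : (0 < n)%N -> {ae lebn, forall t, X t != 0}.
Proof.
move=> n0; exists origin; split; last 2 first.
- exact: lebn_origin.
- by move=> t /= /negP; rewrite negbK => /eqP.
rewrite (_ : origin = eball 0); first exact: measurable_eball.
apply/seteqP; split => t /=; first by rewrite /eball/= => ->; rewrite enorm0.
by move=> h; apply/eqP; rewrite -enorm_eq0 eq_le enorm_ge0 andbT; exact: h.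
Qed.

Lemma exists_dyadic (r : R) : 0 < r -> exists k : int, (2 : R) ^ k <= r < 2 ^ (k + 1).
Proof.
move=> r0; have ln2 : 0 < ln (2 : R) by rewrite ln_gt0// ltr1n.
have rE : r = 2 `^ (ln r / ln 2).
  rewrite /powR pnatr_eq0 /= divfK ?lnK//; last exact: lt0r_neq0.
exists (Num.floor (ln r / ln 2)); have := floor_itv (ln r / ln 2).
rewrite -!powR_intmul// => /andP[h1 h2]; rewrite {2 3}rE.
rewrite ler_powR ?ler1n//= /powR pnatr_eq0/= ltr_expR ltr_pM2r//.
Qed.

Lemma nneseries_geometric_le (r : R) : 0 <= r < 1 ->
  (\sum_(m <oo) (r ^+ m)%:E <= ((1 - r)^-1)%:E)%E.
Proof.
move=> /andP[r0 r1]; apply: lime_le.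
  by apply: is_cvg_nneseries => m _ _; rewrite lee_fin exprn_ge0.
apply: nearW => m; rewrite sumEFin lee_fin.
have r10 : 0 < 1 - r by rewrite subr_gt0.
rewrite -[leRHS]mul1r ler_pdivlMr// mulrC.
rewrite (_ : (1 - r) * _ = 1 - r ^+ m); first by rewrite gerBl exprn_ge0.
by rewrite -[1 in RHS](expr1n _ m) subrXX; congr (_ * _);
  rewrite big_mkord; apply: eq_bigr => i _; rewrite expr1n mul1r.
Qed.

Definition weight (e : R) (P : nat) x : R := enorm x `^ e * bracket x ^- P.

Lemma weight_ge0 e P x : 0 <= weight e P x.
Proof. by rewrite mulr_ge0 ?powR_ge0// invr_ge0 exprn_ge0// ltW// bracket_gt0. Qed.

Lemma meas_enorm_powR e : meas_rV (fun x => enorm x `^ e).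
Proof.
apply: (measurableT_comp (@measurable_powR R e)).
exact: continuous_meas_rV (@continuous_enorm R n).
Qed.

Lemma meas_bracketVn P : meas_rV (fun x => bracket x ^- P).
Proof.
rewrite /meas_rV (_ : _ \o _ = (fun r => r `^ (- P%:R)) \o (bracket \o X)).
  exact: measurableT_comp (@measurable_powR R _)
    (continuous_meas_rV (@continuous_bracket R n)).
by apply/funext => t /=; rewrite powR_invn// ltW// bracket_gt0.
Qed.

Lemma meas_weight e P : meas_rV (weight e P).
Proof. by apply: measurable_funM; [exact: meas_enorm_powR|exact: meas_bracketVn]. Qed.

Definition shell x : R := ((1 <= enorm x) && (enorm x < 2))%:R.

Lemma meas_shell : meas_rV shell.
Proof.
have mh := continuous_meas_rV (@continuous_enorm R n).
rewrite /meas_rV (_ : _ \o _ = \1_((@enorm R n \o X) @^-1` `[1, 2[%classic)).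
  apply: measurable_indic; rewrite -[X in measurable X]setTI.
  by apply: mh => //; exact: measurable_itv.
apply/funext => t /=; rewrite /shell indicE; congr (_%:R).
case: (boolP (_ && _)) => h; [rewrite mem_set//=|rewrite memNset//=]; rewrite in_itv//.
exact/negP.
Qed.

Lemma eint_shell_lty : (\int[lebn]_t (shell (X t))%:E < +oo)%E.
Proof.
apply: le_lt_trans (lebn_eball_lty 2).
rewrite -(setIT (eball 2)) -integral_indic//; last exact: measurable_eball.
apply: ge0_le_integral => //.
- by move=> t _; rewrite lee_fin.
- by apply/measurable_EFinP; exact: meas_shell.
- by apply/measurable_EFinP; apply: measurable_indic; exact: measurable_eball.
move=> t _; rewrite lee_fin /shell indicE.
case: (boolP (_ && _)) => [/andP[_ h]|_]; last by rewrite ler0n.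
by rewrite mem_set//=; exact: ltW.
Qed.

Lemma eint_shell_scale (c l : R) m : 0 <= c -> 0 < l ->
  (\int[lebn]_t (c ^+ m * shell (l ^+ m *: X t))%:E =
   ((c * l ^- n) ^+ m)%:E * \int[lebn]_t (shell (X t))%:E)%E.
Proof.
move=> c0 l0; have ml : emeas_rV (fun x => (shell x)%:E).
  by apply/measurable_EFinP; exact: meas_shell.
have lm : l ^+ m != 0 by rewrite expf_neq0// lt0r_neq0.
under eq_integral do rewrite EFinM.
rewrite ge0_integralZl_EFin//; last 3 first.
- by move=> t _; rewrite lee_fin ler0n.
- rewrite (_ : (fun _ => _) = fun t : T => (shell (l ^+ m *: X t + 0))%:E); last first.
    by apply/funext => t; rewrite addr0.
  exact: (measurable_affine_comp _ _ ml).
- exact: exprn_ge0.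
rewrite (eint_scale (f := fun x => (shell x)%:E))//; last by move=> x; rewrite lee_fin.
rewrite muleA -EFinM; congr (_%:E * _)%E.
rewrite exprMn exprVn normrX gtr0_norm//; congr (_ * _^-1).
by rewrite -!exprM mulnC.
Qed.

(** The point [x] lies in a shell 2^k <= |x| < 2^(k+1), and the weight is compared with the term of
    that shell. The first series serves |x| >= 1, where |x|^e <= [bracket x] uses up one of the [P]
    brackets; the second serves |x| < 1, where only the singularity of |x|^e matters. The maximum
    with 0 covers positive [e], for which the weight is at most 1 there. *)
Lemma weight_le_shells e P x : (0 < n < P)%N -> e <= 2 -> x != 0 ->
  ((weight e P x)%:E <=
   \sum_(m <oo) ((2 ^- n.+1) ^+ m * shell (2^-1 ^+ m *: x))%:E +
   \sum_(m <oo) (2 `^ (Num.max (- e) 0) ^+ m * shell (2 ^+ m *: x))%:E)%E.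
Proof.
move=> /andP[n0 nP] e2 x0.
have x_gt0 : 0 < enorm x by rewrite enorm_gt0.
have b_gt0 := bracket_gt0 x; have b_ge1 := bracket_ge1 x.
have term (c l : R) m : 0 <= c -> ((c ^+ m * shell (l ^+ m *: x))%:E <=
    \sum_(m <oo) (c ^+ m * shell (l ^+ m *: x))%:E)%E.
  move=> c0; have h0 i : (0 <= (c ^+ i * shell (l ^+ i *: x))%:E)%E.
    by rewrite lee_fin mulr_ge0 ?exprn_ge0// ler0n.
  rewrite -[leLHS]add0e; apply: le_trans (nneseries_lim_ge m.+1 _) => //.
  by rewrite big_nat_recr//= leeD2r// sume_ge0.
have [k /andP[k1 k2]] := exists_dyadic x_gt0.
have s1 (l : R) : 0 < l -> l * 2 ^ k = 1 -> shell (l *: x) = 1.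
  move=> l0 lk; have h1 : 1 <= l * enorm x by rewrite -lk ler_pM2l.
  rewrite /shell enormZ gtr0_norm// h1/=.
  rewrite (_ : 2 = l * 2 ^ (k + 1)) ?ltr_pM2l// ?k2//.
  by rewrite exprzDr ?unitfE ?pnatr_eq0// mulrA lk mul1r.
case: k k1 k2 s1 => m k1 k2 s1.
  apply: le_trans (leeDl _ _); last first.
    by apply: nneseries_ge0 => i _ _; rewrite lee_fin mulr_ge0 ?exprn_ge0 ?powR_ge0// ler0n.
  apply: le_trans (term _ _ m _); last by rewrite invr_ge0 exprn_ge0.
  rewrite s1 ?mulr1; last 2 first.
  - by rewrite exprn_gt0 ?invr_gt0.
  - by rewrite -exprnP -exprMn mulVf ?expr1n// pnatr_eq0.
  have m1 : 1 <= enorm x.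
    by apply: le_trans k1; rewrite -exprnP exprn_ege1// ler1n.
  rewrite lee_fin /weight.
  have xe : enorm x `^ e <= bracket x.
    apply: (@le_trans _ _ (enorm x `^ 2%:R)); first exact: ler_powR.
    by rewrite powR_mulrn ?enorm_ge0// sqr_enorm lerDr.
  (* At least n brackets remain after the one spent on |x|^e. They give 2^(2 m n), which exceeds
     2^(m (n + 1)) since n >= 1. *)
  have bP : bracket x * (2 ^+ m) ^+ n.+1 <= bracket x ^+ P.
    rewrite -(prednK (leq_ltn_trans (leq0n n) nP)) [leRHS]exprS ler_pM2l//.
    apply: (@le_trans _ _ (((2 ^+ m) ^+ 2) ^+ P.-1)).
      rewrite -(exprM _ 2) ler_weXn2l//; first by rewrite exprn_ege1// ler1n.
      by rewrite mul2n -addnn; lia.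
    rewrite lerXn2r// ?nnegrE ?exprn_ge0 ?(ltW b_gt0)//.
    apply: le_trans (_ : enorm x ^+ 2 <= _); last by rewrite bracketE lerDr.
    by rewrite lerXn2r// ?nnegrE ?exprn_ge0// ?enorm_ge0.
  rewrite -exprVn -exprM mulnC exprM exprVn exprVn.
  rewrite ler_pdivrMr ?exprn_gt0// [leRHS]mulrC ler_pdivlMr; last by rewrite !exprn_gt0.
  by apply: le_trans bP; rewrite ler_wpM2r// !exprn_ge0.
apply: le_trans (leeDr _ _); last first.
  by apply: nneseries_ge0 => i _ _; rewrite lee_fin mulr_ge0 ?exprn_ge0 ?invr_ge0 ?exprn_ge0// ler0n.
apply: le_trans (term _ _ m.+1 _); last exact: powR_ge0.
rewrite NegzE in k1 k2 s1; rewrite s1 ?mulr1; last 2 first.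
- by rewrite exprn_gt0.
- by rewrite -exprnN mulfV// expf_neq0// pnatr_eq0.
rewrite lee_fin /weight.
have x1 : enorm x <= 1.
  apply/ltW/(lt_le_trans k2).
  rewrite (_ : - m.+1%:Z + 1 = - m%:Z); last by lia.
  by rewrite -exprnN invf_le1 ?exprn_gt0// exprn_ege1// ler1n.
rewrite -[leRHS]mulr1 ler_pM ?powR_ge0 ?invr_ge0 ?exprn_ge0 ?(ltW b_gt0)//; last first.
  by rewrite invf_le1 ?exprn_gt0// exprn_ege1.
set g := Num.max _ _; have g0 : 0 <= g by rewrite le_max lexx orbT.
apply: (@le_trans _ _ (enorm x `^ (- g))).
  by rewrite ger_powR ?x_gt0// lerNl le_max lexx.
have -> : enorm x `^ (- g) = (enorm x)^-1 `^ g.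
  by rewrite -powR_inv1 ?(ltW x_gt0)// -powRrM mulN1r.
have -> : (2 `^ g) ^+ m.+1 = (2 ^+ m.+1) `^ g :> R.
  have powRX (y r : R) k : 0 <= y -> (y `^ r) ^+ k = (y ^+ k) `^ r.
    by move=> y0; rewrite -(powR_mulrn k (powR_ge0 y r)) -(powR_mulrn k y0) powRAC.
  exact: powRX.
rewrite ge0_ler_powR// ?nnegrE ?invr_ge0 ?(ltW x_gt0) ?exprn_ge0//.
by rewrite -[leRHS]invrK lef_pV2 ?posrE ?invr_gt0 ?exprn_gt0.
Qed.

(** After dilation the two series of [weight_le_shells] have geometric integrals, of ratios 1/2 and
    2^(max(-e, 0) - n). The condition - n < e makes the second ratio less than 1. *)
Lemma weight_lty e P : (0 < n)%N -> - n%:R < e -> e <= 2 -> (n < P)%N ->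
  (\int[lebn]_t (weight e P (X t))%:E < +oo)%E.
Proof.
move=> n0 ne e2 nP.
pose a : R := 2 ^- n.+1; pose c : R := 2 `^ (Num.max (- e) 0).
pose A m (t : T) := (a ^+ m * shell (2^-1 ^+ m *: X t))%:E.
pose B m (t : T) := (c ^+ m * shell (2 ^+ m *: X t))%:E.
have mS (l : R) : measurable_fun setT (fun t : T => shell (l *: X t)).
  rewrite (_ : (fun _ => _) = fun t : T => shell (l *: X t + 0)); last first.
    by apply/funext => t; rewrite addr0.
  exact: (measurable_affine_comp _ _ meas_shell).
have mA m : measurable_fun setT (A m).
  by apply/measurable_EFinP; apply: measurable_funM => //; exact: mS.
have mB m : measurable_fun setT (B m).
  by apply/measurable_EFinP; apply: measurable_funM => //; exact: mS.
have A0 m t : (0 <= A m t)%E.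
  by rewrite lee_fin mulr_ge0 ?exprn_ge0 ?invr_ge0 ?exprn_ge0// ler0n.
have B0 m t : (0 <= B m t)%E.
  by rewrite lee_fin mulr_ge0 ?exprn_ge0 ?powR_ge0// ler0n.
have SA0 t : (0 <= \sum_(m <oo) A m t)%E by apply: nneseries_ge0 => m _ _; exact: A0.
have SB0 t : (0 <= \sum_(m <oo) B m t)%E by apply: nneseries_ge0 => m _ _; exact: B0.
have mSA : measurable_fun setT (fun t => \sum_(m <oo) A m t)%E.
  by apply: ge0_emeasurable_sum => // m t _ _; exact: A0.
have mSB : measurable_fun setT (fun t => \sum_(m <oo) B m t)%E.
  by apply: ge0_emeasurable_sum => // m t _ _; exact: B0.
apply: (@le_lt_trans _ _ (\int[lebn]_t
    (\sum_(m <oo) A m t + \sum_(m <oo) B m t))%E).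
  apply: ae_ge0_le_integral => //.
  - by move=> t _; rewrite lee_fin weight_ge0.
  - by apply/measurable_EFinP; exact: meas_weight.
  - by move=> t _; exact: adde_ge0.
  - exact: emeasurable_funD.
  apply: filterS (ae_neq0 n0) => t xt0 _.
  by apply: weight_le_shells => //; rewrite n0.
rewrite ge0_integralD//.
have V := eint_shell_lty.
have c_ge0 : 0 <= c by exact: powR_ge0.
have geom (r : R) : 0 <= r < 1 ->
    (\sum_(m <oo) ((r ^+ m)%:E * \int[lebn]_t (shell (X t))%:E) < +oo)%E.
  move=> r01; have Vf : (\int[lebn]_t (shell (X t))%:E \is a fin_num)%E.
    by rewrite ge0_fin_numE// integral_ge0// => t _; rewrite lee_fin ler0n.
  rewrite -(fineK Vf); under eq_eseriesr do rewrite muleC.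
  rewrite nneseriesZl//; last first.
    by move=> m _; rewrite lee_fin exprn_ge0//; case/andP: r01.
  rewrite lte_mul_pinfty ?lee_fin ?fine_ge0//.
  - by apply: integral_ge0 => t _; rewrite lee_fin ler0n.
  - exact: le_lt_trans (nneseries_geometric_le r01) (ltry _).
apply: lte_add_pinfty.
- rewrite integral_nneseries//.
  under eq_eseriesr do rewrite eint_shell_scale ?invr_ge0 ?exprn_ge0 ?invr_gt0//.
  apply: geom; rewrite mulr_ge0 ?invr_ge0 ?exprn_ge0//= ?invr_ge0//.
  rewrite exprVn invrK /a exprS invfM -mulrA mulVf ?mulr1 ?invf_lt1 ?ltr1n//.
- rewrite integral_nneseries//.
  under eq_eseriesr do rewrite eint_shell_scale//.
  apply: geom; rewrite mulr_ge0 ?invr_ge0 ?exprn_ge0//=.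
  rewrite ltr_pdivrMr ?exprn_gt0// mul1r /c -powR_mulrn//.
  rewrite /powR pnatr_eq0/= ltr_expR ltr_pM2r ?ln_gt0 ?ltr1n//.
  by rewrite gt_max ltrNl ne ltr0n n0.
Qed.

End rV_integral.

Section integrable_rV_algebra.
Context {R : realType} {n : nat}.
Implicit Types (f g : 'rV[R]_n -> R).
Local Notation X := (@rV_of_tuple R n).

Lemma integrable_rVD f g : integrable_rV f -> integrable_rV g ->
  integrable_rV (fun x => f x + g x).
Proof. by move=> /(integrableD measurableT)/[apply]; apply: eq_integrable. Qed.

Lemma integrable_rVB f g : integrable_rV f -> integrable_rV g ->
  integrable_rV (fun x => f x - g x).
Proof. by move=> /(integrableB measurableT)/[apply]; apply: eq_integrable. Qed.

Lemma integrable_rVZ (c : R) f : integrable_rV f -> integrable_rV (fun x => c * f x).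
Proof. by move=> /(integrableZl measurableT c); apply: eq_integrable. Qed.

Lemma integrable_rV_norm f : integrable_rV f -> integrable_rV (fun x => `|f x|).
Proof. by move=> /(integrable_norm (mu := lebn R n)). Qed.

Lemma Rint_rVD f g : integrable_rV f -> integrable_rV g ->
  \int[lebn R n]_t (f (X t) + g (X t)) =
  \int[lebn R n]_t f (X t) + \int[lebn R n]_t g (X t).
Proof. by move=> f1 g1; exact: RintegralD. Qed.

Lemma Rint_rVB f g : integrable_rV f -> integrable_rV g ->
  \int[lebn R n]_t (f (X t) - g (X t)) =
  \int[lebn R n]_t f (X t) - \int[lebn R n]_t g (X t).
Proof. by move=> f1 g1; exact: RintegralB. Qed.

Lemma Rint_rVZ c f : integrable_rV f ->
  \int[lebn R n]_t (c * f (X t)) = c * \int[lebn R n]_t f (X t).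
Proof. by move=> f1; exact: RintegralZl. Qed.

Lemma le_Rint_rV f g : integrable_rV f -> integrable_rV g -> (forall x, f x <= g x) ->
  \int[lebn R n]_t f (X t) <= \int[lebn R n]_t g (X t).
Proof. by move=> f1 g1 fg; apply: le_Rintegral. Qed.

Lemma normr_Rint_rV f : integrable_rV f ->
  `|\int[lebn R n]_t f (X t)| <= \int[lebn R n]_t `|f (X t)|.
Proof. by move=> f1; exact: le_normr_Rintegral. Qed.

Lemma le_integrable_rV f g : meas_rV f -> (forall x, `|f x| <= g x) ->
  integrable_rV g -> integrable_rV f.
Proof.
move=> mf fg; apply: le_integrable => //; first exact/measurable_EFinP.
by move=> t _; rewrite /= lee_fin (le_trans (fg _))// ler_norm.
Qed.

End integrable_rV_algebra.

(** * Taylor bounds in one variable *)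

Section one_variable.
Context {R : realType}.
Implicit Types f g : R -> R.

Lemma is_derive_comp1 f g (t a b : R) :
  is_derive t 1 f a -> is_derive (f t) 1 g b -> is_derive t 1 (g \o f) (b * a).
Proof.
move=> [df <-] [dg <-]; apply: DeriveDef.
  by apply/derivable1_diffP; apply: differentiable_comp; exact/derivable1_diffP.
by rewrite -!derive1E derive1_comp.
Qed.

Lemma is_derive_mull (c u : R) : is_derive u 1 ( *%R c) c.
Proof.
rewrite (_ : ( *%R c) = (fun=> c) * id)//.
apply: is_derive_eq (is_deriveM (is_derive_cst c u 1) (is_derive_id u 1)) _.
by rewrite scaler0 addr0 /GRing.scale/= mulr1.
Qed.

Lemma is_derive_mulr (c u : R) : is_derive u 1 (fun v => v * c) c.
Proof. by under eq_fun do rewrite mulrC; exact: is_derive_mull. Qed.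

Lemma mvt_bound f (df : R -> R) (M a b : R) :
  (forall t : R, is_derive t 1 f (df t)) ->
  (forall t, `|t - a| <= `|b - a| -> `|df t| <= M) ->
  `|f b - f a| <= M * `|b - a|.
Proof.
move=> fdf dfM.
have cf c d : {within `[c, d], continuous f}.
  apply: derivable_within_continuous => t _; exact: (@ex_derive _ _ _ _ _ _ _ (fdf t)).
have [ab|/ltW ba] := leP a b.
  have [c + ->] := MVT_segment ab (fun t _ => fdf t) (cf a b).
  rewrite in_itv/= => /andP[ac cb]; rewrite normrM ler_wpM2r//; apply: dfM.
  by rewrite !ger0_norm ?subr_ge0// lerB.
have [c + fE] := MVT_segment ba (fun t _ => fdf t) (cf b a).
rewrite in_itv/= => /andP[bc ca]; rewrite distrC fE normrM distrC ler_wpM2r//.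
by apply: dfM; rewrite distrC [leRHS]distrC !ger0_norm ?subr_ge0// lerB.
Qed.

(** The mean value theorem for f(u) - u f'(0), and then for f', gives the constant [M] in place of
    the sharp [M / 2], which is enough below. *)
Lemma taylor1_bound f (df ddf : R -> R) (M t : R) :
  (forall u : R, is_derive u 1 f (df u)) -> (forall u : R, is_derive u 1 df (ddf u)) ->
  (forall u, `|ddf u| <= M) ->
  `|f t - f 0 - t * df 0| <= M * t ^+ 2.
Proof.
move=> fdf dfddf ddfM.
have M0 : 0 <= M by apply: le_trans (ddfM 0).
pose g u := f u - u * df 0.
have gd (u : R) : is_derive u 1 g (df u - df 0).
  exact: (is_deriveB (fdf u) (is_derive_mulr (df 0) u)).
have := @mvt_bound g _ (M * `|t|) 0 t gd.
rewrite /g mul0r !subr0 => h.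
rewrite (_ : _ - _ = f t - t * df 0 - f 0); last by lra.
apply: le_trans (h _) _; last by rewrite -mulrA -expr2 real_normK ?num_real.
move=> u ut; apply: le_trans (mvt_bound dfddf _) _; first by move=> v _; exact: ddfM.
by rewrite subr0 in ut *; rewrite ler_wpM2l.
Qed.

End one_variable.

(** * Smooth and radial functions *)

Section smooth_functions.
Context {R : realType} {n : nat}.
Local Notation V := 'rV[R]_n.
Local Notation e i := (delta_mx 0 i : V).
Implicit Types (f g h : V -> R) (N : nat).

Lemma is_derive_line h (x v : V) (d : R) :
  is_derive (0 : R) 1 (fun t : R => h (t *: v + x)) d -> is_derive x v h d.
Proof.
move=> [dh hd]; apply: DeriveDef; first exact/derivable1P.
rewrite -hd /derive.
set g1 := fun t => t^-1 *: _; set g2 := fun t => t^-1 *: _; suff -> : g1 = g2 by [].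
apply/funext => t; rewrite /g1 /g2 /=.
by rewrite addr0 scale0r add0r [_%:A]mulr1.
Qed.

Lemma line_is_derive h dh (x v : V) (t : R) :
  is_derive (t *: v + x) v h dh -> is_derive t 1 (fun t : R => h (t *: v + x)) dh.
Proof.
move=> [/derivable1P d1 d2].
have E : (fun u : R => h (u *: v + (t *: v + x))) = (fun u : R => h ((u + t) *: v + x)).
  by apply/funext => u; rewrite scalerDl addrA.
apply: DeriveDef.
  apply/derivable1P; move: d1; rewrite E.
  by under eq_fun do rewrite -{1}[u in u + t]mulr1.
rewrite -d2 /derive.
set g1 := fun t => t^-1 *: _; set g2 := fun t => t^-1 *: _; suff -> : g1 = g2 by [].
apply/funext => u; rewrite /g1 /g2 /=.
by rewrite scalerDl addrA [_%:A]mulr1.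
Qed.

(** The partial derivatives are given existentially. Closure under sums, products and affine maps is
    then a plain induction on [N], with no formula for iterated derivatives; [smoothP] makes the
    connection with [smooth]. *)
Fixpoint Cn N h : Prop := continuous h /\
  if N is N'.+1 then forall i, exists h',
    (forall x, is_derive x (e i) h (h' x)) /\ Cn N' h'
  else True.

Lemma Cn_continuous N h : Cn N h -> continuous h.
Proof. by case: N => [|N] []. Qed.

Lemma smooth_deriv h i : smooth h -> smooth ('D_(e i) h).
Proof.
move=> sh l; have := sh (rcons l i).
by rewrite /pder foldr_rcons.
Qed.

Lemma smooth_is_derive h i x : smooth h -> is_derive x (e i) h ('D_(e i) h x).
Proof. by move=> sh; apply: derivableP; have [_] := sh [::]; exact. Qed.

Lemma smoothP h : smooth h <-> forall N, Cn N h.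
Proof.
split=> [sh N|].
  elim: N h sh => [|N IH] h sh; split=> //; try by have [] := sh [::].
  move=> i; exists ('D_(e i) h); split; first by move=> x; exact: smooth_is_derive.
  exact/IH/smooth_deriv.
move=> Ch l; elim/last_ind: l h Ch => [|l i IH] h Ch.
  split; first exact: Cn_continuous (Ch 0%N).
  move=> x i; have [_ /(_ i)[h' [hh' _]]] := Ch 1%N; exact: (@ex_derive _ _ _ _ _ _ _ (hh' x)).
rewrite /pder foldr_rcons; apply: IH => N.
have [_ /(_ i)[h' [hh' Ch']]] := Ch N.+1.
suff -> : 'D_(e i) h = h' by [].
by apply/funext => x; have [] := hh' x.
Qed.

Lemma smooth_continuous h : smooth h -> continuous h.
Proof. by move=> sh; have [] := sh [::]. Qed.

Lemma CnS N h : Cn N.+1 h -> Cn N h.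
Proof.
elim: N h => [|N IH] h [ch hd]; split => // i.
by have [h' [? ?]] := hd i; exists h'; split => //; exact: IH.
Qed.

Lemma Cn_cst N (c : R) : Cn N (fun=> c).
Proof.
elim: N c => [|N IH] c; split=> //; try exact: cst_continuous.
by move=> i; exists (fun=> 0); split => // x; exact: is_derive_cst.
Qed.

Lemma CnD N f g : Cn N f -> Cn N g -> Cn N (fun x => f x + g x).
Proof.
elim: N f g => [|N IH] f g [cf df] [cg dg]; (split; first by
  move=> x; exact: (cvgD (cf x) (cg x))) => // i.
have [f' [ff' Cf']] := df i; have [g' [gg' Cg']] := dg i.
by exists (fun x => f' x + g' x); split; [move=> x; exact: is_deriveD|exact: IH].
Qed.

Lemma CnM N f g : Cn N f -> Cn N g -> Cn N (fun x => f x * g x).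
Proof.
elim: N f g => [|N IH] f g Cf Cg; have [cf df] := Cf; have [cg dg] := Cg;
  (split; first by move=> x; exact: (cvgM (cf x) (cg x))) => // i.
have [f' [ff' Cf']] := df i; have [g' [gg' Cg']] := dg i.
exists (fun x => f x * g' x + g x * f' x); split.
  by move=> x; exact: (is_deriveM (ff' x) (gg' x)).
by apply: CnD; apply: IH => //; exact: CnS.
Qed.

Lemma is_derive_coord (x : V) i j :
  is_derive x (e i) (fun y : V => y 0 j : R) (i == j)%:R.
Proof.
apply: is_derive_line; under eq_fun do rewrite !mxE eqxx/=.
rewrite eq_sym; apply: is_derive_eq.
by rewrite scaler0 add0r addr0 /GRing.scale/= mulr1.
Qed.

Lemma Cn_coord N j : Cn N (fun x : V => x 0 j : R).
Proof.
case: N => [|N]; (split; first exact: coord_continuous) => // i.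
by exists (fun=> (i == j)%:R); split; [move=> x; exact: is_derive_coord|exact: Cn_cst].
Qed.

Lemma continuous_affine (c : R) (b : V) : continuous (fun x : V => c *: x + b).
Proof. by move=> x; exact: (cvgD (@scaler_continuous _ _ c x) (cvg_cst b)). Qed.

Lemma continuous_dot_addr (y : V) (a : R) : continuous (fun x : V => dot x y + a).
Proof.
have cd : continuous (fun x : V => dot x y).
  by apply: (continuous_dot (f := id) (g := fun=> y)); [move=> z; exact: cvg_id|exact: cst_continuous].
by move=> x; exact: (cvgD (cd x) (cvg_cst a)).
Qed.

Lemma Cn_affine N h (c : R) (b : V) : Cn N h -> Cn N (fun x => h (c *: x + b)).
Proof.
elim: N h => [|N IH] h [ch dh]; (split; first by
  move=> x; apply: (@continuous_comp _ _ _ (fun x : V => c *: x + b) h);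
    [exact: continuous_affine|exact: ch]) => // i.
have [h' [hh' Ch']] := dh i.
exists (fun x => h' (c *: x + b) * c); split; last first.
  by apply: CnM; [exact: IH|exact: Cn_cst].
move=> x; apply: is_derive_line.
rewrite (_ : (fun _ => _) = (fun t => h (t *: e i + (c *: x + b))) \o (fun t => c * t)).
  apply: is_derive_comp1; last first.
    by apply: line_is_derive; rewrite mulr0 scale0r add0r; exact: hh'.
  exact: is_derive_mull.
by apply/funext => t /=; rewrite scalerDr scalerA addrA.
Qed.

Lemma is_derive_dotr (x y : V) i : is_derive x (e i) (fun x => dot x y) (y 0 i).
Proof.
rewrite (_ : (fun _ => _) = \sum_(j < n) (fun x : V => x 0 j * y 0 j)); last first.
  by apply/funext => z; rewrite fct_sumE.
apply: is_derive_eq.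
  apply: is_derive_sum => j.
  exact: (is_deriveM (is_derive_coord x i j) (is_derive_cst (y 0 j) x (e i))).
rewrite (bigD1 i)//= eqxx scaler0 add0r big1 ?addr0 => [|j ji].
  by rewrite /GRing.scale/= mulr1.
by rewrite scaler0 add0r eq_sym (negbTE ji) scaler0.
Qed.

Lemma Cn_cos N (y : V) (a : R) : Cn N (fun x => cos (dot x y + a)).
Proof.
elim: N a => [|N IH] a; (split; first by
  move=> x; apply: (@continuous_comp _ _ _ (fun x => dot x y + a) cos);
    [exact: continuous_dot_addr|exact: continuous_cos]) => // i.
exists (fun x => y 0 i * cos (dot x y + (a + pi / 2))); split; last first.
  by apply: CnM; [exact: Cn_cst|exact: IH].
move=> x; rewrite addrA cosDpihalf mulrC; apply: is_derive_line.
apply: is_derive_comp1; last by rewrite scale0r add0r; exact: is_derive_cos.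
apply: (@line_is_derive (fun x => dot x y + a)).
apply: is_derive_eq (is_deriveD (is_derive_dotr _ y i) (is_derive_cst a _ _)) _.
by rewrite addr0.
Qed.

Lemma smooth_cst (c : R) : smooth (fun _ : V => c).
Proof. by apply/smoothP => N; exact: Cn_cst. Qed.

Lemma smoothD f g : smooth f -> smooth g -> smooth (fun x => f x + g x).
Proof. by move=> /smoothP sf /smoothP sg; apply/smoothP => N; exact: CnD. Qed.

Lemma smoothM f g : smooth f -> smooth g -> smooth (fun x => f x * g x).
Proof. by move=> /smoothP sf /smoothP sg; apply/smoothP => N; exact: CnM. Qed.

Lemma smooth_coord j : smooth (fun x : V => x 0 j : R).
Proof. by apply/smoothP => N; exact: Cn_coord. Qed.

Lemma smooth_affine h (c : R) (b : V) : smooth h -> smooth (fun x => h (c *: x + b)).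
Proof. by move=> /smoothP sh; apply/smoothP => N; exact: Cn_affine. Qed.

Lemma smooth_cos (y : V) (a : R) : smooth (fun x => cos (dot x y + a)).
Proof. by apply/smoothP => N; exact: Cn_cos. Qed.

Definition test_fun h := smooth h /\ exists r : R, forall x, h x != 0 -> enorm x <= r.

Lemma deriv_support h (r : R) i x :
  (forall y, h y != 0 -> enorm y <= r) -> 'D_(e i) h x != 0 -> enorm x <= r.
Proof.
move=> hr; apply: contraNT; rewrite -ltNge => rx.
suff fg : \near x, (cst 0 : V -> R) x = h x.
  by have [_ ->] := near_eq_is_derive fg (is_derive_cst 0 x (e i)).
near=> y; apply/esym/eqP; apply: contraT => /hr; rewrite leNgt => /negP[].
near: y; move: rx; have /(_ x) := @continuous_enorm R n.
by move=> /cvgr_gt; apply.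
Unshelve. all: by end_near. Qed.

Lemma test_fun_deriv h i : test_fun h -> test_fun ('D_(e i) h).
Proof.
move=> [sh [r hr]]; split; first exact: smooth_deriv.
by exists r => x; exact: deriv_support.
Qed.

Lemma test_funMr f h : smooth f -> test_fun h -> test_fun (fun x => f x * h x).
Proof.
move=> sf [sh [r hr]]; split; first exact: smoothM.
by exists r => x; rewrite mulf_eq0 negb_or => /andP[_ /hr].
Qed.

Lemma test_funD f h : test_fun f -> test_fun h -> test_fun (fun x => f x + h x).
Proof.
move=> [sf [r1 h1]] [sh [r2 h2]]; split; first exact: smoothD.
exists (Num.max r1 r2) => x; rewrite le_max.
have [f0|f0 _] := eqVneq (f x) 0; last by rewrite h1.
by rewrite f0 add0r => /h2 ->; rewrite orbT.
Qed.

Lemma test_fun0 : test_fun (fun=> 0).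
Proof. by split; [exact: smooth_cst|exists 0 => x; rewrite eqxx]. Qed.

Lemma test_fun_sum (I : Type) (s : seq I) (F : I -> V -> R) :
  (forall i, test_fun (F i)) -> test_fun (fun x => \sum_(i <- s) F i x).
Proof.
move=> bF; elim: s => [|i s IH].
  by under eq_fun do rewrite big_nil; exact: test_fun0.
by under eq_fun do rewrite big_cons; exact: test_funD.
Qed.

Lemma test_funZ (c : R) h : test_fun h -> test_fun (fun x => c * h x).
Proof. by apply: test_funMr; exact: smooth_cst. Qed.

Lemma test_fun_affine h (c : R) (b : V) : c != 0 -> test_fun h -> test_fun (fun x => h (c *: x + b)).
Proof.
move=> c0 [sh [r hr]]; split; first exact: smooth_affine.
exists ((r + enorm b) / `|c|) => x /hr xr.
rewrite ler_pdivlMr ?normr_gt0// mulrC -enormZ -[c *: x](addrK b).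
by rewrite (le_trans (enorm_subr_le _ _))// lerD2r.
Qed.

Lemma test_fun_continuous h : test_fun h -> continuous h.
Proof. by move=> [/smooth_continuous]. Qed.

Lemma compact_eball (r : R) : compact [set x : V | enorm x <= r].
Proof.
apply: bounded_closed_compact.
  exists r; split; first exact: num_real.
  by move=> s rs x /= xr; rewrite (le_trans (rV_norm_le_enorm x))// (le_trans xr)// ltW.
rewrite (_ : [set _ | _] = (@enorm R n) @^-1` [set y | y <= r])//.
by apply: closed_comp; [move=> x _; exact: continuous_enorm|exact: closed_le].
Qed.

Lemma continuous_csupp_bounded h (r : R) : continuous h ->
  (forall x, h x != 0 -> enorm x <= r) -> exists M : R, forall x, `|h x| <= M.
Proof.
move=> ch hr; pose A := [set x : V | enorm x <= `|r|].
have A0 : A !=set0 by exists 0; rewrite /A/= enorm0.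
have cA : {within A, continuous (fun x => `|h x|)}.
  apply: continuous_subspaceT => x.
  by apply: (@continuous_comp _ _ _ h Num.norm); [exact: ch|exact: norm_continuous].
have [c _ hc] := EVT_max_rV A0 (@compact_eball _) cA.
exists `|h c| => x; have [->|hx] := eqVneq (h x) 0; first by rewrite normr0.
by apply: hc; rewrite inE /A/= (le_trans (hr _ hx))// ler_norm.
Qed.

Lemma test_fun_bounded h : test_fun h -> exists M : R, forall x, `|h x| <= M.
Proof. by move=> [sh [r hr]]; apply: continuous_csupp_bounded hr; exact: smooth_continuous. Qed.

Lemma integrable_csupp h (r : R) : continuous h ->
  (forall x, h x != 0 -> enorm x <= r) -> integrable_rV h.
Proof.
move=> ch hr; have [M hM] := continuous_csupp_bounded ch hr.
apply/integrable_rVP; split; first exact: continuous_meas_rV.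
have mh : measurable_fun setT (fun t => h (rV_of_tuple t)) := continuous_meas_rV ch.
have mB := measurable_eball (n := n) r.
apply: (@le_lt_trans _ _ (\int[lebn R n]_t (`|M| * \1_(eball r) t)%:E)%E).
  apply: ge0_le_integral => //.
  - by apply/measurable_EFinP; exact: measurableT_comp.
  - by apply/measurable_EFinP; apply: measurable_funM => //; exact: measurable_indic.
  move=> t _; rewrite lee_fin indicE.
  have [->|h0] := eqVneq (h (rV_of_tuple t)) 0; first by rewrite normr0 mulr_ge0.
  by rewrite mem_set ?mulr1 ?(le_trans (hM _)) ?ler_norm//; exact: hr.
under eq_integral do rewrite EFinM.
rewrite ge0_integralZl_EFin//; last by apply/measurable_EFinP; exact: measurable_indic.
rewrite integral_indic// setIT lte_mul_pinfty// ?lee_fin//.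
exact: lebn_eball_lty.
Qed.

Lemma test_fun_integrable h : test_fun h -> integrable_rV h.
Proof. by move=> [/smooth_continuous ch [r hr]]; exact: integrable_csupp hr. Qed.

(* The integral of a derivative vanishes because the integral is translation
   invariant: the difference quotients all integrate to 0. *)
Lemma Rint_deriv h i : test_fun h ->
  \int[lebn R n]_t 'D_(e i) h (rV_of_tuple t) = 0.
Proof.
move=> bh; have [sh [r hr]] := bh.
have bh' := test_fun_deriv i bh; have bh'' := test_fun_deriv i bh'.
have [M hM] := test_fun_bounded bh''.
have M0 : 0 <= M by apply: le_trans (hM 0).
set I := Rintegral _ _ _.
pose V0 : R := fine (lebn R n (eball (r + 1))).
suff hI (t : R) : 0 < t < 1 -> `|I| <= t * (M * V0).
  apply/eqP; rewrite -normr_le0; apply/ler_addgt0Pr => eps eps0; rewrite add0r.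
  have K0 : 0 <= M * V0 by rewrite mulr_ge0 ?fine_ge0.
  pose t := Num.min (1 / 2) (eps / (M * V0 + 1)).
  have t01 : 0 < t < 1.
    by rewrite lt_min gt_min !divr_gt0 ?ltr01 ?ltr_wpDl//= ltr_pdivrMr// mul1r ltr1n.
  apply: le_trans (hI _ t01) _; apply: (@le_trans _ _ (eps / (M * V0 + 1) * (M * V0))).
    by rewrite ler_wpM2r// ge_min lexx orbT.
  by rewrite -mulrA ger_pMr// ler_pdivrMl ?ltr_wpDl// mulr1 lerDl.
move=> /andP[t0 t1].
have ih := test_fun_integrable bh; have ih' := test_fun_integrable bh'.
have iha : integrable_rV (fun x => h (1 *: x + t *: e i)).
  exact: integrable_rV_affine (oner_neq0 _) ih.
have IE : t * I = - \int[lebn R n]_u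
    (h (1 *: rV_of_tuple u + t *: e i) - h (rV_of_tuple u) - t * 'D_(e i) h (rV_of_tuple u)).
  rewrite (Rint_rVB (integrable_rVB iha ih) (integrable_rVZ t ih')).
  rewrite (Rint_rVB iha ih) (Rint_rVZ _ ih').
  by rewrite (Rint_affine _ (oner_neq0 _) ih) normr1 expr1n invr1 mul1r subrr sub0r opprK.
rewrite -(ler_pM2l t0) -{1}(gtr0_norm t0) -normrM IE normrN.
have i3 : integrable_rV (fun x => h (1 *: x + t *: e i) - h x - t * 'D_(e i) h x).
  exact: integrable_rVB (integrable_rVB iha ih) (integrable_rVZ t ih').
apply: le_trans (normr_Rint_rV i3) _.
have mB := measurable_eball (n := n) (r + 1).
have iB : (lebn R n).-integrable setT (EFin \o (\1_(eball (r + 1)) : _ -> R)).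
  apply/integrableP; split; first by apply/measurable_EFinP; exact: measurable_indic.
  under eq_integral => u _ do rewrite /= ger0_norm//.
  by rewrite integral_indic// setIT lebn_eball_lty.
apply: (@le_trans _ _ (\int[lebn R n]_u (t ^+ 2 * M * \1_(eball (r + 1)) u))).
  have iB2 : (lebn R n).-integrable setT (EFin \o (fun u => t ^+ 2 * M * \1_(eball (r + 1)) u)).
    by have := integrableZl measurableT (t ^+ 2 * M) iB; apply: eq_integrable.
  apply: le_Rintegral => //; first exact: integrable_rV_norm i3.
  move=> u _; rewrite indicE; set x := rV_of_tuple u.
  have [xr|] := boolP (u \in eball (r + 1)).
    have df (v : R) : is_derive v 1 (fun t : R => h (t *: e i + x)) ('D_(e i) h (v *: e i + x)).
      by apply: line_is_derive; exact: smooth_is_derive.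
    have ddf (v : R) : is_derive v 1 (fun t : R => 'D_(e i) h (t *: e i + x))
        ('D_(e i) ('D_(e i) h) (v *: e i + x)).
      by apply: (line_is_derive (h := 'D_(e i) h)); apply: smooth_is_derive; exact: smooth_deriv.
    have := taylor1_bound t df ddf (fun v => hM _).
    by rewrite !scale0r !add0r mulr1 (mulrC (t ^+ 2)) scale1r (addrC x).
  rewrite notin_setE /eball/= => /negP; rewrite -ltNge => rx.
  have z (g : V -> R) y : (forall x, g x != 0 -> enorm x <= r) -> enorm (x - y) <= 1 -> g y = 0.
    move=> gr xy; apply/eqP; apply: contraT => /gr yr; move: rx; rewrite ltNge => /negP[].
    by rewrite -/x -[x](subrK y) (le_trans (enorm_triangle _ _))// addrC lerD.
  rewrite (z h)// ?(z h x)// ?(z _ x (@deriv_support h r i ^~ hr))//.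
  - by rewrite mulr0 !subr0 normr0 mulr0.
  - by rewrite subrr enorm0.
  - by rewrite subrr enorm0.
  rewrite scale1r opprD addNKr enormN enormZ gtr0_norm// /enorm dot_delta mxE !eqxx sqrtr1 mulr1.
  exact: ltW.
rewrite RintegralZl// /V0 -mulrA expr2 -!mulrA.
rewrite ler_pM2l// ler_pM2l// ler_wpM2l//.
by rewrite /Rintegral (_ : (fun _ => _) = EFin \o \1_(eball (r + 1)))// integral_indic// setIT.
Qed.

End smooth_functions.

(** * Smoothness of radial functions supported away from the origin *)

Section radial_functions.
Context {R : realType} {n : nat}.
Local Notation V := 'rV[R]_n.
Local Notation e i := (delta_mx 0 i : V).
Variables (phi : R -> R) (c d : R).
Hypothesis c0 : 0 < c.
Hypothesis phi_derivable : forall (j : nat) (r : R), derivable (phi^`(j))%classic r 1.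
Hypothesis phi_supp : forall r, phi r != 0 -> c <= r <= d.
Local Notation phij j := (phi^`(j))%classic.

Lemma phij_supp j r : phij j r != 0 -> c <= r <= d.
Proof.
elim: j r => [|j IH] r; first by rewrite derive1n0; exact: phi_supp.
apply: contraNT => rcd; rewrite derive1nS derive1E.
suff /near_eq_derive -> : \near r, phij j r = cst 0 r by rewrite derive_cst.
move: rcd; rewrite negb_and -!ltNge => /orP[rc|dr]; near=> z; apply/eqP;
  apply: contraT => /IH /andP[cz zd].
  suff : z < c by rewrite ltNge cz.
  by near: z; exact: lt_nbhsl.
suff : d < z by rewrite ltNge zd.
by near: z; exact: lt_nbhsr.
Unshelve. all: by end_near. Qed.

Lemma is_derive_phij j (r : R) : is_derive r 1 (phij j) (phij j.+1 r).
Proof. by rewrite derive1nS derive1E; exact: derivableP. Qed.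

(** Up to coordinate factors this family is closed under partial differentiation, see
    [is_derive_radial]; smoothness follows by induction. As [phi] vanishes below c > 0, no power [p]
    creates a singularity at the origin. *)
Definition radial j (p lam : R) (x : V) : R := phij j (enorm x / lam) * enorm x `^ p.

Lemma radial_near0 j p lam : 0 < lam -> \forall y \near (0 : V), (cst 0 : V -> R) y = radial j p lam y.
Proof.
move=> lam0; near=> y; rewrite /radial /=.
suff /eqP -> : phij j (enorm y / lam) == 0 by rewrite mul0r.
apply: contraT => /phij_supp /andP[+ _]; rewrite ler_pdivlMr// leNgt => /negP[].
near: y; have /(_ (0 : V)) := @continuous_enorm R n.
by move=> /cvgr_lt; apply; rewrite enorm0 mulr_gt0.
Unshelve. all: by end_near. Qed.

Lemma enorm_powRE (x : V) (p : R) : enorm x `^ p = (dot x x) `^ (2^-1 * p).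
Proof. by rewrite powRrM powR12_sqrt ?dot_ge0. Qed.

(** The same function in the variable s = |x|^2, which is quadratic along coordinate lines. This
    avoids differentiating the norm. *)
Definition radial_profile j (p lam s : R) : R := phij j (s `^ 2^-1 / lam) * s `^ (2^-1 * p).

Lemma radialE j p lam x : radial j p lam x = radial_profile j p lam (dot x x).
Proof. by rewrite /radial /radial_profile -enorm_powRE powR12_sqrt ?dot_ge0. Qed.

Lemma is_derive_radial_profile j (p lam s : R) : 0 < s ->
  is_derive s 1 (radial_profile j p lam)
   (2^-1 * (lam^-1 * phij j.+1 (s `^ 2^-1 / lam) * s `^ (2^-1 * (p - 1)) +
     p * phij j (s `^ 2^-1 / lam) * s `^ (2^-1 * (p - 2)))).
Proof.
move=> s0.
have d1 : is_derive s 1 (fun s => phij j (s `^ 2^-1 / lam))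
    (phij j.+1 (s `^ 2^-1 / lam) * (lam^-1 * (2^-1 * s `^ (2^-1 - 1)))).
  apply: (is_derive_comp1 (f := fun s => s `^ 2^-1 / lam) (g := phij j)).
    apply: (is_derive_comp1 (f := fun s => s `^ 2^-1) (g := fun s => s / lam)).
      exact: is_derive1_powR.
    exact: is_derive_mulr.
  exact: is_derive_phij.
apply: is_derive_eq (is_deriveM d1 (is_derive1_powR (2^-1 * p) s0)) _.
rewrite /GRing.scale/=.
have -> : s `^ (2^-1 * (p - 1)) = s `^ (2^-1 * p) * s `^ (2^-1 - 1).
  rewrite -powRD; last by rewrite (gt_eqF s0) implybT.
  by congr (_ `^ _); field.
have -> : s `^ (2^-1 * (p - 2)) = s `^ (2^-1 * p - 1) by congr (_ `^ _); field.
ring.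
Qed.

Lemma is_derive_radial j (p lam : R) (x : V) i : 0 < lam ->
  is_derive x (e i) (radial j p lam)
    (x 0 i * (lam^-1 * radial j.+1 (p - 1) lam x + p * radial j (p - 2) lam x)).
Proof.
move=> lam0; have [->|x0] := eqVneq x 0.
  rewrite mxE mul0r.
  exact: near_eq_is_derive (radial_near0 j p lam0) (is_derive_cst 0 _ _).
have s0 : 0 < dot x x by rewrite -sqr_enorm exprn_gt0// enorm_gt0.
apply: is_derive_line.
have -> : (fun t : R => radial j p lam (t *: e i + x)) =
    radial_profile j p lam \o (fun t => t * (t + 2 * x 0 i) + dot x x).
  apply/funext => t; rewrite radialE /=; congr (radial_profile _ _ _ _).
  have ee : dot (e i) (e i) = 1 by rewrite dot_delta mxE !eqxx.
  by rewrite !(dotDl, dotDr, dotZl, dotZr) ee (dotC (e i) x) dot_delta; ring.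
have dq : is_derive (0 : R) 1 (fun t : R => t * (t + 2 * x 0 i) + dot x x) (2 * x 0 i).
  apply: is_derive_eq.
  by rewrite /GRing.scale/=; ring.
have dp : is_derive ((0 : R) * (0 + 2 * x 0 i) + dot x x) 1 (radial_profile j p lam)
   (2^-1 * (lam^-1 * phij j.+1 (dot x x `^ 2^-1 / lam) * dot x x `^ (2^-1 * (p - 1)) +
     p * phij j (dot x x `^ 2^-1 / lam) * dot x x `^ (2^-1 * (p - 2)))).
  by rewrite mul0r add0r; exact: is_derive_radial_profile.
apply: is_derive_eq (is_derive_comp1 dq dp) _.
by rewrite !radialE /radial_profile; field; rewrite gt_eqF.
Qed.

Lemma continuous_radial j p lam : 0 < lam -> continuous (radial j p lam).
Proof.
move=> lam0 x; have [->|x0] := eqVneq x 0.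
  have := radial_near0 j p lam0 => h.
  rewrite /continuous_at -(nbhs_singleton h) /=.
  exact: cvg_trans (near_eq_cvg h) (cvg_cst _).
have s0 : 0 < dot x x by rewrite -sqr_enorm exprn_gt0// enorm_gt0.
rewrite (_ : radial j p lam = radial_profile j p lam \o (fun x => dot x x)); last first.
  by apply/funext => y; rewrite radialE.
apply: continuous_comp.
  by apply: (continuous_dot (f := id) (g := id)) => z; exact: cvg_id.
apply/differentiable_continuous/derivable1_diffP.
exact: (@ex_derive _ _ _ _ _ _ _ (is_derive_radial_profile j p lam s0)).
Qed.

Lemma Cn_radial N j p lam : 0 < lam -> Cn N (radial j p lam).
Proof.
move=> lam0; elim: N j p => [|N IH] j p; (split; first exact: continuous_radial) => // i.
exists (fun x : V => x 0 i * (lam^-1 * radial j.+1 (p - 1) lam x + p * radial j (p - 2) lam x)).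
split; first by move=> x; exact: is_derive_radial.
apply: CnM; first exact: Cn_coord.
by apply: CnD; apply: CnM => //; exact: Cn_cst.
Qed.

Lemma radial_supp j p lam x : 0 < lam -> radial j p lam x != 0 ->
  c * lam <= enorm x <= d * lam.
Proof.
move=> lam0; rewrite mulf_eq0 negb_or => /andP[/phij_supp + _].
by rewrite ler_pdivlMr// ler_pdivrMr.
Qed.

Lemma test_fun_radial j p lam : 0 < lam -> test_fun (radial j p lam).
Proof.
move=> lam0; split; first by apply/smoothP => N; exact: Cn_radial.
by exists (d * lam) => x /(radial_supp lam0) /andP[].
Qed.

End radial_functions.

(** * Exchange of integrals and positivity *)

Section fubini_rV.
Context {R : realType} {n : nat}.
Local Notation T := (n.-tuple (measurableTypeR R)).
Local Notation X := (@rV_of_tuple R n).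
Local Notation V := 'rV[R]_n.
Local Notation lebn := (lebn R n).

(** Fubini with the majorant |a(x)| |b(y)|. In all uses [k] is a cosine, and the lemma then moves a
    cosine transform from one factor to the other. *)
Lemma Rint_swap (a b : V -> R) (k : V -> V -> R) :
  integrable_rV a -> integrable_rV b ->
  measurable_fun [set: T * T] (fun st => k (X st.1) (X st.2)) ->
  (forall x y, `|k x y| <= 1) ->
  \int[lebn]_s (a (X s) * \int[lebn]_t (b (X t) * k (X s) (X t))) =
  \int[lebn]_t (b (X t) * \int[lebn]_s (a (X s) * k (X s) (X t))).
Proof.
move=> ia ib mk k1.
have [ma _] := (integrable_rVP a).1 ia; have [mb _] := (integrable_rVP b).1 ib.
pose f (st : T * T) : \bar R := (a (X st.1) * (b (X st.2) * k (X st.1) (X st.2)))%:E.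
have mf : measurable_fun setT f.
  apply/measurable_EFinP; apply: measurable_funM.
    exact: (measurableT_comp ma (@measurable_fst _ _ T T)).
  apply: measurable_funM => //.
  exact: (measurableT_comp mb (@measurable_snd _ _ T T)).
have ibk s : lebn.-integrable setT (fun t => (b (X t) * k (X s) (X t))%:E).
  apply: (le_integrable _ _ _ ib) => //.
    apply/measurable_EFinP; apply: measurable_funM => //.
    exact: (measurableT_comp mk (measurable_pair1 s)).
  by move=> t _; rewrite /= lee_fin normrM ler_piMr.
have iak t : lebn.-integrable setT (fun s => (a (X s) * k (X s) (X t))%:E).
  apply: (le_integrable _ _ _ ia) => //.
    apply/measurable_EFinP; apply: measurable_funM => //.
    exact: (measurableT_comp mk (measurable_pair2 t)).
  by move=> s _; rewrite /= lee_fin normrM ler_piMr.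
have if_ : (lebn \x lebn)%E.-integrable setT f.
  apply/(integrable12ltyP _ _ mf).
  apply: (@le_lt_trans _ _ (\int[lebn]_s (`|a (X s)|%:E * \int[lebn]_t `|b (X t)|%:E))%E).
    apply: ge0_le_integral => //.
    - by move=> s _; apply: integral_ge0.
    - apply: (measurable_fun_fubini_tonelli_F (abse \o f)) => //=.
      exact: measurableT_comp.
    - apply: emeasurable_funM => //.
      by apply/measurable_EFinP; exact: measurableT_comp.
    move=> s _; rewrite -ge0_integralZl//; last first.
      by apply/measurable_EFinP; exact: measurableT_comp.
    apply: ge0_le_integral => //.
    - by apply: measurableT_comp => //; exact: (measurableT_comp mf (measurable_pair1 s)).
    - by apply: emeasurable_funM => //; apply/measurable_EFinP; exact: measurableT_comp.
    move=> t _; rewrite /f /= lee_fin !normrM ler_wpM2l// ler_piMr//.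
  have [_ fa] := (integrable_rVP a).1 ia; have [_ fb] := (integrable_rVP b).1 ib.
  rewrite ge0_integralZr//.
  - by rewrite lte_mul_pinfty// ?integral_ge0// ge0_fin_numE// integral_ge0.
  - by apply/measurable_EFinP; exact: measurableT_comp.
  - exact: integral_ge0.
have := Fubini if_; rewrite /Rintegral => fub.
have -> : (\int[lebn]_s (a (X s) * fine (\int[lebn]_t (b (X t) * k (X s) (X t))%:E))%:E =
   \int[lebn]_s \int[lebn]_t f (s, t))%E.
  apply: eq_integral => s _; rewrite /f /=.
  under [RHS]eq_integral do rewrite EFinM.
  rewrite integralZl; [|exact: measurableT|]; last by [].
  by rewrite EFinM fineK; [by []|exact: integrable_fin_num].
rewrite fub; congr fine; apply: eq_integral => t _; rewrite /f /=.
under eq_integral do rewrite mulrCA EFinM.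
rewrite integralZl; [|exact: measurableT|]; last by [].
by rewrite EFinM fineK; [by []|exact: integrable_fin_num].
Qed.

Lemma Rint_gt0 (g : V -> R) x0 : continuous g -> (forall x, 0 <= g x) ->
  integrable_rV g -> 0 < g x0 -> 0 < \int[lebn]_t g (X t).
Proof.
move=> cg g0 ig gx0.
have /cvgrPdist_lt/(_ (g x0 / 2)) := cg x0.
rewrite divr_gt0// => /(_ isT) /nbhs_normP[r /= r0 hr].
have gr x : `|x0 - x| < r -> g x0 / 2 <= g x.
  by move=> /(hr x)/=; rewrite ltr_norml => /andP[_]; lra.
have mc : emeas_rV (fun x : V => (\1_(cube (r / 2)) (tuple_of_rV x))%:E).
  apply/measurable_EFinP; rewrite (_ : (fun _ => _) = \1_(cube (r / 2))); last first.
    by apply/funext => t /=; rewrite rV_of_tupleK.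
  by apply: measurable_indic; exact: measurable_cube.
have r20 : 0 <= r / 2 by rewrite ltW// divr_gt0.
have E : (\int[lebn]_t (\1_(cube (r / 2)) (tuple_of_rV (X t - x0)))%:E = ((r / 2 *+ 2) ^+ n)%:E)%E.
  rewrite (eint_subr mc)//.
  under eq_integral do rewrite rV_of_tupleK.
  rewrite integral_indic ?setIT; [exact: lebn_cube|by []|exact: measurable_cube].
suff h : (((g x0 / 2) * (r / 2 *+ 2) ^+ n)%:E <= \int[lebn]_t (g (X t))%:E)%E.
  have fi : (\int[lebn]_t (g (X t))%:E)%E \is a fin_num.
    exact: (@integrable_fin_num _ _ _ _ _ measurableT _ ig).
  rewrite /Rintegral; apply: lt_le_trans (_ : (g x0 / 2) * (r / 2 *+ 2) ^+ n <= _).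
    by rewrite mulr_gt0 ?exprn_gt0 ?divr_gt0 ?mulrn_wgt0 ?divr_gt0.
  by rewrite -lee_fin fineK.
rewrite EFinM -E -ge0_integralZl_EFin//; last 2 first.
- have := measurable_affine_comp 1 (- x0) mc.
  by under eq_fun do rewrite scale1r.
- by rewrite ltW// divr_gt0.
apply: ge0_le_integral => //.
- by move=> t _; rewrite -EFinM lee_fin mulr_ge0// ltW// divr_gt0.
- apply: emeasurable_funM => //; have := measurable_affine_comp 1 (- x0) mc.
  by under eq_fun do rewrite scale1r.
- by have [/measurable_EFinP mg _] := (integrable_rVP g).1 ig.
move=> t _; rewrite -EFinM lee_fin indicE.
have [h|_] := boolP (_ \in _); last by rewrite mulr0.
rewrite mulr1; apply: gr; apply: le_lt_trans (_ : r / 2 < r); last by lra.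
apply: rV_norm_le => // i; move: h; rewrite inE => /(_ i).
by rewrite tnth_mktuple !mxE distrC.
Qed.

End fubini_rV.

(** * The Fourier transform on test functions *)

Section cosine_transform.
Context {R : realType} {n : nat}.
Local Notation T := (n.-tuple (measurableTypeR R)).
Local Notation X := (@rV_of_tuple R n).
Local Notation V := 'rV[R]_n.
Local Notation lebn := (lebn R n).
Local Notation e i := (delta_mx 0 i : V).
Implicit Types (g h : V -> R) (x y z xi : V) (a b : R).

(* The phase a lets one function represent both the cosine and the sine
   transform, and keeps derivatives and moments inside the same family. *)
Definition ctrans g a xi : R := \int[lebn]_t (g (X t) * cos (dot (X t) xi + a)).

Lemma norm_cos_le1 (r : R) : `|cos r| <= 1.
Proof. by rewrite ler_norml cos_geN1 cos_le1. Qed.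

Lemma meas_cos_dot xi a : meas_rV (fun x => cos (dot x xi + a)).
Proof.
apply: continuous_meas_rV; exact/smooth_continuous/smooth_cos.
Qed.

Lemma measurable_cos_comp d (S : measurableType d) (f : S -> R) :
  measurable_fun setT f -> measurable_fun setT (fun s => cos (f s)).
Proof.
by move=> mf; exact: (measurableT_comp (continuous_measurable_fun (@continuous_cos R)) mf).
Qed.

Lemma integrable_rV_mulbd g (k : V -> R) : integrable_rV g -> meas_rV k ->
  (forall x, `|k x| <= 1) -> integrable_rV (fun x => g x * k x).
Proof.
move=> ig mk k1; have [mg _] := (integrable_rVP g).1 ig.
apply: (le_integrable_rV _ _ (integrable_rV_norm ig)); first exact: measurable_funM.
by move=> x; rewrite normrM ler_piMr.
Qed.

Lemma integrable_cos g xi a : integrable_rV g ->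
  integrable_rV (fun x => g x * cos (dot x xi + a)).
Proof.
by move=> ig; apply: integrable_rV_mulbd => //; [exact: meas_cos_dot|move=> x; exact: norm_cos_le1].
Qed.

Lemma ctrans_norm_le g a xi : integrable_rV g ->
  `|ctrans g a xi| <= \int[lebn]_t `|g (X t)|.
Proof.
move=> ig; apply: le_trans (normr_Rint_rV (integrable_cos xi a ig)) _.
apply: (le_Rint_rV (f := fun x => `|g x * cos (dot x xi + a)|) (g := fun x => `|g x|)).
- exact/integrable_rV_norm/integrable_cos.
- exact: integrable_rV_norm.
by move=> x; rewrite normrM ler_piMr// norm_cos_le1.
Qed.

Lemma ctransN g xi : ctrans g 0 (- xi) = ctrans g 0 xi.
Proof. by apply: eq_Rintegral => t _; rewrite dotNr !addr0 cosN. Qed.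

Lemma ctransD g h a xi : integrable_rV g -> integrable_rV h ->
  ctrans (fun x => g x + h x) a xi = ctrans g a xi + ctrans h a xi.
Proof.
move=> ig ih; rewrite -(Rint_rVD (integrable_cos xi a ig) (integrable_cos xi a ih)).
by apply: eq_Rintegral => t _; rewrite mulrDl.
Qed.

Lemma ctransZ c g a xi : integrable_rV g ->
  ctrans (fun x => c * g x) a xi = c * ctrans g a xi.
Proof.
move=> ig; rewrite -(Rint_rVZ c (integrable_cos xi a ig)).
by apply: eq_Rintegral => t _; rewrite mulrA.
Qed.

Lemma ctrans_pi g a xi : integrable_rV g -> ctrans g (a + pi) xi = - ctrans g a xi.
Proof.
move=> ig; rewrite -mulN1r -(Rint_rVZ (-1) (integrable_cos xi a ig)).
by apply: eq_Rintegral => t _; rewrite addrA cosDpi; ring.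
Qed.

(** The sine part of the integral changes sign under x -> -x, so it vanishes and the phase factors
    out. *)
Lemma ctrans_even g a xi : integrable_rV g -> (forall x, g (- x) = g x) ->
  ctrans g a xi = cos a * ctrans g 0 xi.
Proof.
move=> ig ge.
have i1 := integrable_cos xi 0 ig; have i2 := integrable_cos xi (- (pi / 2)) ig.
have sin0 : \int[lebn]_t (g (X t) * cos (dot (X t) xi - pi / 2)) = 0.
  have := Rint_opp i2; set I := RHS => h.
  have : - I = I.
    rewrite -{2}h -mulN1r -(Rint_rVZ (-1) i2); apply: eq_Rintegral => t _.
    rewrite ge dotNl -[in RHS]cosN opprD !opprK.
    have -> (r : R) : cos (r - pi / 2) = sin r.
      by rewrite cosB cos_pihalf sin_pihalf mulr0 add0r mulr1.
    by rewrite cosDpihalf; ring.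
  by move=> /eqP; rewrite -subr_eq0 -opprD oppr_eq0 -mulr2n mulrn_eq0/= => /eqP.
transitivity (\int[lebn]_t (cos a * (g (X t) * cos (dot (X t) xi + 0)) -
    sin a * (g (X t) * cos (dot (X t) xi - pi / 2)))).
  apply: eq_Rintegral => t _; rewrite addr0 cosD.
  by rewrite (cosB _ (pi / 2)) cos_pihalf sin_pihalf; ring.
rewrite (Rint_rVB (integrable_rVZ (cos a) i1) (integrable_rVZ (sin a) i2)).
by rewrite (Rint_rVZ _ i1) (Rint_rVZ _ i2) sin0 mulr0 subr0.
Qed.

Lemma ctrans_scale g a c xi : c != 0 -> integrable_rV g ->
  ctrans (fun x => g (c *: x)) a xi = `|c| ^- n * ctrans g a (c^-1 *: xi).
Proof.
move=> c0 ig; rewrite /ctrans -(Rint_affine 0 c0 (integrable_cos (c^-1 *: xi) a ig)).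
apply: eq_Rintegral => t _; rewrite addr0 dotZl dotZr mulrA divff// mul1r//.
Qed.

Lemma ctrans_subl g x xi : integrable_rV g -> (forall x, g (- x) = g x) ->
  ctrans (fun z => g (x - z)) 0 xi = cos (dot x xi) * ctrans g 0 xi.
Proof.
move=> ig ge; rewrite -(ctransN g) -ctrans_even//.
rewrite -[RHS](Rint_subl x (integrable_cos (- xi) (dot x xi) ig)).
apply: eq_Rintegral => t _; congr (_ * cos _).
by rewrite dotNr dotDl dotNl; ring.
Qed.

Definition ccs g := continuous g /\ exists r, forall x, g x != 0 -> enorm x <= r.

Lemma test_fun_ccs g : test_fun g -> ccs g.
Proof. by move=> [/smooth_continuous cg hg]. Qed.

Lemma ccsM (f g : V -> R) : continuous f -> ccs g -> ccs (fun x => f x * g x).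
Proof.
move=> cf [cg [r hr]]; split; first by move=> x; exact: (cvgM (cf x) (cg x)).
by exists r => x; rewrite mulf_eq0 negb_or => /andP[_ /hr].
Qed.

Lemma ccs_integrable g : ccs g -> integrable_rV g.
Proof. by move=> [cg [r hr]]; exact: integrable_csupp hr. Qed.

Lemma cos_taylor (p q t : R) :
  `|cos (p + t * q) - cos p - t * (q * cos (p + pi / 2))| <= q ^+ 2 * t ^+ 2.
Proof.
have d1 (u s : R) : is_derive u 1 (fun u => cos (u * q + s)) (q * cos (u * q + (s + pi / 2))).
  rewrite addrA cosDpihalf mulrC.
  have h1 : is_derive u 1 (fun u => u * q + s) q.
    apply: is_derive_eq (is_deriveD (is_derive_mulr q u) (is_derive_cst s u 1)) _.
    by rewrite addr0.
  exact: (is_derive_comp1 h1 (is_derive_cos (u * q + s))).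
have d2 (u : R) : is_derive u 1 (fun u => q * cos (u * q + (p + pi / 2)))
    (- q ^+ 2 * cos (u * q + p)).
  apply: is_derive_eq (is_deriveM (is_derive_cst q u 1) (d1 u (p + pi / 2))) _.
  rewrite scaler0 addr0 /GRing.scale/= -addrA -splitr addrA cosDpi; ring.
have := @taylor1_bound R _ _ _ (q ^+ 2) t (fun u => d1 u p) d2.
rewrite !mul0r !add0r (addrC p (t * q)); apply => u.
rewrite -[leRHS]mulr1 normrM normrN (ger0_norm (sqr_ge0 q)).
by apply: ler_wpM2l; [exact: sqr_ge0|exact: norm_cos_le1].
Qed.

(** Replaces differentiation under the integral sign in [is_derive_ctrans]: a quadratic bound on the
    remainder survives integration directly, without a convergence theorem. *)
Lemma is_derive_quadratic (f : R -> R) (d K : R) :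
  (forall t, `|f t - f 0 - t * d| <= K * t ^+ 2) -> is_derive (0 : R) 1 f d.
Proof.
move=> fK; have K0 : 0 <= K.
  by have := le_trans (normr_ge0 _) (fK 1); rewrite expr1n mulr1.
suff h : (fun t : R => t^-1 *: (f (t *: 1 + 0) - f 0)) @ 0^' --> d.
  by apply: DeriveDef; [apply/cvg_ex; exists d; exact: h|exact: cvg_lim h].
apply/cvgrPdist_le => eps eps0.
have K1 : 0 < K + 1 by rewrite ltr_wpDl.
near=> t.
have t0 : t != 0 by near: t; exact: nbhs_dnbhs_neq.
have te : `|t| <= eps / (K + 1).
  near: t; exact: (dnbhs0_le (divr_gt0 eps0 K1)).
have := fK t; rewrite addr0 [t *: 1]mulr1 => h.
rewrite distrC (_ : _ - d = t^-1 * (f t - f 0 - t * d)); last first.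
  by rewrite /GRing.scale/=; field.
rewrite normrM normfV ler_pdivrMl ?normr_gt0//.
apply: le_trans h _; rewrite -(real_normK (num_real t)) expr2 mulrA mulrC ler_wpM2l//.
apply: (@le_trans _ _ ((K + 1) * `|t|)); first by rewrite ler_wpM2r// lerDl.
by rewrite mulrC -ler_pdivlMr.
Unshelve. all: by end_near. Qed.

(** The bound of [cos_taylor], integrated against |g|, leaves a remainder of at most t^2 times the
    integral of |x_i^2 g|. The derivative is again a [ctrans], of a moment of [g] and with the phase
    advanced by pi / 2. *)
Lemma is_derive_ctrans g a xi i : ccs g ->
  is_derive xi (e i) (ctrans g a) (ctrans (fun x => x 0 i * g x) (a + pi / 2) xi).
Proof.
move=> cg; have ig := ccs_integrable cg.
have cg1 := ccsM (@continuous_coord R n i) cg; have ig1 := ccs_integrable cg1.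
have cg2 := ccsM (@continuous_coord R n i) cg1; have ig2 := ccs_integrable cg2.
apply: is_derive_line.
apply: (@is_derive_quadratic _ _ (\int[lebn]_t `|X t 0 i * (X t 0 i * g (X t))|)) => t.
have it := integrable_cos (t *: e i + xi) a ig.
have i0 := integrable_cos (0 *: e i + xi) a ig.
have i1 := integrable_rVZ t (integrable_cos xi (a + pi / 2) ig1).
rewrite /ctrans -(Rint_rVZ t (integrable_cos xi (a + pi / 2) ig1)).
rewrite -(Rint_rVB it i0) -(Rint_rVB (integrable_rVB it i0) i1).
apply: le_trans (normr_Rint_rV (integrable_rVB (integrable_rVB it i0) i1)) _.
rewrite [leRHS]mulrC -(Rint_rVZ _ (integrable_rV_norm ig2)).
apply: (le_Rint_rV (integrable_rV_norm (integrable_rVB (integrable_rVB it i0) i1))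
  (integrable_rVZ _ (integrable_rV_norm ig2))) => x /=.
rewrite scale0r add0r dotDr dotZr dot_delta.
have := cos_taylor (dot x xi + a) (x 0 i) t.
rewrite (_ : t * x 0 i + dot x xi + a = dot x xi + a + t * x 0 i); last by ring.
rewrite (addrA _ a) => h.
rewrite (_ : _ - _ - _ = g x * (cos (dot x xi + a + t * x 0 i) - cos (dot x xi + a) -
    t * (x 0 i * cos (dot x xi + a + pi / 2)))); last by ring.
rewrite (_ : x 0 i * (x 0 i * g x) = g x * x 0 i ^+ 2); last by ring.
rewrite (normrM (g x)) (normrM (g x) (x 0 i ^+ 2)) (ger0_norm (sqr_ge0 (x 0 i))).
by rewrite [leRHS]mulrCA ler_wpM2l// [leRHS]mulrC.
Qed.

(** The cosine is 1-Lipschitz, so the transform is Lipschitz with constant the integral of |x|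
    |g|. *)
Lemma continuous_ctrans g a : ccs g -> continuous (ctrans g a).
Proof.
move=> cg; have ig := ccs_integrable cg.
have cg1 := ccsM (@continuous_enorm R n) cg; have ig1 := ccs_integrable cg1.
pose K := \int[lebn]_t `|enorm (X t) * g (X t)|.
have lip xi eta : `|ctrans g a xi - ctrans g a eta| <= K * enorm (xi - eta).
  have i1 := integrable_cos xi a ig; have i2 := integrable_cos eta a ig.
  rewrite /ctrans -(Rint_rVB i1 i2).
  apply: le_trans (normr_Rint_rV (integrable_rVB i1 i2)) _.
  rewrite [leRHS]mulrC /K -(Rint_rVZ _ (integrable_rV_norm ig1)).
  apply: (le_Rint_rV (integrable_rV_norm (integrable_rVB i1 i2))
    (integrable_rVZ _ (integrable_rV_norm ig1))) => x /=.
  rewrite -mulrBr !normrM (ger0_norm (enorm_ge0 _)) mulrA [leRHS]mulrC ler_wpM2l//.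
  have h : `|cos (dot x xi + a) - cos (dot x eta + a)| <= 1 * `|(dot x xi + a) - (dot x eta + a)|.
    apply: (mvt_bound (fun u => is_derive_cos u)) => u _.
    by rewrite normrN ler_norml sin_geN1 sin_le1.
  apply: le_trans h _; rewrite mul1r.
  rewrite (_ : _ - _ = dot x (xi - eta)); last by rewrite dotDr dotNr; ring.
  by rewrite mulrC dot_normE_le.
move=> xi; suff h : ctrans g a y @[y --> nbhs xi] --> ctrans g a xi by exact: h.
apply/cvgrPdist_le => eps eps0.
have K0 : 0 <= K by apply: Rintegral_ge0.
have K1 : 0 < K + 1 by rewrite ltr_wpDl.
have ce : continuous (fun y => enorm (xi - y)).
  rewrite (_ : (fun _ => _) = @enorm R n \o (fun y => -1 *: y + xi)).
    by move=> y; apply: continuous_comp; [exact: continuous_affine|exact: continuous_enorm].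
  by apply/funext => y /=; rewrite scaleN1r addrC.
have := ce xi; rewrite /continuous_at subrr enorm0 => /cvgr_le/(_ (eps / (K + 1))).
rewrite divr_gt0// => /(_ isT); apply: filterS => y /= ye.
apply: le_trans (lip _ _) _; apply: (@le_trans _ _ ((K + 1) * enorm (xi - y))).
  by rewrite ler_wpM2r ?enorm_ge0// lerDl.
by rewrite mulrC -ler_pdivlMr.
Qed.

Lemma Cn_ctrans N g a : ccs g -> Cn N (ctrans g a).
Proof.
elim: N g a => [|N IH] g a cg; (split; first exact: continuous_ctrans) => // i.
exists (ctrans (fun x => x 0 i * g x) (a + pi / 2)); split.
  by move=> x; exact: is_derive_ctrans.
by apply: IH; apply: ccsM => //; exact: continuous_coord.
Qed.

Lemma smooth_ctrans g a : ccs g -> smooth (ctrans g a).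
Proof. by move=> cg; apply/smoothP => N; exact: Cn_ctrans. Qed.

Lemma deriv_ctrans g a i : ccs g ->
  'D_(e i) (ctrans g a) = ctrans (fun x => x 0 i * g x) (a + pi / 2).
Proof. by move=> cg; apply/funext => xi; have [_] := is_derive_ctrans a xi i cg. Qed.

Lemma integrable_rV_sum (I : Type) (s : seq I) (F : I -> V -> R) :
  (forall i, integrable_rV (F i)) -> integrable_rV (fun x => \sum_(i <- s) F i x).
Proof.
move=> iF; elim: s => [|i s IH].
  rewrite /integrable_rV; under eq_fun do rewrite big_nil.
  exact: integrable0.
rewrite /integrable_rV; under eq_fun do rewrite big_cons.
exact: (integrable_rVD (iF i) IH).
Qed.

Lemma Rint_rV_sum (I : Type) (s : seq I) (F : I -> V -> R) :
  (forall i, integrable_rV (F i)) ->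
  \int[lebn]_t (\sum_(i <- s) F i (X t)) = \sum_(i <- s) \int[lebn]_t F i (X t).
Proof.
move=> iF; elim: s => [|i s IH].
  under eq_Rintegral do rewrite big_nil.
  by rewrite big_nil Rintegral_cst// mul0r.
under eq_Rintegral do rewrite big_cons.
by rewrite big_cons -IH (Rint_rVD (iF i) (integrable_rV_sum s iF)).
Qed.

(** Integration by parts, in the form that the integral of the partial derivative of h(x) cos(x.xi +
    a) is 0. *)
Lemma ctrans_deriv h a xi i : test_fun h ->
  ctrans ('D_(e i) h) a xi = - (xi 0 i * ctrans h (a + pi / 2) xi).
Proof.
move=> bh; have ih := test_fun_integrable bh.
have ih' := test_fun_integrable (test_fun_deriv i bh).
have bc : test_fun (fun x => cos (dot x xi + a) * h x).
  by apply: test_funMr => //; exact: smooth_cos.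
have := Rint_deriv i bc.
have dE x : 'D_(e i) (fun x => cos (dot x xi + a) * h x) x =
    'D_(e i) h x * cos (dot x xi + a) + xi 0 i * (h x * cos (dot x xi + (a + pi / 2))).
  have dc : is_derive x (e i) (fun x => cos (dot x xi + a))
      (xi 0 i * cos (dot x xi + (a + pi / 2))).
    rewrite addrA cosDpihalf mulrC; apply: is_derive_line.
    have h1 : is_derive (0 : R) 1 (fun t => dot (t *: e i + x) xi + a) (xi 0 i).
      apply: (@line_is_derive _ _ (fun x => dot x xi + a)).
      apply: is_derive_eq (is_deriveD (is_derive_dotr _ xi i) (is_derive_cst a _ _)) _.
      by rewrite addr0.
    have := is_derive_comp1 h1 (is_derive_cos _).
    by rewrite scale0r add0r.
  have [sh _] := bh.
  have [_ ->] := is_deriveM dc (smooth_is_derive i x sh).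
  by rewrite /GRing.scale/=; ring.
under eq_Rintegral do rewrite dE.
rewrite (Rint_rVD (integrable_cos xi a ih') (integrable_rVZ _ (integrable_cos xi _ ih))).
rewrite (Rint_rVZ _ (integrable_cos xi _ ih)) => /eqP.
by rewrite addr_eq0 => /eqP.
Qed.

Definition laplacian h x : R := \sum_(i < n) 'D_(e i) ('D_(e i) h) x.

Lemma test_fun_laplacian h : test_fun h -> test_fun (laplacian h).
Proof. by move=> bh; apply: test_fun_sum => i; do 2 apply: test_fun_deriv. Qed.

Lemma ctrans_laplacian h a xi : test_fun h ->
  ctrans (laplacian h) a xi = - (dot xi xi * ctrans h a xi).
Proof.
move=> bh; rewrite /ctrans.
transitivity (\sum_(i < n) ctrans ('D_(e i) ('D_(e i) h)) a xi).
  under eq_Rintegral do rewrite mulr_suml.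
  have ii i : integrable_rV (fun x => 'D_(e i) ('D_(e i) h) x * cos (dot x xi + a)).
    by apply/integrable_cos/test_fun_integrable; do 2 apply: test_fun_deriv.
  by rewrite (Rint_rV_sum _ ii).
rewrite /dot mulr_suml -sumrN; apply: eq_bigr => i _.
have bi := test_fun_deriv i bh.
rewrite !ctrans_deriv// -addrA -splitr ctrans_pi; last exact: test_fun_integrable.
by rewrite -!/(ctrans h a xi); ring.
Qed.

Lemma test_fun_iter_laplacian N h : test_fun h -> test_fun (iter N laplacian h).
Proof. by move=> bh; elim: N => //= N IH; exact: test_fun_laplacian. Qed.

Lemma ctrans_iter_laplacian N h a xi : test_fun h ->
  ctrans (iter N laplacian h) a xi = (- dot xi xi) ^+ N * ctrans h a xi.
Proof.
move=> bh; elim: N => [|N IH]; first by rewrite mul1r.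
rewrite /= ctrans_laplacian ?IH; last exact: test_fun_iter_laplacian.
by rewrite exprS; ring.
Qed.

(** Applying the Laplacian [N] times multiplies the transform by (-|xi|^2)^N, and the result is
    bounded by an L^1 norm whatever the phase. Together with the case [N = 0] this controls the
    power of the bracket. *)
Lemma ctrans_decay h N : test_fun h ->
  exists C : R, 0 <= C /\ forall a xi, `|ctrans h a xi| <= C * bracket xi ^- N.
Proof.
move=> bh; have ih := test_fun_integrable bh.
have iL := test_fun_integrable (test_fun_iter_laplacian N bh).
pose C0 := \int[lebn]_t `|h (X t)|; pose C1 := \int[lebn]_t `|iter N laplacian h (X t)|.
have C00 : 0 <= C0 by apply: Rintegral_ge0.
have C10 : 0 <= C1 by apply: Rintegral_ge0.
exists (2 ^+ N * (C0 + C1)); split; first by rewrite mulr_ge0 ?exprn_ge0 ?addr_ge0.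
move=> a xi; rewrite ler_pdivlMr ?exprn_gt0 ?bracket_gt0//.
have h0 := ctrans_norm_le a xi ih; have := ctrans_norm_le a xi iL.
rewrite ctrans_iter_laplacian// normrM normrX normrN (ger0_norm (dot_ge0 _)) => h1.
have bN : bracket xi ^+ N <= 2 ^+ N * (1 + dot xi xi ^+ N).
  have d0 := dot_ge0 xi; rewrite /bracket.
  have [d1|/ltW d1] := leP (dot xi xi) 1.
    apply: (@le_trans _ _ (2 ^+ N)); last by rewrite ler_peMr ?exprn_ge0// lerDl exprn_ge0.
    by rewrite lerXn2r// ?nnegrE ?addr_ge0//; lra.
  apply: (@le_trans _ _ ((2 * dot xi xi) ^+ N)).
    by rewrite lerXn2r// ?nnegrE ?addr_ge0 ?mulr_ge0//; lra.
  by rewrite exprMn ler_wpM2l ?exprn_ge0// lerDr.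
apply: (@le_trans _ _ (`|ctrans h a xi| * (2 ^+ N * (1 + dot xi xi ^+ N)))).
  by rewrite ler_wpM2l.
rewrite mulrCA ler_wpM2l ?exprn_ge0// mulrDr mulr1 [X in _ + X]mulrC.
exact: lerD.
Qed.

Hypothesis n_gt0 : (0 < n)%N.

Lemma integrable_bracketVn N : (n < N)%N -> integrable_rV (fun x => bracket x ^- N).
Proof.
move=> nN; apply/integrable_rVP; split; first exact: meas_bracketVn.
have nlt0 : - n%:R < 0 :> R by rewrite oppr_lt0 ltr0n.
have := weight_lty n_gt0 nlt0 (ler0n R 2) nN.
congr (_ < _)%E; apply: eq_integral => t _; congr EFin.
by rewrite /weight powRr0 mul1r ger0_norm// invr_ge0 exprn_ge0// ltW// bracket_gt0.
Qed.

Lemma integrable_decay (f : V -> R) C N : (n < N)%N -> meas_rV f ->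
  (forall x, `|f x| <= C * bracket x ^- N) -> integrable_rV f.
Proof.
by move=> nN mf fC; exact: (le_integrable_rV mf fC (integrable_rVZ C (integrable_bracketVn nN))).
Qed.

Lemma integrable_ctrans h a : test_fun h -> integrable_rV (ctrans h a).
Proof.
move=> bh; have [C [C0 hC]] := ctrans_decay n.+1 bh.
apply: (integrable_decay (ltnSn n) _ (hC a)).
by apply: continuous_meas_rV; apply: continuous_ctrans; exact: test_fun_ccs.
Qed.

End cosine_transform.

(** * Two stable classes of Schwartz functions *)

Section schwartz_functions.
Context {R : realType} {n : nat}.
Local Notation V := 'rV[R]_n.
Local Notation e i := (delta_mx 0 i : V).

Lemma class_pder_bound (P : (V -> R) -> Prop) :
  (forall h i, P h -> P ('D_(e i) h)) ->
  (forall h M, P h -> exists C : R, forall x, bracket x ^+ M * `|h x| <= C) ->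
  forall N M h, P h -> exists C : R, 0 <= C /\ forall l x, (size l <= N)%N ->
    bracket x ^+ M * `|pder l h x| <= C.
Proof.
move=> PD PB; elim=> [|N IH] M h Ph; have [C0 hC0] := PB h M Ph.
  exists `|C0|; split => // l x; rewrite leqn0 size_eq0 => /eqP ->.
  by rewrite (le_trans (hC0 x))// ler_norm.
have [C hC] := choice (fun i => IH M _ (PD h i Ph)).
have CC0 i : 0 <= C i by have [] := hC i.
exists (`|C0| + \sum_i C i); split; first by rewrite addr_ge0// sumr_ge0.
move=> l x; case/lastP: l => [|l i] sl.
  by rewrite (le_trans (hC0 x))// (le_trans (ler_norm _))// lerDl sumr_ge0.
have [_ /(_ l x)] := hC i; rewrite /pder foldr_rcons => h1.
apply: le_trans (h1 _) _; first by move: sl; rewrite size_rcons.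
by rewrite (bigD1 i)//= addrCA lerDl addr_ge0 ?sumr_ge0.
Qed.

(** Stability of the class yields the decay of all derivatives by induction, with no formula for
    them. The two classes used are test functions and cosine transforms of test functions; these are
    the arguments to which a distribution is applied in the norms. *)
Lemma schwartz_class (P : (V -> R) -> Prop) :
  (forall h, P h -> smooth h) ->
  (forall h i, P h -> P ('D_(e i) h)) ->
  (forall h M, P h -> exists C : R, forall x, bracket x ^+ M * `|h x| <= C) ->
  forall psi : V -> R[i], P (@complex.Re R \o psi) -> P (@complex.Im R \o psi) ->
  schwartz psi.
Proof.
move=> PS PD PB psi P1 P2; split; first by split; exact: PS.
move=> N; have [C1 [C10 h1]] := class_pder_bound PD PB N N P1.
have [C2 [C20 h2]] := class_pder_bound PD PB N N P2.
apply: (@le_lt_trans _ _ (C1 + C2)%:E); last exact: ltry.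
apply: ge_ereal_sup => _ [l [m [x [lN mN ->]]]]; rewrite lee_fin.
have xm : enorm x ^+ m <= bracket x ^+ N.
  apply: (@le_trans _ _ (bracket x ^+ m)); last by rewrite ler_weXn2l// bracket_ge1.
  have b0 := ltW (bracket_gt0 x); rewrite lerXn2r ?nnegrE ?enorm_ge0//.
  by rewrite bracketE; have := sqr_ge0 (enorm x - 1); have := enorm_ge0 x; nra.
apply: (@le_trans _ _ (bracket x ^+ N * (`|pder l (@complex.Re R \o psi) x| +
    `|pder l (@complex.Im R \o psi) x|))).
  by rewrite ler_wpM2r// addr_ge0.
by rewrite mulrDr lerD// ?h1 ?h2.
Qed.

Lemma schwartz_test_fun (psi : V -> R[i]) :
  test_fun (@complex.Re R \o psi) -> test_fun (@complex.Im R \o psi) -> schwartz psi.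
Proof.
apply: (@schwartz_class (@test_fun R n)).
- by move=> h [].
- by move=> h i; exact: test_fun_deriv.
move=> h M [sh [r hr]].
have cb : continuous (fun x : V => bracket x ^+ M).
  move=> x; apply: (@continuous_comp _ _ _ bracket (fun y => y ^+ M)).
    exact: continuous_bracket.
  exact: exprn_continuous.
have [ch [r' hr']] := ccsM cb (conj (smooth_continuous sh) (ex_intro _ r hr)).
have [C hC] := continuous_csupp_bounded ch hr'.
exists C => x; move: (hC x); rewrite normrM ger0_norm// exprn_ge0// ltW//.
exact: bracket_gt0.
Qed.

Lemma schwartz_ctrans (psi : V -> R[i]) (g1 g2 : V -> R) (a1 a2 : R) :
  test_fun g1 -> test_fun g2 ->
  @complex.Re R \o psi = ctrans g1 a1 -> @complex.Im R \o psi = ctrans g2 a2 -> schwartz psi.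
Proof.
move=> t1 t2 E1 E2.
apply: (@schwartz_class (fun h => exists g a, test_fun g /\ h = ctrans g a)).
- by move=> _ [g [a [tg ->]]]; apply: smooth_ctrans; exact: test_fun_ccs.
- move=> _ i [g [a [tg ->]]]; rewrite deriv_ctrans; last exact: test_fun_ccs.
  exists (fun x : V => x 0 i * g x), (a + pi / 2); split => //.
  by apply: test_funMr => //; exact: smooth_coord.
- move=> _ M [g [a [tg ->]]]; have [C [C0 hC]] := ctrans_decay M tg.
  by exists C => x; rewrite mulrC -ler_pdivlMr ?exprn_gt0 ?bracket_gt0.
- by exists g1, a1.
- by exists g2, a2.
Qed.

End schwartz_functions.

(** * Fourier inversion for even functions, up to a constant *)

Section fourier_inversion.
Context {R : realType} {n : nat}.
Local Notation T := (n.-tuple (measurableTypeR R)).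
Local Notation X := (@rV_of_tuple R n).
Local Notation V := 'rV[R]_n.
Local Notation lebn := (lebn R n).
Hypothesis n_gt0 : (0 < n)%N.

(** The multiplication formula with a dilation: Fubini moves the transform from [h] to [A], and the
    substitution x -> eps x moves the dilation from [A] to [h]. *)
Lemma ctrans_mult (h A : V -> R) eps : 0 < eps -> test_fun h -> test_fun A ->
  \int[lebn]_t (A (eps *: X t) * ctrans h 0 (X t)) =
  \int[lebn]_t (h (eps *: X t) * ctrans A 0 (X t)).
Proof.
move=> e0 th tA; have e1 := lt0r_neq0 e0.
have W : eps ^- n * eps ^+ n = 1 by rewrite mulVf// expf_neq0.
have W2 t : eps *: (eps^-1 *: X t + 0) = X t by rewrite addr0 scalerA mulfV// scale1r.
have tAe : test_fun (fun x => A (eps *: x)).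
  by have := test_fun_affine 0 e1 tA; under eq_fun do rewrite addr0.
have the : test_fun (fun x => h (eps *: x)).
  by have := test_fun_affine 0 e1 th; under eq_fun do rewrite addr0.
have ih := test_fun_integrable th.
have := Rint_swap (k := fun x y => cos (dot y x + 0)) (test_fun_integrable tAe) ih.
have mk : measurable_fun [set: T * T] (fun st => cos (dot (X st.2) (X st.1) + 0)).
  apply: measurable_cos_comp; apply: measurable_funD => //.
  by under eq_fun do rewrite dotC; exact: measurable_dot2.
move=> /(_ mk (fun x y => norm_cos_le1 _)) => E.
transitivity (\int[lebn]_t (h (X t) * (eps ^- n * ctrans A 0 (eps^-1 *: X t)))).
  apply: (etrans E); apply: eq_Rintegral => t _; congr (_ * _).
  have := ctrans_scale 0 (X t) e1 (test_fun_integrable tA); rewrite (gtr0_norm e0) => <-.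
  by apply: eq_Rintegral => s _; rewrite dotC.
have iF : integrable_rV (fun x => h (eps *: x) * ctrans A 0 x).
  apply: ccs_integrable.
  have := ccsM (@continuous_ctrans _ _ _ 0 (test_fun_ccs tA)) (test_fun_ccs the).
  by under eq_fun do rewrite mulrC.
have := Rint_affine 0 (a := eps^-1) _ iF.
have ei : 0 < eps^-1 by rewrite invr_gt0.
rewrite invr_eq0 (gtr0_norm ei) exprVn invrK => /(_ e1) F.
have E2 : \int[lebn]_t (h (eps *: X t) * ctrans A 0 (X t)) = eps ^- n *
    \int[lebn]_t (h (eps *: (eps^-1 *: X t + 0)) * ctrans A 0 (eps^-1 *: X t + 0)).
  rewrite F mulrA W mul1r; reflexivity.
apply: (etrans _ (esym E2)).
have i2 := integrable_rV_affine 0 (lt0r_neq0 ei) iF.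
apply: (etrans _ (Rint_rVZ _ i2)).
apply: eq_Rintegral => t _.
rewrite W2 [_ + 0]addr0; exact: mulrCA.
Qed.

Lemma cvg_dilate (F G : V -> R) (M : R) : continuous F -> (forall x, `|F x| <= M) ->
  integrable_rV G ->
  (\int[lebn]_t (F (m.+1%:R^-1 *: X t) * G (X t))) @[m --> \oo] -->
  F 0 * \int[lebn]_t G (X t).
Proof.
move=> cF FM iG; rewrite -(Rint_rVZ _ iG).
have [mG _] := (integrable_rVP G).1 iG.
have mF := continuous_meas_rV cF.
have mf m : measurable_fun setT (fun t => (F (m.+1%:R^-1 *: X t) * G (X t))%:E).
  apply/measurable_EFinP; apply: measurable_funM => //.
  by have := measurable_affine_comp (m.+1%:R^-1) 0 mF; under eq_fun do rewrite addr0.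
have mf0 : measurable_fun setT (fun t => (F 0 * G (X t))%:E).
  by apply/measurable_EFinP; apply: measurable_funM.
have iMG : lebn.-integrable setT (fun t => (M * `|G (X t)|)%:E).
  exact: (integrable_rVZ M (integrable_rV_norm iG)).
have := @dominated_convergence _ _ _ lebn setT measurableT
  (fun m t => (F (m.+1%:R^-1 *: X t) * G (X t))%:E) _ _ mf mf0 _ iMG _.
case.
- apply: aeW => t _; apply: cvg_EFin; first by apply: nearW.
  apply: cvgM; last exact: cvg_cst.
  rewrite -[X in _ --> F X](scale0r (X t)).
  apply: (@cvg_comp _ _ _ (fun m => m.+1%:R^-1 *: X t) F _ (nbhs (0 *: X t)) _).
    by apply: cvgZr_tmp; exact: cvg_harmonic.
  exact: cF.
- by apply: aeW => t m _ /=; rewrite lee_fin normrM ler_wpM2r.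
move=> i0 _ h; apply: fine_cvg; rewrite fineK//.
exact: (@integrable_fin_num _ _ _ _ _ measurableT _ i0).
Qed.

(** Letting eps tend to 0 in [ctrans_mult] replaces the dilated factors by their values at 0. Hence
    the integral of [ctrans h 0] is proportional to [h 0], and no explicit transform such as that of
    a Gaussian is required. *)
Lemma ctrans_integral_ratio (h A : V -> R) : test_fun h -> test_fun A ->
  A 0 * \int[lebn]_t ctrans h 0 (X t) = h 0 * \int[lebn]_t ctrans A 0 (X t).
Proof.
move=> th tA.
have [MA hA] := test_fun_bounded tA; have [Mh hh] := test_fun_bounded th.
have c1 := cvg_dilate (test_fun_continuous tA) hA (integrable_ctrans n_gt0 0 th).
have c2 := cvg_dilate (test_fun_continuous th) hh (integrable_ctrans n_gt0 0 tA).
apply: (cvg_unique _ c1); [exact: norm_hausdorff|move: c2; apply: cvg_trans].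
apply: near_eq_cvg; apply: nearW => m.
have m0 : (0 : R) < m.+1%:R^-1 by rewrite invr_gt0.
exact: (esym (ctrans_mult m0 th tA)).
Qed.

(** The point is that the constant is not 0. Otherwise the transform of [ctrans Q 0] would vanish,
    by evenness and translation, and Fubini would give 0 for the integral of the square of
    [ctrans Q 0]. This square is continuous and positive at 0, where [ctrans Q 0] is the integral of
    [Q]. *)
Lemma inversion_constant (Q : V -> R) y0 : test_fun Q -> (forall x, Q (- x) = Q x) ->
  (forall x, 0 <= Q x) -> 0 < Q y0 ->
  exists c : R, c != 0 /\ forall h, test_fun h -> \int[lebn]_t ctrans h 0 (X t) = c * h 0.
Proof.
move=> tQ eQ Q0 Qy; have iQ := test_fun_integrable tQ.
(* A translate of [Q] is the reference function because [Q] itself may vanish at 0, as an annulus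
   does. *)
pose A x := Q (1 *: x + y0).
have tA : test_fun A by exact: test_fun_affine (oner_neq0 _) tQ.
have A0 : A 0 != 0 by rewrite /A scaler0 add0r gt_eqF.
have hc h : test_fun h -> \int[lebn]_t ctrans h 0 (X t) =
    (\int[lebn]_t ctrans A 0 (X t)) / A 0 * h 0.
  move=> th; move: (ctrans_integral_ratio th tA).
  move: (\int[lebn]_t ctrans h 0 (X t)) (\int[lebn]_t ctrans A 0 (X t)) => I J e.
  by apply: (mulfI A0); rewrite e; field.
exists ((\int[lebn]_t ctrans A 0 (X t)) / A 0); split => //.
apply/eqP => c0.
have iC := integrable_ctrans n_gt0 0 tQ.
have z x : \int[lebn]_t (ctrans Q 0 (X t) * cos (dot (X t) x + 0)) = 0.
  have tx : test_fun (fun z => Q (- 1 *: z + x)).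
    by apply: test_fun_affine => //; rewrite oppr_eq0 oner_neq0.
  apply: (etrans (y := \int[lebn]_t ctrans (fun z => Q (- 1 *: z + x)) 0 (X t))); last first.
    by rewrite (hc _ tx) c0 mul0r.
  apply: eq_Rintegral => t _.
  rewrite addr0 dotC mulrC -(ctrans_subl x (X t) iQ eQ).
  by apply: eq_Rintegral => s _; rewrite scaleN1r addrC.
have := Rint_swap (k := fun x y => cos (dot y x + 0)) iQ iC.
have mk : measurable_fun [set: T * T] (fun st => cos (dot (X st.2) (X st.1) + 0)).
  apply: measurable_cos_comp; apply: measurable_funD => //.
  by under eq_fun do rewrite dotC; exact: measurable_dot2.
move=> /(_ mk (fun x y => norm_cos_le1 _)).
under eq_Rintegral do rewrite z mulr0.
rewrite Rintegral_cst// mul0r => h.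
have cC := @continuous_ctrans _ _ _ 0 (test_fun_ccs tQ).
have : 0 < \int[lebn]_t (ctrans Q 0 (X t) * ctrans Q 0 (X t)).
  apply: (@Rint_gt0 _ _ (fun x => ctrans Q 0 x * ctrans Q 0 x) 0).
  - by move=> x; exact: (cvgM (cC x) (cC x)).
  - by move=> x; rewrite -expr2 sqr_ge0.
  - have [C [C0 hC]] := ctrans_decay 0 tQ.
    have [mC _] := (integrable_rVP _).1 iC.
    apply: (le_integrable_rV _ _ (integrable_rVZ C (integrable_rV_norm iC))).
      exact: measurable_funM.
    move=> x; rewrite normrM ler_wpM2r//.
    by have := hC 0 x; rewrite expr0 invr1 mulr1.
  have : 0 < ctrans Q 0 0.
    rewrite /ctrans; under eq_Rintegral do rewrite dotC dot0l addr0 cos0 mulr1.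
    exact: Rint_gt0 (test_fun_continuous tQ) Q0 iQ Qy.
  by move=> p; rewrite mulr_gt0.
move=> pos; suff e : \int[lebn]_t (ctrans Q 0 (X t) * ctrans Q 0 (X t)) = 0.
  by move: pos; rewrite e ltxx.
apply: (etrans _ (esym h)); apply: eq_Rintegral => t _; congr (_ * _).
by apply: eq_Rintegral => s _; rewrite dotC.
Qed.

Lemma inversion_even c (Q : V -> R) a x :
  (forall h, test_fun h -> \int[lebn]_t ctrans h 0 (X t) = c * h 0) ->
  test_fun Q -> (forall x, Q (- x) = Q x) ->
  ctrans (ctrans Q 0) a x = c * (cos a * Q x).
Proof.
move=> hc tQ eQ; have iQ := test_fun_integrable tQ.
have iC := integrable_ctrans n_gt0 0 tQ.
rewrite ctrans_even//; last by move=> y; exact: ctransN.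
rewrite mulrCA; congr (_ * _).
have tx : test_fun (fun z => Q (- 1 *: z + x)).
  by apply: test_fun_affine => //; rewrite oppr_eq0 oner_neq0.
have := hc _ tx; rewrite scaler0 add0r => <-; apply: eq_Rintegral => t _.
rewrite addr0 dotC mulrC -(ctrans_subl x (X t) iQ eQ).
by apply: eq_Rintegral => s _; rewrite scaleN1r addrC.
Qed.

End fourier_inversion.

(** * Weighted L2 estimates *)

Section weighted_estimates.
Context {R : realType} {n : nat}.
Local Notation T := (n.-tuple (measurableTypeR R)).
Local Notation X := (@rV_of_tuple R n).
Local Notation V := 'rV[R]_n.
Local Notation lebn := (lebn R n).
Implicit Types f g h : V -> R.

Definition eint f : \bar R := (\int[lebn]_t (f (X t))%:E)%E.

Lemma meas_rVM f g : meas_rV f -> meas_rV g -> meas_rV (fun x => f x * g x).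
Proof. exact: measurable_funM. Qed.

Lemma meas_rVD f g : meas_rV f -> meas_rV g -> meas_rV (fun x => f x + g x).
Proof. exact: measurable_funD. Qed.

Lemma meas_rVZ (c : R) f : meas_rV f -> meas_rV (fun x => c * f x).
Proof. by move=> mf; apply: meas_rVM => //; exact: measurable_cst. Qed.

Lemma meas_rVX f k : meas_rV f -> meas_rV (fun x => f x ^+ k).
Proof. exact: measurable_funX. Qed.

Lemma meas_rV_norm f : meas_rV f -> meas_rV (fun x => `|f x|).
Proof. by move=> mf; exact: measurableT_comp mf. Qed.

Lemma meas_rV_affine f (a : R) (b : V) : meas_rV f -> meas_rV (fun x => f (a *: x + b)).
Proof. exact: measurable_affine_comp. Qed.

Lemma meas_rV_sub f (b : V) : meas_rV f -> meas_rV (fun x => f (b - x)).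
Proof.
move=> /(meas_rV_affine (-1) b); rewrite /meas_rV; congr measurable_fun.
by apply/funext => t /=; rewrite scaleN1r addrC.
Qed.

Lemma eint_ge0 f : (forall x, 0 <= f x) -> (0 <= eint f)%E.
Proof. by move=> f0; apply: integral_ge0 => t _; rewrite lee_fin. Qed.

Lemma le_eint f g : meas_rV f -> meas_rV g -> (forall x, 0 <= f x <= g x) ->
  (eint f <= eint g)%E.
Proof.
move=> mf mg fg; apply: ge0_le_integral => //.
- by move=> t _; have /andP[f0 _] := fg (X t); rewrite lee_fin.
- exact/measurable_EFinP.
- exact/measurable_EFinP.
- by move=> t _; have /andP[_ h] := fg (X t); rewrite lee_fin.
Qed.

Lemma ae_le_eint f g : (0 < n)%N -> meas_rV f -> meas_rV g -> (forall x, 0 <= f x) ->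
  (forall x, 0 <= g x) -> (forall x, x != 0 -> f x <= g x) -> (eint f <= eint g)%E.
Proof.
move=> n0 mf mg f0 g0 fg; apply: ae_ge0_le_integral => //.
- by move=> t _; rewrite lee_fin.
- exact/measurable_EFinP.
- by move=> t _; rewrite lee_fin.
- exact/measurable_EFinP.
- by apply: filterS (ae_neq0 (R := R) n0) => t /fg h _; rewrite lee_fin.
Qed.

Lemma eintZ (c : R) f : 0 <= c -> meas_rV f -> (forall x, 0 <= f x) ->
  eint (fun x => c * f x) = (c%:E * eint f)%E.
Proof.
move=> c0 mf f0; rewrite /eint; under eq_integral do rewrite EFinM.
by rewrite ge0_integralZl//; [exact/measurable_EFinP|move=> t _; rewrite lee_fin].
Qed.

Lemma eintD f g : meas_rV f -> meas_rV g -> (forall x, 0 <= f x) -> (forall x, 0 <= g x) ->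
  eint (fun x => f x + g x) = (eint f + eint g)%E.
Proof.
move=> mf mg f0 g0; rewrite /eint; under eq_integral do rewrite EFinD.
rewrite ge0_integralD//.
- by move=> t _; rewrite lee_fin.
- exact/measurable_EFinP.
- by move=> t _; rewrite lee_fin.
- exact/measurable_EFinP.
Qed.

Lemma eint_sum (I : Type) (r : seq I) (F : I -> V -> R) :
  (forall i, meas_rV (F i)) -> (forall i x, 0 <= F i x) ->
  eint (fun x => \sum_(i <- r) F i x) = (\sum_(i <- r) eint (F i))%E.
Proof.
move=> mF F0; rewrite /eint -ge0_integral_sum//.
- by apply: eq_integral => t _; rewrite sumEFin.
- by move=> i; apply/measurable_EFinP; exact: mF.
- by move=> i t _; rewrite lee_fin.
Qed.

Lemma eint_dilate f (lam : R) (b : V) : 0 < lam -> meas_rV f -> (forall x, 0 <= f x) ->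
  eint (fun x => lam ^+ n * f (lam *: (b - x))) = eint f.
Proof.
move=> l0 mf f0.
have ln : lam ^+ n != 0 by rewrite expf_neq0// gt_eqF.
have E (x : V) : lam *: (b - x) = (- lam) *: x + lam *: b.
  by rewrite scalerBr scaleNr addrC.
rewrite eintZ; first last.
- by move=> x; exact: f0.
- have := meas_rV_affine (- lam) (lam *: b) mf; rewrite /meas_rV; congr measurable_fun.
  by apply/funext => t /=; rewrite E.
- by rewrite exprn_ge0// ltW.
rewrite /eint; under eq_integral do rewrite E.
rewrite (eint_affine (f := fun x => (f x)%:E)).
- by rewrite normrN (gtr0_norm l0) muleA -EFinM mulfV// mul1e.
- exact/measurable_EFinP.
- by move=> x; rewrite lee_fin.
- by rewrite oppr_eq0 gt_eqF.
Qed.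

Lemma eint_swap (k : V -> V -> R) :
  measurable_fun [set: T * T] (fun st => k (X st.1) (X st.2)) ->
  (forall x y, 0 <= k x y) ->
  (\int[lebn]_s eint (k (X s)) = \int[lebn]_t eint (fun x => k x (X t)))%E.
Proof.
move=> mk k0; apply: (@fubini_tonelli _ _ _ _ _ lebn lebn
  (fun st => (k (X st.1) (X st.2))%:E)).
  exact/measurable_EFinP.
by move=> st; rewrite lee_fin.
Qed.

Lemma meas_eint (k : V -> V -> R) :
  measurable_fun [set: T * T] (fun st => k (X st.1) (X st.2)) ->
  (forall x y, 0 <= k x y) ->
  measurable_fun [set: T] (fun s => eint (k (X s))).
Proof.
move=> mk k0; apply: (measurable_fun_fubini_tonelli_F
  (fun st : T * T => (k (X st.1) (X st.2))%:E)).
  exact/measurable_EFinP.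
by move=> st; rewrite lee_fin.
Qed.

(** Stated with products in place of square roots, so that it can be used in [\bar R] without
    finiteness conditions. *)
Lemma cauchy_schwarz_eint f g : meas_rV f -> meas_rV g ->
  (eint (fun x => `|f x * g x|%R) * eint (fun x => `|f x * g x|%R) <=
   eint (fun x => f x ^+ 2)%R * eint (fun x => g x ^+ 2)%R)%E.
Proof.
move=> mf mg.
have h2 : (2^-1 + 2^-1 = 1 :> R) by lra.
have U (p : R) (h : T -> R) : Lnorm lebn p%:E (EFin \o h) =
    ((\int[lebn]_t (`|h t| `^ p)%:E) `^ p^-1)%E.
  by rewrite unlock.
have U1 (h : T -> R) : Lnorm lebn 1 (EFin \o h) = (\int[lebn]_t (`|h t|)%:E)%E.
  rewrite U invr1 poweRe1; first by apply: eq_integral => t _; rewrite powRr1.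
  by apply: integral_ge0 => t _; rewrite lee_fin powR_ge0.
have := hoelder lebn mf mg (ltr0n R 2) (ltr0n R 2) h2.
rewrite U1 !U.
have E2 h : (\int[lebn]_t (`|h (X t)| `^ 2)%:E = eint (fun x => h x ^+ 2)%R)%E.
  by apply: eq_integral => t _; rewrite powR_mulrn// real_normK// num_real.
have -> := E2 f; have -> := E2 g => H.
have sq h : (eint (fun x => h x ^+ 2)%R `^ 2^-1 * eint (fun x => h x ^+ 2)%R `^ 2^-1 =
   eint (fun x => h x ^+ 2)%R)%E.
  have := eint_ge0 (fun x => sqr_ge0 (h x)); case: (eint _) => [r| |]//=.
    by rewrite lee_fin => r0; rewrite -EFinM powR12_sqrt// -expr2 sqr_sqrtr.
  by rewrite invr_eq0 pnatr_eq0.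
have I0 : (0 <= eint (fun x => `|f x * g x|%R))%E by exact: eint_ge0.
by apply: le_trans (lee_pmul I0 I0 H H) _; rewrite muleACA !sq.
Qed.

(** With [f] the modulus of a Fourier transform this is the square of the homogeneous Sobolev norm,
    see [Hdot_sqr]. *)
Definition wnorm (s : R) f : \bar R := eint (fun x => enorm x `^ (2 * s) * f x ^+ 2)%R.

Lemma wnorm_ge0 s f : (0 <= wnorm s f)%E.
Proof. by apply: eint_ge0 => x; rewrite mulr_ge0 ?powR_ge0 ?sqr_ge0. Qed.

Lemma meas_wnorm s f : meas_rV f -> meas_rV (fun x => enorm x `^ (2 * s) * f x ^+ 2).
Proof. by move=> mf; apply: meas_rVM; [exact: meas_enorm_powR|exact: meas_rVX]. Qed.

Hypothesis n_gt0 : (0 < n)%N.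

(** Common majorant for the transforms of cut-offs at scale [lam] in space; the factor [lam ^+ n]
    makes its integral independent of [lam]. *)
Definition bump_kernel (P : nat) (lam : R) (x : V) : R := lam ^+ n * bracket (lam *: x) ^- P.

Lemma bump_kernel_ge0 P lam x : 0 < lam -> 0 <= bump_kernel P lam x.
Proof.
by move=> l0; rewrite mulr_ge0 ?exprn_ge0 ?(ltW l0)// invr_ge0 exprn_ge0// ltW// bracket_gt0.
Qed.

Lemma meas_bump_kernel P lam : meas_rV (bump_kernel P lam).
Proof.
apply: meas_rVZ; have := meas_rV_affine lam 0 (meas_bracketVn P).
by rewrite /meas_rV; under eq_fun do rewrite addr0.
Qed.

Lemma bump_kernelB P lam x y : bump_kernel P lam (x - y) = bump_kernel P lam (y - x).
Proof. by rewrite /bump_kernel !scalerBr bracketB. Qed.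

Definition weight_int (e : R) : R := fine (eint (weight e n.+1)).

Lemma weight_intE e : - n%:R < e -> e <= 2 -> eint (weight e n.+1) = (weight_int e)%:E.
Proof.
move=> ne e2; rewrite fineK// ge0_fin_numE; first exact: weight_lty.
by apply: eint_ge0 => x; exact: weight_ge0.
Qed.

Lemma weight_int_ge0 e : 0 <= weight_int e.
Proof. by apply: fine_ge0; apply: eint_ge0 => x; exact: weight_ge0. Qed.

(* Splits according to whether |eta| >= |xi|/2 or not. *)
Lemma weight_ratio_le (sg lam : R) (xi eta : V) : 0 < lam -> 0 <= sg <= 1 ->
  enorm xi `^ (2 * sg) * (bracket (lam *: (xi - eta)) ^- n.+2 * enorm eta `^ (- (2 * sg))) <=
  4 * weight 0 n.+1 (lam *: (xi - eta)) + 4 * weight (- (2 * sg)) n.+1 (lam *: (0 - eta)).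
Proof.
move=> l0 /andP[s0 s1].
set J := bracket (lam *: (xi - eta)); have J0 : 0 < J by exact: bracket_gt0.
have J1 : J ^- n.+2 <= J ^- n.+1.
  by rewrite lef_pV2 ?posrE ?exprn_gt0// ler_weXn2l ?bracket_ge1.
have w0 := weight_ge0 (- (2 * sg)) n.+1 (lam *: (0 - eta)).
have JV m : 0 <= J ^- m by rewrite invr_ge0 exprn_ge0// ltW.
have first (r : R) : r <= 4 -> r * J ^- n.+2 <=
    4 * weight 0 n.+1 (lam *: (xi - eta)) + 4 * weight (- (2 * sg)) n.+1 (lam *: (0 - eta)).
  move=> r4; apply: (@le_trans _ _ (4 * J ^- n.+2)); first by rewrite ler_wpM2r.
  apply: ler_wpDr; first by rewrite mulr_ge0.
  by rewrite /weight powRr0 mul1r ler_wpM2l.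
have [e0|eta0] := eqVneq eta 0.
  have [sg0|sg0] := eqVneq sg 0.
    have r14 : (1 : R) <= 4 by lra.
    have := first 1 r14; rewrite sg0 mulr0 oppr0 !powRr0 mulr1 !mul1r; exact.
  rewrite [X in enorm X `^ (- _)]e0 enorm0 powR0 ?oppr_eq0 ?mulf_neq0// !mulr0.
  by apply: addr_ge0; apply: mulr_ge0 => //; exact: weight_ge0.
have e0 : 0 < enorm eta by rewrite enorm_gt0.
have x0 := enorm_ge0 xi.
have s2 : 0 <= 2 * sg by lra.
have [xe|ex] := leP (enorm xi) (2 * enorm eta).
  rewrite [X in _ * X]mulrC mulrA; apply: first.
  rewrite powRN ler_pdivrMr ?powR_gt0//.
  apply: (@le_trans _ _ ((2 * enorm eta) `^ (2 * sg))).
    by rewrite ge0_ler_powR// nnegrE mulr_ge0// ltW.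
  rewrite powRM ?(ltW e0)// ler_wpM2r ?powR_ge0//.
  apply: (@le_trans _ _ (2 `^ 2)); first by rewrite ler_powR ?ler1n//; lra.
  by rewrite powR_mulrn//; lra.
apply: ler_wpDl; first by rewrite mulr_ge0 ?weight_ge0.
rewrite /weight sub0r scalerN enormN bracketN enormZ (gtr0_norm l0).
rewrite powRM ?(ltW l0) ?(ltW e0)//.
have Jd : lam * (enorm xi - enorm eta) <= enorm (lam *: (xi - eta)).
  by rewrite enormZ (gtr0_norm l0) ler_wpM2l ?(ltW l0) ?enorm_sub_ge.
have Jn : J = 1 + enorm (lam *: (xi - eta)) ^+ 2 by exact: bracketE.
have be : bracket (lam *: eta) <= J.
  rewrite Jn bracketE lerD2l lerXn2r ?nnegrE ?enorm_ge0//.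
  by apply: le_trans Jd; rewrite enormZ (gtr0_norm l0) ler_wpM2l ?(ltW l0)//; lra.
have aJ : (lam * enorm xi) `^ (2 * sg) <= 4 * J.
  have a0 : 0 <= lam * enorm xi by rewrite mulr_ge0// ltW.
  have aa : (lam * enorm xi) ^+ 2 <= 4 * (J - 1).
    have -> : 4 * (J - 1) = (2 * enorm (lam *: (xi - eta))) ^+ 2 by rewrite Jn; ring.
    rewrite lerXn2r ?nnegrE ?mulr_ge0 ?enorm_ge0 ?(ltW l0)//.
    by have := Jd; have : 0 <= lam * (enorm xi - 2 * enorm eta);
      [rewrite mulr_ge0 ?(ltW l0)//; lra|lra].
  have J11 : 1 <= J by exact: bracket_ge1.
  have [a1|a1] := leP (lam * enorm xi) 1.
    apply: (@le_trans _ _ (1 `^ (2 * sg))); last by rewrite powR1; lra.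
    by rewrite ge0_ler_powR// nnegrE.
  apply: (@le_trans _ _ ((lam * enorm xi) `^ 2)); first by rewrite ler_powR ?(ltW a1)//; lra.
  by rewrite powR_mulrn//; lra.
have lx : enorm xi `^ (2 * sg) = lam `^ (- (2 * sg)) * (lam * enorm xi) `^ (2 * sg).
  by rewrite powRM ?(ltW l0)// mulrA powRN mulVf ?mul1r// gt_eqF ?powR_gt0.
rewrite lx exprS invfM.
have -> : lam `^ (- (2 * sg)) * (lam * enorm xi) `^ (2 * sg) *
    ((J^-1 * J ^- n.+1) * enorm eta `^ (- (2 * sg))) =
    ((lam * enorm xi) `^ (2 * sg) / J) *
    (lam `^ (- (2 * sg)) * enorm eta `^ (- (2 * sg)) * J ^- n.+1) by ring.
apply: ler_pM.
- by rewrite divr_ge0 ?powR_ge0// ltW.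
- by rewrite !mulr_ge0 ?powR_ge0.
- by rewrite ler_pdivrMr.
rewrite ler_wpM2l ?mulr_ge0 ?powR_ge0//.
by rewrite lef_pV2 ?posrE ?exprn_gt0 ?bracket_gt0// lerXn2r ?nnegrE ?(ltW (bracket_gt0 _)) ?(ltW J0).
Qed.

(** Schur's condition for the weight |xi|^(2 sg), uniform in [lam] by scaling. Of the [n.+2]
    brackets one absorbs the growth of |xi|^(2 sg), which is where sg <= 1 enters, and the others
    ensure integrability at infinity; 2 sg < n is integrability at the origin. *)
Lemma weight_convolution (sg : R) : 0 <= sg <= 1 -> 2 * sg < n%:R ->
  exists C : R, 0 <= C /\ forall (lam : R) (xi : V), 0 < lam ->
  ((enorm xi `^ (2 * sg))%:E *
   eint (fun eta => bump_kernel n.+2 lam (xi - eta) * enorm eta `^ (- (2 * sg)))%R <= C%:E)%E.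
Proof.
move=> sg01 sgn; have /andP[s0 s1] := sg01.
have n0 : - n%:R < 0 :> R by rewrite oppr_lt0 ltr0n.
exists (4 * weight_int 0 + 4 * weight_int (- (2 * sg))).
have w0 := weight_int_ge0; split; first by rewrite addr_ge0 ?mulr_ge0.
move=> lam xi l0.
have mk : meas_rV (fun eta => bump_kernel n.+2 lam (xi - eta) * enorm eta `^ (- (2 * sg))).
  apply: meas_rVM; last exact: meas_enorm_powR.
  exact: (meas_rV_sub xi (meas_bump_kernel _ _)).
have k0 eta : 0 <= bump_kernel n.+2 lam (xi - eta) * enorm eta `^ (- (2 * sg)).
  by rewrite mulr_ge0 ?powR_ge0 ?bump_kernel_ge0.
rewrite -eintZ ?powR_ge0//.
have md e (b : V) : meas_rV (fun x => lam ^+ n * weight e n.+1 (lam *: (b - x))).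
  apply: meas_rVZ; apply: (meas_rV_sub (f := fun x => weight e n.+1 (lam *: x))).
  have := meas_rV_affine lam 0 (meas_weight e n.+1).
  by rewrite /meas_rV; under eq_fun do rewrite addr0.
have d0 e (b x : V) : 0 <= lam ^+ n * weight e n.+1 (lam *: (b - x)).
  by rewrite mulr_ge0 ?weight_ge0// exprn_ge0// ltW.
apply: (@le_trans _ _ (eint (fun eta => 4 * (lam ^+ n * weight 0 n.+1 (lam *: (xi - eta))) +
    4 * (lam ^+ n * weight (- (2 * sg)) n.+1 (lam *: (0 - eta)))))).
  apply: le_eint; first exact: meas_rVZ.
    by apply: meas_rVD; apply: meas_rVZ; exact: md.
  move=> eta; rewrite mulr_ge0 ?powR_ge0//=.
  move: (weight_ratio_le xi eta l0 sg01); rewrite /bump_kernel.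
  move: (weight 0 _ _) (weight (- _) _ _) (enorm xi `^ _) (enorm eta `^ _) (bracket _ ^- _).
  move=> w v a b J h.
  have -> : a * (lam ^+ n * J * b) = lam ^+ n * (a * (J * b)) by ring.
  have -> : 4 * (lam ^+ n * w) + 4 * (lam ^+ n * v) = lam ^+ n * (4 * w + 4 * v) by ring.
  by rewrite ler_wpM2l// exprn_ge0// ltW.
rewrite eintD; [|by apply: meas_rVZ; exact: md|by apply: meas_rVZ; exact: md
  |by move=> x; rewrite mulr_ge0|by move=> x; rewrite mulr_ge0].
rewrite (eintZ (ler0n R 4) (md 0 xi) (d0 0 xi)) (eintZ (ler0n R 4) (md _ 0) (d0 _ 0)).
rewrite (eint_dilate xi l0 (meas_weight 0 n.+1) (weight_ge0 0 n.+1)).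
rewrite (eint_dilate 0 l0 (meas_weight _ n.+1) (weight_ge0 _ n.+1)).
rewrite !weight_intE//; [lra|lra].
Qed.

Lemma powR_sqr (r e : R) : (r `^ e) ^+ 2 = r `^ (2 * e).
Proof. by rewrite -powR_mulrn ?powR_ge0// -powRrM mulrC. Qed.

(** The kernel is split by Cauchy-Schwarz as the product of A^(1/2) |y|^(-sg) and A^(1/2) |y|^sg
    z(y). The first factor is bounded by the row condition, and integrating the second in xi leads
    to the column condition. *)
Lemma schur_bound (s : R) : `|s| <= 1 -> 2 * `|s| < n%:R ->
  exists C : R, 0 <= C /\ forall (lam : R) g z, 0 < lam -> meas_rV g -> meas_rV z ->
    (forall x, 0 <= z x) -> z 0 = 0 ->
    (forall xi, ((`|g xi|)%:E <= eint (fun eta => bump_kernel n.+2 lam (xi - eta) * z eta)%R)%E) ->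
    (wnorm s g <= C%:E * wnorm s z)%E.
Proof.
move=> s1 sn.
(* [weight_convolution] is about nonnegative exponents. For s >= 0 the weight enters the row
   integrals, with sg = s; for s < 0 it enters the column integrals, with ta = - s. The other
   exponent is 0. *)
have [sg [ta [sg01 ta01 sgn tan ps]]] : exists sg ta : R,
    [/\ 0 <= sg <= 1, 0 <= ta <= 1, 2 * sg < n%:R, 2 * ta < n%:R &
     forall x : V, enorm x `^ (2 * s) = enorm x `^ (- (2 * ta)) * enorm x `^ (2 * sg)].
  have n0 : 2 * 0 < n%:R :> R by rewrite mulr0 ltr0n.
  have [h|h] := lerP 0 s; [rewrite ger0_norm// in s1 sn|rewrite ltr0_norm// in s1 sn].
    exists s, 0; split => //; [by rewrite h|by rewrite lexx ler01|].
    by move=> x; rewrite mulr0 oppr0 powRr0 mul1r.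
  exists 0, (- s); split => //; [by rewrite lexx ler01|by rewrite oppr_ge0 (ltW h)|].
  by move=> x; rewrite mulr0 powRr0 mulr1 mulrN opprK.
have [C1 [C10 h1]] := weight_convolution sg01 sgn.
have [C2 [C20 h2]] := weight_convolution ta01 tan.
exists (C1 * C2); split; first exact: mulr_ge0.
move=> lam g z l0 mg mz z0 z00 gz.
pose A (x y : V) := bump_kernel n.+2 lam (x - y).
have A0 x y : 0 <= A x y by exact: bump_kernel_ge0.
have mA x : meas_rV (A x) by exact: (meas_rV_sub x (meas_bump_kernel _ _)).
pose B (y : V) := enorm y `^ (2 * sg) * z y ^+ 2.
have B0 y : 0 <= B y by rewrite mulr_ge0 ?powR_ge0 ?sqr_ge0.
have mB : meas_rV B by apply: meas_rVM; [exact: meas_enorm_powR|exact: meas_rVX].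
have cs xi : ((g xi ^+ 2)%:E <=
    eint (fun y => A xi y * enorm y `^ (- (2 * sg)))%R * eint (fun y => A xi y * B y)%R)%E.
  pose f y := Num.sqrt (A xi y) * enorm y `^ (- sg).
  pose h y := Num.sqrt (A xi y) * (enorm y `^ sg * z y).
  have msq : meas_rV (fun y => Num.sqrt (A xi y)).
    rewrite /meas_rV (_ : _ \o _ = (fun r => r `^ 2^-1) \o (A xi \o X)).
      exact: measurableT_comp (@measurable_powR R _) (mA xi).
    by apply/funext => t /=; rewrite powR12_sqrt.
  have mf : meas_rV f by apply: meas_rVM => //; exact: meas_enorm_powR.
  have mh : meas_rV h.
    by apply: meas_rVM => //; apply: meas_rVM => //; exact: meas_enorm_powR.
  have := cauchy_schwarz_eint mf mh.
  have -> : eint (fun y => `|f y * h y|)%R = eint (fun y => A xi y * z y)%R.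
    apply: eq_integral => t _; congr (_%:E); rewrite /f /h.
    (* The powers of |y| need not cancel at y = 0; there the assumption [z 0 = 0] takes over. *)
    have [->|y0] := eqVneq (X t) 0; first by rewrite z00 !mulr0 normr0.
    have e : enorm (X t) `^ (- sg) * (enorm (X t) `^ sg * z (X t)) = z (X t).
      by rewrite mulrA powRN mulVf ?mul1r// gt_eqF// powR_gt0// enorm_gt0.
    by rewrite mulrACA -expr2 sqr_sqrtr// e ger0_norm// mulr_ge0.
  have -> : eint (fun y => f y ^+ 2)%R = eint (fun y => A xi y * enorm y `^ (- (2 * sg)))%R.
    by apply: eq_integral => t _; rewrite /f exprMn sqr_sqrtr// powR_sqr mulrN.
  have -> : eint (fun y => h y ^+ 2)%R = eint (fun y => A xi y * B y)%R.
    by apply: eq_integral => t _; rewrite /h /B !exprMn sqr_sqrtr// powR_sqr.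
  apply: le_trans; rewrite -real_normK ?num_real// expr2 EFinM.
  by apply: lee_pmul; rewrite ?lee_fin// ?gz.
pose k (x y : V) := C1 * (enorm x `^ (- (2 * ta)) * (A x y * B y)).
have kk0 x y : 0 <= enorm x `^ (- (2 * ta)) * (A x y * B y).
  by apply: mulr_ge0; [exact: powR_ge0|exact: mulr_ge0].
have k0 x y : 0 <= k x y by exact: mulr_ge0.
have mk : measurable_fun [set: T * T] (fun st => k (X st.1) (X st.2)).
  apply: measurable_funM => //; apply: measurable_funM.
    exact: (measurableT_comp (meas_enorm_powR _) (@measurable_fst _ _ T T)).
  apply: measurable_funM; first exact: (measurable_sub_comp (meas_bump_kernel _ _)).
  exact: (measurableT_comp mB (@measurable_snd _ _ T T)).
apply: (@le_trans _ _ (\int[lebn]_s eint (k (X s)))%E).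
  apply: ge0_le_integral => //.
  - by move=> t _; rewrite lee_fin mulr_ge0 ?powR_ge0 ?sqr_ge0.
  - by apply/measurable_EFinP; exact: meas_wnorm.
  - exact: meas_eint.
  move=> t _; rewrite /k eintZ//; last by apply: meas_rVZ; exact: meas_rVM.
  rewrite eintZ ?powR_ge0//; [|exact: meas_rVM|by move=> y; rewrite mulr_ge0].
  rewrite ps -mulrA EFinM muleCA; apply: lee_wpmul2l; first by rewrite lee_fin powR_ge0.
  rewrite EFinM; apply: (@le_trans _ _ ((enorm (X t) `^ (2 * sg))%:E *
     (eint (fun y => A (X t) y * enorm y `^ (- (2 * sg)))%R *
      eint (fun y => A (X t) y * B y)%R))%E).
    by apply: lee_wpmul2l; [rewrite lee_fin powR_ge0|exact: cs].
  rewrite muleA; apply: lee_wpmul2r; last exact: h1.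
  by apply: eint_ge0 => y; rewrite mulr_ge0.
rewrite eint_swap//.
have mks t : meas_rV (fun x => k x (X t)) by exact: (measurableT_comp mk (measurable_pair2 t)).
have mkt : measurable_fun setT (fun t => eint (fun x => k x (X t))).
  apply: (meas_eint (k := fun y x => k x y)) => //.
  exact: (measurableT_comp mk (@measurable_swap _ _ T T)).
rewrite -eintZ ?mulr_ge0//; first last.
- by move=> y; rewrite mulr_ge0 ?powR_ge0 ?sqr_ge0.
- exact: meas_wnorm.
apply: ge0_le_integral => //.
- by move=> t _; exact: eint_ge0.
- by apply/measurable_EFinP; exact: (meas_rVZ (C1 * C2) (meas_wnorm s mz)).
move=> t _; have [y0|y0] := eqVneq (X t) 0.
  rewrite (_ : eint _ = 0%E) ?lee_fin ?mulr_ge0 ?powR_ge0 ?sqr_ge0//.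
  by apply: integral0_eq => x _; rewrite /k /B y0 z00 expr0n/= !mulr0.
have {}y0 : 0 < enorm (X t) by rewrite enorm_gt0.
have := h2 lam (X t) l0; set I := eint _ => hI.
have -> : eint (fun x => k x (X t)) = ((C1 * B (X t))%:E * I)%E.
  rewrite -(eintZ (mulr_ge0 C10 (B0 (X t)))); first last.
  - by move=> x; rewrite mulr_ge0 ?powR_ge0 ?bump_kernel_ge0.
  - apply: meas_rVM; last exact: meas_enorm_powR.
    exact: (meas_rV_sub _ (meas_bump_kernel _ _)).
  apply: eq_integral => x _; congr (_%:E).
  by rewrite /k /A bump_kernelB; ring.
apply: (@le_trans _ _ ((C1 * B (X t))%:E * (C2 * enorm (X t) `^ (- (2 * ta)))%:E)%E).
  apply: lee_wpmul2l; first by rewrite lee_fin mulr_ge0.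
  by rewrite powRN EFinM lee_pdivlMr ?powR_gt0// muleC.
by rewrite -EFinM lee_fin ps /B le_eqVlt; apply/orP; left; apply/eqP; ring.
Qed.

End weighted_estimates.

(** * Localisation in space, seen in frequency *)

Section localisation.
Context {R : realType} {n : nat}.
Local Notation T := (n.-tuple (measurableTypeR R)).
Local Notation X := (@rV_of_tuple R n).
Local Notation V := 'rV[R]_n.
Local Notation lebn := (lebn R n).
Implicit Types f g h w : V -> R.

Lemma cosM (a b : R) : cos a * cos b = 2^-1 * (cos (a - b) + cos (a + b)).
Proof. by rewrite cosB cosD; lra. Qed.

Lemma integrable_rV_bounded g (k : V -> R) (M : R) : integrable_rV g -> meas_rV k ->
  (forall x, `|k x| <= M) -> integrable_rV (fun x => g x * k x).
Proof.
move=> ig mk kM; have [mg _] := (integrable_rVP g).1 ig.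
apply: (le_integrable_rV _ _ (integrable_rVZ M (integrable_rV_norm ig))).
  exact: measurable_funM.
by move=> x; rewrite normrM mulrC ler_wpM2r.
Qed.

Lemma Rint_eq0 (f : T -> R) : (forall t, [set: T] t -> f t = 0) -> \int[lebn]_t f t = 0.
Proof.
move=> f0; apply: (etrans (y := \int[lebn]_(t in [set: T]) (0 : R))).
  by apply: eq_Rintegral => t _; exact: f0.
by rewrite Rintegral_cst// mul0r.
Qed.

Lemma ctrans_bounded h a xi : test_fun h -> `|ctrans h a xi| <= \int[lebn]_t `|h (X t)|.
Proof. by move=> /test_fun_integrable; exact: ctrans_norm_le. Qed.

Lemma meas_ctrans h a : test_fun h -> meas_rV (ctrans h a).
Proof. by move=> th; exact: (continuous_meas_rV (@continuous_ctrans _ _ _ a (test_fun_ccs th))). Qed.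

Lemma measurable_dot_cos (a : R) :
  measurable_fun [set: T * T] (fun st => cos (dot (X st.1) (X st.2) + a)).
Proof.
by apply: measurable_cos_comp; apply: measurable_funD => //; exact: measurable_dot2.
Qed.

Lemma measurable_dot_cosC (a : R) :
  measurable_fun [set: T * T] (fun st => cos (dot (X st.2) (X st.1) + a)).
Proof.
by have := measurable_dot_cos a; under eq_fun do rewrite dotC.
Qed.

(** Unfolding the transforms of [q] and [w] turns the integral into a superposition, over x in the
    support of [w] and y in that of [q], of values of [ctrans b] at x - y and x + y. Both signs
    arise from the product formula for cosines. With [b] a symbol this says that its convolution
    kernel only acts through its values at differences of points of the two supports. *)
Lemma ctrans_orthogonal (b q w : V -> R) (th : R) (xi : V) :
  integrable_rV b -> (forall x, b (- x) = b x) -> test_fun q -> test_fun w ->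
  (forall x y, w x != 0 -> q y != 0 -> ctrans b 0 (x - y) = 0 /\ ctrans b 0 (x + y) = 0) ->
  \int[lebn]_t (b (X t) * ctrans q 0 (xi - X t) * ctrans w th (X t)) = 0.
Proof.
move=> ib eb tq tw h.
have mq : meas_rV (fun x => ctrans q 0 (xi - x)) by exact: (meas_rV_sub xi (meas_ctrans 0 tq)).
have iq := integrable_rV_bounded ib mq (fun x => ctrans_bounded 0 (xi - x) tq).
apply: (etrans (Rint_swap (k := fun x y => cos (dot y x + th)) iq (test_fun_integrable tw)
  (measurable_dot_cosC th) (fun x y => norm_cos_le1 _))).
apply: Rint_eq0 => t _.
have [->|wx] := eqVneq (w (X t)) 0; first by rewrite mul0r.
suff -> : \int[lebn]_s (b (X s) * ctrans q 0 (xi - X s) * cos (dot (X t) (X s) + th)) = 0.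
  by rewrite mulr0.
have ibc : integrable_rV (fun s => b s * cos (dot (X t) s + th)).
  by have := integrable_cos (X t) th ib; under eq_fun do rewrite dotC.
have mk : measurable_fun [set: T * T] (fun st => cos (dot (X st.2) (xi - X st.1) + 0)).
  apply: measurable_cos_comp; apply: measurable_funD => //.
  under eq_fun do rewrite dotDr dotNr; apply: measurable_funB.
    have mx := continuous_meas_rV (@continuous_dot_addr R n xi 0).
    have := measurableT_comp mx (@measurable_snd _ _ T T).
    by rewrite /comp; under eq_fun do rewrite addr0.
  by under eq_fun do rewrite dotC; exact: measurable_dot2.
have := Rint_swap (k := fun x y => cos (dot y (xi - x) + 0)) ibc (test_fun_integrable tq) mk
  (fun x y => norm_cos_le1 _).
move=> sw; apply: (etrans (y := \int[lebn]_s (b (X s) * cos (dot (X t) (X s) + th) *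
    ctrans q 0 (xi - X s)))).
  by apply: eq_Rintegral => s _; rewrite mulrAC.
apply: (etrans sw) => {sw}.
apply: Rint_eq0 => y _.
have [->|qy] := eqVneq (q (X y)) 0; first by rewrite mul0r.
have [h1 h2] := h _ _ wx qy.
suff -> : \int[lebn]_s (b (X s) * cos (dot (X t) (X s) + th) *
    cos (dot (X y) (xi - X s) + 0)) = 0 by rewrite mulr0.
have i1 := integrable_cos (X t + X y) (th - dot (X y) xi) ib.
have i2 := integrable_cos (X t - X y) (th + dot (X y) xi) ib.
apply: (etrans (y := 2^-1 * (ctrans b (th - dot (X y) xi) (X t + X y) +
    ctrans b (th + dot (X y) xi) (X t - X y)))); last first.
  by rewrite ctrans_even// [X in _ + X]ctrans_even// h1 h2 !mulr0 addr0 mulr0.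
rewrite /ctrans -(Rint_rVD i1 i2) -(Rint_rVZ _ (integrable_rVD i1 i2)).
apply: eq_Rintegral => s _.
rewrite -mulrA cosM mulrCA -mulrDr; congr (_ * (_ * (cos _ + cos _)));
  rewrite !dotDr ?dotNr !(dotC (X s)); ring.
Qed.

(** Since w h = w, the transform of [w] is its own convolution with the transform of [h], up to the
    inversion constant. Two translates are averaged because a product of cosines is half the sum of
    two cosines. *)
Lemma ctrans_reproducing (c : R) (h w : V -> R) (th : R) (eta : V) :
  (0 < n)%N -> test_fun h -> test_fun w ->
  (forall x, ctrans (ctrans h 0) 0 x = c * h x) -> (forall x, w x != 0 -> h x = 1) ->
  c * ctrans w th eta =
  \int[lebn]_t (ctrans h 0 (X t) *
    (2^-1 * (ctrans w th (eta - X t) + ctrans w th (eta + X t)))).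
Proof.
move=> n0 the tw hc w1; have iw := test_fun_integrable tw.
have ih := integrable_ctrans n0 0 the.
have iwc := integrable_cos eta th iw.
apply/esym; apply: (etrans (y := \int[lebn]_t (ctrans h 0 (X t) *
  \int[lebn]_s (w (X s) * cos (dot (X s) eta + th) * cos (dot (X s) (X t) + 0))))).
  apply: eq_Rintegral => t _; congr (_ * _).
  have i1 := integrable_cos (eta - X t) th iw; have i2 := integrable_cos (eta + X t) th iw.
  rewrite /ctrans -(Rint_rVD i1 i2) -(Rint_rVZ _ (integrable_rVD i1 i2)).
  apply: eq_Rintegral => s _.
  rewrite -[in RHS]mulrA cosM mulrCA -mulrDr; congr (_ * (_ * (cos _ + cos _)));
    rewrite !dotDr ?dotNr; ring.
have sw := Rint_swap (k := fun x y => cos (dot y x + 0)) ih iwc (measurable_dot_cosC 0)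
  (fun x y => norm_cos_le1 _).
apply: (etrans sw) => {sw}; rewrite /ctrans -(Rint_rVZ _ iwc).
apply: eq_Rintegral => s _.
have -> : \int[lebn]_t (ctrans h 0 (X t) * cos (dot (X s) (X t) + 0)) = c * h (X s).
  by rewrite -hc; apply: eq_Rintegral => t _; rewrite dotC.
have [->|wx] := eqVneq (w (X s)) 0; first by rewrite !mul0r mulr0.
rewrite (w1 _ wx) mulr1 mulrC; reflexivity.
Qed.

(* The substitution of the formula for [ctrans q 0] moves the product into a
   superposition of translates of [ctrans h 0]. *)
Lemma ctrans_prod_bound (h q : V -> R) (P : nat) : test_fun h -> test_fun q ->
  exists C : R, 0 <= C /\ forall (tau : R) (zeta : V), 0 < tau ->
   `|ctrans (fun z => h z * ctrans q 0 (tau *: z)) 0 zeta| <=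
   C * Num.max 1 tau ^+ (2 * P) * bracket zeta ^- P.
Proof.
move=> the tq; have [C [C0 hC]] := ctrans_decay P the.
have [_ [r hr]] := tq; have iq := test_fun_integrable tq; have ih := test_fun_integrable the.
pose I := \int[lebn]_t `|q (X t)|.
have I0 : 0 <= I by apply: Rintegral_ge0.
exists (C * (2 * (1 + r ^+ 2)) ^+ P * I).
have r2 : 0 <= 2 * (1 + r ^+ 2) by rewrite mulr_ge0// addr_ge0// sqr_ge0.
split; first by rewrite !mulr_ge0// exprn_ge0.
move=> tau zeta t0.
set mx := Num.max 1 tau; have m1 : 1 <= mx by rewrite le_max lexx.
have mx0 : 0 <= mx by rewrite (le_trans ler01).
have mt : tau <= mx by rewrite le_max lexx orbT.
have ihc := integrable_cos zeta 0 ih.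
pose K (y : V) := 2^-1 * (ctrans h 0 (zeta - tau *: y) + ctrans h 0 (zeta + tau *: y)).
have -> : ctrans (fun z => h z * ctrans q 0 (tau *: z)) 0 zeta =
    \int[lebn]_t (q (X t) * K (X t)).
  have mk : measurable_fun [set: T * T] (fun st => cos (dot (X st.2) (tau *: X st.1) + 0)).
    apply: measurable_cos_comp; apply: measurable_funD => //.
    under eq_fun do rewrite dotZr; apply: measurable_funM => //.
    by under eq_fun do rewrite dotC; exact: measurable_dot2.
  have sw := Rint_swap (k := fun x y => cos (dot y (tau *: x) + 0)) ihc iq mk
    (fun x y => norm_cos_le1 _).
  apply: (etrans (y := \int[lebn]_t (h (X t) * cos (dot (X t) zeta + 0) *
      ctrans q 0 (tau *: X t)))).
    by apply: eq_Rintegral => t _; rewrite mulrAC.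
  apply: (etrans sw) => {sw}; apply: eq_Rintegral => y _; congr (_ * _).
  have i1 := integrable_cos (zeta - tau *: X y) 0 ih.
  have i2 := integrable_cos (zeta + tau *: X y) 0 ih.
  rewrite /K /ctrans -(Rint_rVD i1 i2) -(Rint_rVZ _ (integrable_rVD i1 i2)).
  apply: eq_Rintegral => s _.
  rewrite -mulrA cosM mulrCA -mulrDr; congr (_ * (_ * (cos _ + cos _)));
    rewrite !dotDr ?dotNr !dotZr (dotC (X y)); ring.
pose D := C * (2 * (1 + r ^+ 2)) ^+ P * mx ^+ (2 * P) * bracket zeta ^- P.
have D0 : 0 <= D.
  rewrite /D !mulr_ge0// ?exprn_ge0//.
  by rewrite invr_ge0 exprn_ge0// ltW// bracket_gt0.
have mK : meas_rV K.
  apply: meas_rVZ; apply: meas_rVD.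
    have := meas_rV_affine (- tau) zeta (meas_ctrans 0 the); rewrite /meas_rV.
    by congr measurable_fun; apply/funext => t /=; rewrite scaleNr addrC.
  have := meas_rV_affine tau zeta (meas_ctrans 0 the); rewrite /meas_rV.
  by congr measurable_fun; apply/funext => t /=; rewrite addrC.
have bnd (y v : V) : enorm y <= r -> enorm (zeta - v) = tau * enorm y ->
    `|ctrans h 0 v| <= D.
  move=> yr vy; apply: le_trans (hC 0 v) _; rewrite /D -!mulrA ler_wpM2l//.
  have bz := bracket_peetre zeta v.
  have b1 : bracket (zeta - v) <= (1 + r ^+ 2) * mx ^+ 2.
    have r0 : 0 <= r by apply: le_trans yr; exact: enorm_ge0.
    have ty : tau * enorm y <= r * mx by rewrite mulrC ler_pM ?enorm_ge0// ltW.
    rewrite bracketE vy mulrDl mul1r; apply: lerD; first by rewrite expr_ge1.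
    rewrite -exprMn lerXn2r// nnegrE; first by rewrite mulr_ge0 ?enorm_ge0// ltW.
    exact: mulr_ge0.
  have r3 : 0 <= 1 + r ^+ 2 by rewrite addr_ge0 ?sqr_ge0.
  have bv := bracket_gt0 v; have bze := bracket_gt0 zeta.
  rewrite mulrA ler_pdivlMr ?exprn_gt0// mulrC ler_pdivrMr ?exprn_gt0//.
  rewrite exprM -!exprMn lerXn2r ?nnegrE ?mulr_ge0 ?(ltW bze) ?(ltW bv) ?sqr_ge0//.
  by apply: le_trans bz _; rewrite mulrAC ler_wpM2r ?(ltW bv)// -mulrA ler_wpM2l.
rewrite -/D; have -> : C * (2 * (1 + r ^+ 2)) ^+ P * I * mx ^+ (2 * P) * bracket zeta ^- P = D * I.
  by rewrite /D; ring.
have qK y : `|q y * K y| <= D * `|q y|.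
  rewrite normrM mulrC; have [->|qy] := eqVneq (q y) 0; first by rewrite normr0 !mulr0.
  rewrite ler_wpM2r// /K normrM ger0_norm ?invr_ge0//.
  have e1 : enorm (zeta - (zeta - tau *: y)) = tau * enorm y.
    by rewrite opprB addrC subrK enormZ gtr0_norm.
  have e2 : enorm (zeta - (zeta + tau *: y)) = tau * enorm y.
    by rewrite opprD addrA subrr add0r enormN enormZ gtr0_norm.
  have b1 := bnd _ _ (hr _ qy) e1; have b2 := bnd _ _ (hr _ qy) e2.
  by have := ler_normD (ctrans h 0 (zeta - tau *: y)) (ctrans h 0 (zeta + tau *: y)); lra.
have iqK : integrable_rV (fun y => q y * K y).
  apply: (le_integrable_rV _ qK (integrable_rVZ D (integrable_rV_norm iq))).
  exact: (meas_rVM (continuous_meas_rV (test_fun_continuous tq)) mK).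
apply: le_trans (normr_Rint_rV iqK) _; rewrite /I -(Rint_rVZ D (integrable_rV_norm iq)).
exact: (le_Rint_rV (integrable_rV_norm iqK) (integrable_rVZ D (integrable_rV_norm iq)) qK).
Qed.

End localisation.

(** * Unordered sums and finite lists *)

Section esum_seq.
Context {R : realType} {I : choiceType}.
Implicit Types (f : I -> \bar R) (s : seq I).

Lemma sum_le_esum f s : (forall i, 0 <= f i)%E -> uniq s ->
  (\sum_(i <- s) f i <= \esum_(i in [set: I]) f i)%E.
Proof.
move=> f0 us; apply: esum_ge; exists [set` s]; last by rewrite -fsbig_seq.
by split => //; exact: finite_seq.
Qed.

Lemma esum_le_sum f (C : \bar R) :
  (forall s, uniq s -> \sum_(i <- s) f i <= C)%E -> (\esum_(i in [set: I]) f i <= C)%E.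
Proof.
move=> h; apply: ub_ereal_sup => _ [A [fA _] <-].
by rewrite fsbig_finite//; apply: h; exact: finmap.fset_uniq.
Qed.

Lemma esum_seqE f s : (forall i, 0 <= f i)%E -> uniq s -> (forall i, i \notin s -> f i = 0%E) ->
  \esum_(i in [set: I]) f i = (\sum_(i <- s) f i)%E.
Proof.
move=> f0 us fs; apply/eqP; rewrite eq_le sum_le_esum// andbT.
apply: esum_le_sum => r ur.
rewrite (bigID (mem s))/= [X in (_ + X)%E]big1 ?adde0; last by move=> i /fs.
rewrite -big_filter; have fr := filter_uniq (mem s) ur.
rewrite [leRHS](bigID (mem r))/=.
rewrite (_ : \sum_(i <- s | i \in r) f i = \sum_(i <- [seq x <- r | mem s x]) f i)%E.
  by rewrite leeDl// sume_ge0.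
rewrite -big_filter; apply/perm_big/uniq_perm; [exact: filter_uniq|exact: fr|].
by move=> i; rewrite !mem_filter/= andbC.
Qed.

End esum_seq.

(** * Kernels of the localised operators *)

Section dyadic_annuli.
Context {R : realType} {n : nat}.
Local Notation T := (n.-tuple (measurableTypeR R)).
Local Notation X := (@rV_of_tuple R n).
Local Notation V := 'rV[R]_n.
Local Notation lebn := (lebn R n).
Variable phi : R -> R.
Hypothesis Hphi : dyadic_generator phi.

Lemma generator_derivable (j : nat) (r : R) : derivable (phi^`(j))%classic r 1.
Proof. by case: Hphi. Qed.

Lemma generator_supp : exists c d : R, [/\ 1 / 2 < c, d < 2 & forall r, phi r != 0 -> c <= r <= d].
Proof. by case: Hphi. Qed.

Lemma generator_lt r : phi r != 0 -> 2^-1 < r < 2.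
Proof.
by have [c [d [c2 d2 h]]] := generator_supp => /h; rewrite mul1r in c2; lra.
Qed.

Lemma generator_ge0 r : 0 <= phi r.
Proof. by case: Hphi. Qed.

Lemma generator_eq0 r : r <= 0 -> phi r = 0.
Proof. by move=> r0; apply/eqP/negPn/negP => /generator_lt; lra. Qed.

Lemma generator_sum_le1 (r : R) (s : seq int) : uniq s ->
  \sum_(k <- s) phi (r / 2 ^ k) <= 1.
Proof.
move=> us; have [r0|r0] := leP r 0.
  rewrite big1 ?ler01// => k _; apply: generator_eq0.
  by rewrite pmulr_lle0// invr_gt0 exprz_gt0.
case: Hphi => _ _ _ /(_ r r0) h; rewrite -lee_fin -h -sumEFin.
by apply: sum_le_esum => // i; rewrite lee_fin generator_ge0.
Qed.

Lemma generator_le1 r : phi r <= 1.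
Proof.
have := @generator_sum_le1 r [:: 0] isT.
by rewrite big_seq1 expr0z divr1.
Qed.

(** As [phi] lives in (1/2, 2), only the five indices k with |k| <= 2 can contribute on this
    range. *)
Lemma generator_sum_near (r : R) : 4^-1 <= r <= 4 ->
  \sum_(0 <= i < 5) phi (r / 2 ^ (i%:Z - 2)) = 1.
Proof.
move=> /andP[r1 r4]; have r0 : 0 < r by lra.
case: Hphi => _ _ _ /(_ r r0); rewrite (esum_seqE (s := [seq i%:Z - 2 | i <- iota 0 5])).
- by rewrite big_map sumEFin => -[]; rewrite /index_iota subn0.
- by move=> k; rewrite lee_fin generator_ge0.
- by [].
move=> k kn; congr EFin; apply/eqP; apply: contraNT kn => /generator_lt.
have k2 : (0 : R) < 2 ^ k by rewrite exprz_gt0.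
rewrite ltr_pdivrMr// ltr_pdivlMr// => /andP[h1 h2].
have ln2 : (1 : R) < 2 by lra.
have u : k < 3.
  by rewrite -(ltr_eXz2l ln2); apply: (@le_lt_trans _ _ (2 * 2 ^ k / 2)); [lra|rewrite (_ : 2 ^ 3 = 8); [lra|by rewrite -exprnP; ring]].
have l : - 3 < k.
  by rewrite -(ltr_eXz2l ln2) (_ : (2 : R) ^ (- 3) = 8^-1); [lra|rewrite -exprnN; congr (_^-1); ring].
have : k \in [:: -2; -1; 0; 1; 2] by rewrite !inE; lia.
by rewrite !inE => /or4P[|||/orP[]] /eqP ->.
Qed.

(** [dyadic] with an arbitrary scale instead of a power of 2, so that everything can be rescaled to
    [annulus 1]. *)
Definition annulus (lam : R) (x : V) : R := phi (enorm x / lam).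

Lemma annulus_phi lam x : annulus lam x = phi (enorm x / lam).
Proof. by []. Qed.

Lemma annulusE lam x : 0 < lam -> annulus lam x = radial phi 0 0 lam x.
Proof. by move=> l0; rewrite /radial derive1n0 powRr0 mulr1. Qed.

Lemma annulus_supp lam x : 0 < lam -> annulus lam x != 0 -> lam / 2 < enorm x < 2 * lam.
Proof.
by move=> l0 /generator_lt; rewrite ltr_pdivrMr// ltr_pdivlMr// mulrC.
Qed.

Lemma annulus0 lam : annulus lam 0 = 0.
Proof. by rewrite /annulus enorm0 mul0r generator_eq0. Qed.

Lemma annulus_ge0 lam x : 0 <= annulus lam x.
Proof. exact: generator_ge0. Qed.

Lemma annulus_le1 lam x : annulus lam x <= 1.
Proof. exact: generator_le1. Qed.

Lemma annulusN lam x : annulus lam (- x) = annulus lam x.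
Proof. by rewrite /annulus enormN. Qed.

Lemma test_fun_generator_radial p lam : 0 < lam -> test_fun (@radial R n phi 0 p lam).
Proof.
have [c [d [c2 d2 h]]] := generator_supp; have c0 : 0 < c by rewrite mul1r in c2; lra.
exact: (@test_fun_radial R n phi c d c0 generator_derivable h 0 p lam).
Qed.

Lemma test_fun_annulus lam : 0 < lam -> test_fun (annulus lam).
Proof.
move=> l0; rewrite (_ : annulus lam = radial phi 0 0 lam); first exact: test_fun_generator_radial.
by apply/funext => x; exact: annulusE.
Qed.

Lemma annulus_scale lam x : 0 < lam -> annulus lam x = annulus 1 (lam^-1 *: x).
Proof.
by move=> l0; rewrite /annulus divr1 enormZ gtr0_norm ?invr_gt0// mulrC.
Qed.

Lemma ctrans_annulus lam a xi : 0 < lam ->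
  ctrans (annulus lam) a xi = lam ^+ n * ctrans (annulus 1) a (lam *: xi).
Proof.
move=> l0; have li : lam^-1 != 0 by rewrite invr_eq0 gt_eqF.
have := ctrans_scale a xi li (test_fun_integrable (test_fun_annulus ltr01)).
rewrite invrK gtr0_norm ?invr_gt0// exprVn invrK => <-.
by apply: eq_Rintegral => t _; rewrite annulus_scale.
Qed.

(* Multiplied by [|x|^p]; for [p = 0] it is 1 on [1/4 <= |x| <= 4]. *)
Definition cutoff (p : R) (x : V) : R :=
  \sum_(0 <= i < 5) radial phi 0 p (2 ^ (i%:Z - 2)) x.

Lemma test_fun_cutoff p : test_fun (cutoff p).
Proof.
by apply: test_fun_sum => i; apply: test_fun_generator_radial; rewrite exprz_gt0.
Qed.

Lemma cutoffN p x : cutoff p (- x) = cutoff p x.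
Proof. by apply: eq_bigr => i _; rewrite /radial enormN. Qed.

Lemma cutoffE p x : cutoff p x = cutoff 0 x * enorm x `^ p.
Proof.
by rewrite /cutoff big_distrl/=; apply: eq_bigr => i _; rewrite /radial powRr0 mulr1.
Qed.

Lemma cutoff0 x : 4^-1 <= enorm x <= 4 -> cutoff 0 x = 1.
Proof.
move=> /generator_sum_near <-; apply: eq_bigr => i _.
by rewrite /radial derive1n0 powRr0 mulr1.
Qed.

(** The cut-off vanishes at the origin, so the negative power does no harm there. *)
Lemma cutoff_dot N x : cutoff (- (2 * N)%:R) x * dot x x ^+ N = cutoff 0 x.
Proof.
rewrite cutoffE -sqr_enorm -exprM -mulrA.
have [->|x0] := eqVneq x 0.
  rewrite /cutoff big1 ?mul0r// => i _.
  by rewrite /radial derive1n0 enorm0 mul0r generator_eq0 ?mul0r.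
have e0 : 0 < enorm x by rewrite enorm_gt0.
rewrite -powR_mulrn ?enorm_ge0// powRN mulVf ?mulr1// gt_eqF// powR_gt0//.
Qed.

End dyadic_annuli.

(** * Truncated symbols and reproducing bounds *)

Section off_diagonal.
Context {R : realType} {n : nat}.
Local Notation T := (n.-tuple (measurableTypeR R)).
Local Notation X := (@rV_of_tuple R n).
Local Notation V := 'rV[R]_n.
Local Notation lebn := (lebn R n).
Hypothesis n_gt0 : (0 < n)%N.
Variable phi : R -> R.
Hypothesis Hphi : dyadic_generator phi.
Local Notation annulus := (@annulus R n phi).
Local Notation cutoff := (@cutoff R n phi).

Let test_annulus lam : 0 < lam -> test_fun (annulus lam) := @test_fun_annulus R n phi Hphi lam.
Let test_cutoff p : test_fun (cutoff p) := @test_fun_cutoff R n phi Hphi p.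

Lemma normr_Rint_eint (g : V -> R) : integrable_rV g ->
  ((`|\int[lebn]_t g (X t)|)%:E <= eint (fun x => `|g x|%R))%E.
Proof.
move=> ig; have [mg _] := (integrable_rVP g).1 ig.
have mgE : measurable_fun [set: T] (fun t => (g (X t))%:E) by exact/measurable_EFinP.
apply: le_trans (le_abse_integral lebn measurableT mgE).
by rewrite /Rintegral -(fineK (integrable_fin_num measurableT ig)) /=.
Qed.

(** The partition of unity at radius 1 forces a nonzero value of [phi]. Such a point is what
    [inversion_constant] asks for. *)
Lemma annulus_gt0 : exists y0 : V, 0 < annulus 1 y0.
Proof.
have h41 : 4^-1 <= (1 : R) <= 4 by lra.
have := generator_sum_near Hphi h41.
have [/hasP[i _ pi0]|/hasPn no] := boolP (has (fun i => phi (1 / 2 ^ (i%:Z - 2)) != 0) (index_iota 0 5)).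
  move=> _; set r : R := 1 / 2 ^ (i%:Z - 2) in pi0 *.
  have r0 : 0 <= r by rewrite divr_ge0// ltW// exprz_gt0.
  exists (r *: delta_mx 0 (Ordinal n_gt0)).
  rewrite annulus_phi enormZ (ger0_norm r0) divr1.
  have -> : enorm (delta_mx 0 (Ordinal n_gt0) : V) = 1.
    by rewrite /enorm dot_delta mxE !eqxx sqrtr1.
  by rewrite mulr1 lt0r pi0 generator_ge0.
rewrite big1_seq => [/esym/eqP|i /andP[_ /no]]; first by rewrite oner_eq0.
by rewrite negbK => /eqP.
Qed.

Lemma even_fourier_inversion : exists c : R, c != 0 /\
  forall (h : V -> R) x, test_fun h -> (forall x, h (- x) = h x) -> ctrans (ctrans h 0) 0 x = c * h x.
Proof.
have [y0 Ay] := annulus_gt0.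
have [c [c0 hc]] := inversion_constant n_gt0 (test_annulus ltr01)
  (annulusN phi 1) (annulus_ge0 Hphi 1) Ay.
exists c; split => // h x th eh; rewrite (inversion_even n_gt0 0 x hc th eh) cos0 mul1r//.
Qed.

(** For tau = 2^m 2^l this is 2^(-|l + m|), the size of the kernel of P_l cut off to |z| ~ 2^m. *)
Definition gain (tau : R) : R := Num.min tau tau^-1.

Lemma gain_ge0 tau : 0 < tau -> 0 <= gain tau.
Proof. by move=> t0; rewrite /gain le_min invr_ge0 (ltW t0). Qed.

(* For large [tau] the decay comes from [cutoff 0 = |y|^(2N) cutoff (-2N)], the
   power of [y] being turned into a power of the Laplacian on [annulus 1]. *)
Lemma cutoff_prod_bound (P : nat) : exists C : R, 0 <= C /\
  forall (tau : R) (zeta : V), 0 < tau ->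
    tau ^+ n * `|ctrans (fun y => cutoff 0 y * ctrans (annulus 1) 0 (tau *: y)) 0 zeta| <=
    C * gain tau * bracket zeta ^- P.
Proof.
(* The Laplacian yields 2 N inverse powers of [tau]: 2 P of them offset the loss in
   [ctrans_prod_bound], n offset the factor [tau ^+ n], and the n >= 1 remaining ones give the
   gain. *)
pose N := (P + n)%N; have eN : (2 * N = n + (n + 2 * P))%N by rewrite /N; lia.
pose A := annulus 1; pose L := iter N laplacian A.
have tA : test_fun A by exact: (test_annulus ltr01).
have tL : test_fun L by exact: test_fun_iter_laplacian.
have [C1 [C10 h1]] := ctrans_prod_bound P (test_cutoff 0) tA.
have [C2 [C20 h2]] := ctrans_prod_bound P (test_cutoff (- (2 * N)%:R)) tL.
exists (C1 + C2); split; first exact: addr_ge0.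
move=> tau zeta t0.
have b0 : 0 <= bracket zeta ^- P by rewrite invr_ge0 exprn_ge0// ltW// bracket_gt0.
have tn0 : 0 <= tau ^+ n by rewrite exprn_ge0// ltW.
have [t1|/ltW t1] := leP tau 1.
  have gt : gain tau = tau by apply/min_idPl; rewrite (le_trans t1)// invf_ge1.
  have m1 : Num.max 1 tau = 1 by apply/max_idPl.
  have := h1 tau zeta t0; rewrite m1 expr1n mulr1 => h.
  apply: le_trans (ler_wpM2l tn0 h) _; rewrite mulrA ler_wpM2r// gt mulrC.
  apply: ler_pM => //; first by rewrite lerDl.
  by rewrite -(prednK n_gt0) exprS ler_piMr ?(ltW t0)// exprn_ile1// ltW.
have gt : gain tau = tau^-1 by apply/min_idPr; rewrite (le_trans _ t1)// invf_le1.
have m1 : Num.max 1 tau = tau by apply/max_idPr.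
have t2 : tau ^+ (2 * N) != 0 by rewrite expf_neq0// gt_eqF.
have -> : (fun y => cutoff 0 y * ctrans A 0 (tau *: y)) =
    (fun y => (-1) ^+ N * tau ^- (2 * N) *
      (cutoff (- (2 * N)%:R) y * ctrans L 0 (tau *: y))).
  apply/funext => y; rewrite ctrans_iter_laplacian// dotZl dotZr.
  have -> : (- (tau * (tau * dot y y))) ^+ N = (-1) ^+ N * (tau ^+ (2 * N) * dot y y ^+ N).
    by rewrite exprM -!exprMn; congr (_ ^+ _); ring.
  rewrite -(cutoff_dot Hphi N y).
  have s1 : (-1) ^+ N * (-1) ^+ N = 1 :> R by rewrite -expr2 sqrr_sign.
  move: s1 t2; move: ((-1) ^+ N) (tau ^+ (2 * N)) (cutoff _ y) (dot y y ^+ N) (ctrans A 0 _).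
  move=> a b c d e s1 b0'.
  transitivity ((a * a) * (b^-1 * b) * (c * d * e)); last by ring.
  by rewrite s1 mulVf// !mul1r.
have iL : integrable_rV (fun y => cutoff (- (2 * N)%:R) y * ctrans L 0 (tau *: y)).
  have mK : meas_rV (fun y => ctrans L 0 (tau *: y)).
    have := meas_rV_affine tau 0 (meas_ctrans 0 tL).
    by rewrite /meas_rV; under eq_fun do rewrite addr0.
  apply: (integrable_rV_bounded (test_fun_integrable (test_cutoff _)) mK) => y.
  exact: ctrans_bounded.
rewrite ctransZ// normrM normrM normrX normrN1 expr1n mul1r normfV normrX (gtr0_norm t0).
have := h2 tau zeta t0; rewrite m1 => h.
have tN : 0 <= tau ^- (2 * N) by rewrite invr_ge0 exprn_ge0// ltW.
apply: le_trans (ler_wpM2l tn0 (ler_wpM2l tN h)) _.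
rewrite gt.
have e : tau ^+ (2 * N) = tau ^+ n * (tau ^+ n * tau ^+ (2 * P)).
  by rewrite -!exprD eN.
have tnn : tau ^+ n != 0 by rewrite expf_neq0// gt_eqF.
have tpp : tau ^+ (2 * P) != 0 by rewrite expf_neq0// gt_eqF.
rewrite (_ : tau ^+ n * _ = C2 * tau ^- n * bracket zeta ^- P); last first.
  rewrite e; move: tnn tpp (bracket_gt0 zeta).
  move: (tau ^+ n) (tau ^+ (2 * P)) => a b a0 b0'.
  by rewrite !invfM; move: (bracket zeta ^- P) => z _; field; rewrite a0 b0'.
rewrite ler_wpM2r//; apply: ler_pM => //; [by rewrite invr_ge0|by rewrite lerDr|].
rewrite lef_pV2 ?posrE ?exprn_gt0// -{1}(expr1 tau) ler_weXn2l//.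
Qed.

(** The truncated kernel is an even test function, so even inversion exhibits it as the transform of
    [b], a multiple of its own transform. Rescaling by [mu] reduces the bound on [b] to
    [cutoff_prod_bound] at tau = mu nu. *)
Lemma truncated_symbol (P : nat) : exists C : R, 0 <= C /\
  forall mu nu : R, 0 < mu -> 0 < nu -> exists b : V -> R,
  [/\ integrable_rV b, forall x, b (- x) = b x,
      forall z, ctrans b 0 z = cutoff 0 (mu^-1 *: z) * ctrans (annulus nu) 0 z &
      forall x, `|b x| <= C * gain (mu * nu) * bracket (mu *: x) ^- P].
Proof.
have [C [C0 hC]] := cutoff_prod_bound P.
have [c [c0 hc]] := even_fourier_inversion.
exists (`|c|^-1 * C); split; first by rewrite mulr_ge0// invr_ge0.
move=> mu nu m0 v0.
pose g z := cutoff 0 (mu^-1 *: z) * ctrans (annulus nu) 0 z.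
have mi : mu^-1 != 0 by rewrite invr_eq0 gt_eqF.
have tA := test_annulus v0.
have tg : test_fun g.
  have := test_funMr (smooth_ctrans 0 (test_fun_ccs tA)) (test_fun_affine 0 mi (test_cutoff 0)).
  by rewrite /g; under eq_fun do rewrite addr0 mulrC.
have eg z : g (- z) = g z by rewrite /g scalerN cutoffN ctransN.
have ig := integrable_ctrans n_gt0 0 tg.
exists (fun x => c^-1 * ctrans g 0 x); split.
- exact: integrable_rVZ.
- by move=> x; rewrite ctransN.
- by move=> z; rewrite ctransZ// hc// mulKf.
move=> x; rewrite normrM normfV -!mulrA ler_wpM2l ?invr_ge0//.
pose g1 y := cutoff 0 y * ctrans (annulus 1) 0 ((mu * nu) *: y).
have t1 : test_fun (annulus 1) by exact: (test_annulus ltr01).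
have ig1 : integrable_rV g1.
  have mK : meas_rV (fun y => ctrans (annulus 1) 0 ((mu * nu) *: y)).
    have := meas_rV_affine (mu * nu) 0 (meas_ctrans 0 t1).
    by rewrite /meas_rV; under eq_fun do rewrite addr0.
  apply: (integrable_rV_bounded (test_fun_integrable (test_cutoff _)) mK) => y.
  exact: ctrans_bounded.
have gE : g = (fun z => nu ^+ n * g1 (mu^-1 *: z)).
  apply/funext => z; rewrite /g /g1 (ctrans_annulus Hphi _ _ v0) scalerA.
  by rewrite mulrAC mulfV ?gt_eqF// mul1r mulrCA.
have i2 : integrable_rV (fun z => g1 (mu^-1 *: z)).
  by have := integrable_rV_affine 0 mi ig1; under eq_fun do rewrite addr0.
have mm : `|mu^-1| ^- n = mu ^+ n by rewrite gtr0_norm ?invr_gt0// exprVn invrK.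
rewrite gE ctransZ// ctrans_scale// mm invrK [nu ^+ n * _]mulrA -exprMn [nu * mu]mulrC normrM ger0_norm ?exprn_ge0 ?mulr_ge0 ?(ltW m0) ?(ltW v0)//.
by rewrite mulrA; apply: hC; exact: mulr_gt0.
Qed.

(* Functions of frequency whose inverse Fourier transform lives in the shell
   [lam / 2 < |x| < 2 * lam]. *)
Definition shell_localised (lam : R) (W : V -> R) : Prop := exists w1 w2 (t1 t2 : R),
  [/\ test_fun w1 /\ test_fun w2,
      forall x, w1 x != 0 -> lam / 2 < enorm x < 2 * lam,
      forall x, w2 x != 0 -> lam / 2 < enorm x < 2 * lam &
      W = (fun xi => ctrans w1 t1 xi + ctrans w2 t2 xi)].

Lemma shell_localised_meas lam W : shell_localised lam W -> meas_rV W.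
Proof.
by move=> [w1 [w2 [t1 [t2 [[h1 h2] _ _ ->]]]]]; apply: meas_rVD; exact: meas_ctrans.
Qed.

Lemma shell_localised_integrable lam W : shell_localised lam W -> integrable_rV W.
Proof.
move=> [w1 [w2 [t1 [t2 [[h1 h2] _ _ ->]]]]].
exact: (integrable_rVD (integrable_ctrans n_gt0 t1 h1) (integrable_ctrans n_gt0 t2 h2)).
Qed.

Lemma annulus_decay (M : nat) : exists C : R, 0 <= C /\ forall lam a (xi : V), 0 < lam ->
  `|ctrans (annulus lam) a xi| <= C * bump_kernel M lam xi.
Proof.
have [C [C0 hC]] := ctrans_decay M (test_annulus ltr01).
exists C; split => // lam a xi l0.
rewrite (ctrans_annulus Hphi _ _ l0) normrM ger0_norm ?exprn_ge0 ?(ltW l0)//.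
by rewrite /bump_kernel mulrCA ler_wpM2l ?exprn_ge0 ?(ltW l0).
Qed.

Lemma cutoff_decay (M : nat) : exists C : R, 0 <= C /\ forall lam a (xi : V), 0 < lam ->
  `|ctrans (fun x => cutoff 0 (lam^-1 *: x)) a xi| <= C * bump_kernel M lam xi.
Proof.
have tc := test_cutoff 0; have [C [C0 hC]] := ctrans_decay M tc.
exists C; split => // lam a xi l0; have li : lam^-1 != 0 by rewrite invr_eq0 gt_eqF.
have mm : `|lam^-1| ^- n = lam ^+ n by rewrite gtr0_norm ?invr_gt0// exprVn invrK.
rewrite (ctrans_scale a xi li (test_fun_integrable tc)) mm invrK normrM ger0_norm ?exprn_ge0 ?(ltW l0)//.
by rewrite /bump_kernel mulrCA ler_wpM2l ?exprn_ge0 ?(ltW l0).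
Qed.

(** The rescaled cut-off is 1 on the shell, so [W] is its convolution with the transform of the
    cut-off. This is what allows point values of [W] to be estimated by an integral norm. *)
Lemma shell_localised_reproducing (M : nat) : exists C : R, 0 <= C /\
  forall lam W (eta : V), 0 < lam -> shell_localised lam W ->
  ((`|W eta|)%:E <= C%:E * eint (fun z => bump_kernel M lam (eta - z) * `|W z|)%R)%E.
Proof.
have half (r : R) : 2^-1 * (r + r) = r by lra.
have half12 := half 1.
have [c [c0 hc]] := even_fourier_inversion.
have [C [C0 hC]] := cutoff_decay M.
exists (`|c|^-1 * C); split; first by rewrite mulr_ge0// invr_ge0.
move=> lam W eta l0 lW; have mW := shell_localised_meas lW.
have iW := shell_localised_integrable lW.
have [w1 [w2 [t1 [t2 [[h1 h2] s1 s2 WE]]]]] := lW.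
pose h x := cutoff 0 (lam^-1 *: x).
have li : lam^-1 != 0 by rewrite invr_eq0 gt_eqF.
have th : test_fun h.
  by have := test_fun_affine 0 li (test_cutoff 0); under eq_fun do rewrite addr0.
have eh x : h (- x) = h x by rewrite /h scalerN cutoffN.
have h1E x : lam / 2 < enorm x < 2 * lam -> h x = 1.
  move=> /andP[a1 a2]; apply: (cutoff0 Hphi); rewrite enormZ gtr0_norm ?invr_gt0//.
  rewrite mulrC ler_pdivlMr// ler_pdivrMr//; apply/andP; split; lra.
have r1 := ctrans_reproducing t1 eta n_gt0 th h1 (fun x => hc h x th eh) (fun x p => h1E x (s1 x p)).
have r2 := ctrans_reproducing t2 eta n_gt0 th h2 (fun x => hc h x th eh) (fun x p => h1E x (s2 x p)).
have mc (w : V -> R) t (x : V) : test_fun w -> meas_rV (fun z => 2^-1 * (ctrans w t (x - z) + ctrans w t (x + z))).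
  move=> tw; apply: meas_rVZ; apply: meas_rVD; first exact: (meas_rV_sub x (meas_ctrans t tw)).
  have := meas_rV_affine 1 x (meas_ctrans t tw).
  by rewrite /meas_rV; under eq_fun do rewrite scale1r addrC.
have bc (w : V -> R) t (x : V) : test_fun w -> forall z,
    `|2^-1 * (ctrans w t (x - z) + ctrans w t (x + z))| <= \int[lebn]_s `|w (X s)|.
  move=> tw z; rewrite normrM ger0_norm ?invr_ge0//.
  have b1 := ctrans_bounded t (x - z) tw; have b2 := ctrans_bounded t (x + z) tw.
  apply: (le_trans (ler_wpM2l _ (ler_normD _ _))); rewrite ?invr_ge0//.
  by rewrite -[leRHS]half ler_wpM2l ?invr_ge0// lerD.
have ih := integrable_ctrans n_gt0 0 th.
have i1 := integrable_rV_bounded ih (mc _ t1 eta h1) (bc _ t1 eta h1).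
have i2 := integrable_rV_bounded ih (mc _ t2 eta h2) (bc _ t2 eta h2).
pose J z := 2^-1 * (W (eta - z) + W (eta + z)).
have cW : c * W eta = \int[lebn]_t (ctrans h 0 (X t) * J (X t)).
  rewrite WE mulrDr r1 r2 -(Rint_rVD i1 i2); apply: eq_Rintegral => t _.
  by rewrite /J WE -!mulrDr addrACA.
have iJ : integrable_rV (fun z => ctrans h 0 z * J z).
  have := integrable_rVD i1 i2; rewrite /integrable_rV; congr (_.-integrable _ _).
  by apply/funext => t; congr EFin; rewrite /J WE -!mulrDr addrACA.
have cp : 0 < `|c| by rewrite normr_gt0.
suff : ((`|c| * `|W eta|)%:E <= C%:E * eint (fun z => bump_kernel M lam (eta - z) * `|W z|)%R)%E.
  by rewrite EFinM muleC -lee_pdivlMr// => H; rewrite EFinM -muleA muleC.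
rewrite -normrM cW; apply: le_trans (normr_Rint_eint iJ) _.
have mk : meas_rV (fun z => bump_kernel M lam (eta - z) * `|W z|).
  by apply: meas_rVM; [exact: (meas_rV_sub eta (meas_bump_kernel _ _))|exact: meas_rV_norm].
have k0 z : 0 <= bump_kernel M lam (eta - z) * `|W z| by rewrite mulr_ge0 ?bump_kernel_ge0.
have m1 : meas_rV (fun z => bump_kernel M lam z * `|W (eta - z)|).
  apply: meas_rVM; first exact: meas_bump_kernel.
  exact: (meas_rV_norm (meas_rV_sub eta mW)).
have m2 : meas_rV (fun z => bump_kernel M lam z * `|W (eta + z)|).
  apply: meas_rVM; first exact: meas_bump_kernel.
  have := meas_rV_norm (meas_rV_affine 1 eta mW).
  by rewrite /meas_rV; under eq_fun do rewrite scale1r addrC.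
have k1 z : 0 <= bump_kernel M lam z * `|W (eta - z)| by rewrite mulr_ge0 ?bump_kernel_ge0.
have k2 z : 0 <= bump_kernel M lam z * `|W (eta + z)| by rewrite mulr_ge0 ?bump_kernel_ge0.
have C2 : 0 <= C * 2^-1 by rewrite mulr_ge0// invr_ge0.
apply: (@le_trans _ _ (eint (fun z => C * 2^-1 * (bump_kernel M lam z * `|W (eta - z)| +
    bump_kernel M lam z * `|W (eta + z)|)))).
  apply: le_eint.
  - by have [mJ _] := (integrable_rVP _).1 iJ; exact: meas_rV_norm.
  - by apply: meas_rVZ; exact: meas_rVD.
  move=> z; rewrite normr_ge0/= normrM.
  have -> : C * 2^-1 * (bump_kernel M lam z * `|W (eta - z)| +
      bump_kernel M lam z * `|W (eta + z)|) =
    (C * bump_kernel M lam z) * (2^-1 * (`|W (eta - z)| + `|W (eta + z)|)) by ring.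
  apply: ler_pM => //; first exact: hC.
  by rewrite /J normrM ger0_norm ?invr_ge0// ler_wpM2l ?invr_ge0// ler_normD.
have kk0 z : 0 <= bump_kernel M lam z * `|W (eta - z)| +
    bump_kernel M lam z * `|W (eta + z)| by exact: addr_ge0.
rewrite (eintZ C2 (meas_rVD m1 m2) kk0) (eintD m1 m2 k1 k2).
set E := eint (fun z => bump_kernel M lam (eta - z) * _)%R.
have mkE : emeas_rV (fun z => (bump_kernel M lam (eta - z) * `|W z|)%:E).
  exact/measurable_EFinP.
have k0E z : (0 <= (bump_kernel M lam (eta - z) * `|W z|)%:E)%E by rewrite lee_fin.
have -> : eint (fun z => bump_kernel M lam z * `|W (eta - z)|)%R = E.
  apply: (etrans _ (eint_subl mkE k0E eta)).
  by apply: eq_integral => t _; rewrite subKr.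
have -> : eint (fun z => bump_kernel M lam z * `|W (eta + z)|)%R = E.
  apply: (etrans _ (eint_subr mkE k0E (- eta))).
  apply: eq_integral => t _; rewrite opprK opprD addrCA subrr addr0 [X t + _]addrC.
  by rewrite /bump_kernel scalerN bracketN.
have E0 : (0 <= E)%E by exact: eint_ge0.
have C12 : C * 2^-1 * (1 + 1) = C by rewrite -mulrA half12 mulr1.
by rewrite -{1 2}(mul1e E) -ge0_muleDl// muleA -EFinD -EFinM C12.
Qed.

End off_diagonal.

(** * Blocks between separated shells *)

Section off_diagonal_bound.
Context {R : realType} {n : nat}.
Local Notation T := (n.-tuple (measurableTypeR R)).
Local Notation X := (@rV_of_tuple R n).
Local Notation V := 'rV[R]_n.
Local Notation lebn := (lebn R n).
Hypothesis n_gt0 : (0 < n)%N.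
Variable phi : R -> R.
Hypothesis Hphi : dyadic_generator phi.
Local Notation annulus := (@annulus R n phi).
Local Notation cutoff := (@cutoff R n phi).
Let test_annulus lam : 0 < lam -> test_fun (annulus lam) := @test_fun_annulus R n phi Hphi lam.
Let test_cutoff p : test_fun (cutoff p) := @test_fun_cutoff R n phi Hphi p.

Lemma meas_rV_scale (f : V -> R) (c : R) : meas_rV f -> meas_rV (fun x => f (c *: x)).
Proof.
by move=> /(meas_rV_affine c 0); rewrite /meas_rV; under eq_fun do rewrite addr0.
Qed.

(** The loss is expressed at the larger scale [mu] because that is the scale at which the truncated
    symbol decays. *)
Lemma bump_kernel_peetre M (lam mu : R) (x y : V) : 0 < lam <= mu ->
  bump_kernel M lam (x - y) <= 2 ^+ M * bracket (mu *: y) ^+ M * bump_kernel M lam x.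
Proof.
move=> /andP[l0 lm]; rewrite /bump_kernel mulrCA ler_wpM2l ?exprn_ge0 ?(ltW l0)//.
have bm := bracket_gt0 (mu *: y); have bx := bracket_gt0 (lam *: x).
have bxy := bracket_gt0 (lam *: (x - y)).
rewrite ler_pdivlMr ?exprn_gt0// mulrC ler_pdivrMr ?exprn_gt0// -!exprMn.
rewrite lerXn2r ?nnegrE ?mulr_ge0 ?(ltW bm) ?(ltW bx) ?(ltW bxy)//.
have := bracket_peetre (lam *: x) (lam *: y); rewrite -scalerBr => h; apply: le_trans h _.
by rewrite ler_wpM2r ?(ltW bxy)// ler_wpM2l// bracketZ_le// (ltW l0).
Qed.

(* The localised convolution Q_lam P_nu on the Fourier side. *)
Definition loc_conv (lam : R) (b W : V -> R) (xi : V) : R :=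
  \int[lebn]_t (b (X t) * ctrans (annulus lam) 0 (xi - X t) * W (X t)).

Lemma loc_conv_unfold lam b W xi : loc_conv lam b W xi =
  \int[lebn]_t (b (X t) * ctrans (annulus lam) 0 (xi - X t) * W (X t)).
Proof. by []. Qed.

Lemma integrable_loc_conv lam (b W : V -> R) xi M : 0 < lam -> integrable_rV b -> meas_rV W ->
  (forall x, `|W x| <= M) ->
  integrable_rV (fun x => b x * ctrans (annulus lam) 0 (xi - x) * W x).
Proof.
move=> l0 ib mW WM; apply: (integrable_rV_bounded _ mW WM).
apply: (integrable_rV_bounded ib (meas_rV_sub xi (meas_ctrans 0 (test_annulus l0)))).
by move=> x; apply: ctrans_bounded; exact: test_annulus.
Qed.

Lemma shell_localised_bounded lam (W : V -> R) : shell_localised lam W ->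
  exists M : R, forall x, `|W x| <= M.
Proof.
move=> [w1 [w2 [t1 [t2 [[h1 h2] _ _ ->]]]]].
exists (\int[lebn]_t `|w1 (X t)| + \int[lebn]_t `|w2 (X t)|) => x.
by apply: le_trans (ler_normD _ _) _; apply: lerD; exact: ctrans_bounded.
Qed.

Definition shells_apart (lam lam' mu : R) := forall x y : V,
  lam' / 2 < enorm x < 2 * lam' -> lam / 2 < enorm y < 2 * lam ->
  mu / 4 <= enorm (x - y) <= 4 * mu.

(** The two symbols have kernels that agree for mu/4 <= |z| <= 4 mu, which contains all differences
    of points of the two shells; [ctrans_orthogonal] applies to the difference of the symbols. Sums
    x + y are differences x - (-y), the shells being symmetric. *)
Lemma loc_conv_truncate lam lam' mu nu (b W : V -> R) xi : 0 < lam -> 0 < mu -> 0 < nu ->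
  shells_apart lam lam' mu -> integrable_rV b -> (forall x, b (- x) = b x) ->
  (forall z, ctrans b 0 z = cutoff 0 (mu^-1 *: z) * ctrans (annulus nu) 0 z) ->
  shell_localised lam' W -> loc_conv lam (annulus nu) W xi = loc_conv lam b W xi.
Proof.
move=> l0 m0 v0 sep ib eb hb lW.
have [M WM] := shell_localised_bounded lW; have mW := shell_localised_meas lW.
have iA := test_fun_integrable (test_annulus v0).
have i1 := integrable_loc_conv xi l0 iA mW WM; have i2 := integrable_loc_conv xi l0 ib mW WM.
apply/eqP; rewrite -subr_eq0; apply/eqP; rewrite /loc_conv -(Rint_rVB i1 i2).
have [w1 [w2 [t1 [t2 [[h1 h2] s1 s2 WE]]]]] := lW.
pose d x := annulus nu x - b x.
have id : integrable_rV d by exact: integrable_rVB.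
have ed x : d (- x) = d x by rewrite /d eb annulusN.
have z w t : test_fun w -> (forall x, w x != 0 -> lam' / 2 < enorm x < 2 * lam') ->
    \int[lebn]_s (d (X s) * ctrans (annulus lam) 0 (xi - X s) * ctrans w t (X s)) = 0.
  move=> tw sw; apply: (ctrans_orthogonal t xi id ed (test_annulus l0) tw) => x y wx qy.
  have ys := annulus_supp Hphi l0 qy; have xs := sw _ wx.
  have zero v : mu / 4 <= enorm v <= 4 * mu -> ctrans d 0 v = 0.
    move=> /andP[v1 v2]; have cd := ctransD 0 v iA (integrable_rVZ (-1) ib).
    have -> : ctrans d 0 v = ctrans (annulus nu) 0 v - ctrans b 0 v.
      rewrite -mulN1r -(ctransZ (-1) 0 v ib) -cd; apply: eq_Rintegral => s _.
      by rewrite /d mulN1r.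
    rewrite hb (cutoff0 Hphi) ?mul1r ?subrr//.
    rewrite enormZ gtr0_norm ?invr_gt0// mulrC ler_pdivlMr// ler_pdivrMr//.
    by rewrite mulrC v1 v2.
  split; apply: zero; first exact: sep.
  by rewrite -[y]opprK; apply: sep => //; rewrite enormN.
have j1 := integrable_loc_conv xi l0 id (meas_ctrans t1 h1) (fun x => ctrans_bounded t1 x h1).
have j2 := integrable_loc_conv xi l0 id (meas_ctrans t2 h2) (fun x => ctrans_bounded t2 x h2).
have := Rint_rVD j1 j2; rewrite (z _ _ h1 s1) (z _ _ h2 s2) addr0 => E.
apply: (etrans _ E); apply: eq_Rintegral => s _.
by rewrite -!mulrBl WE mulrDr.
Qed.

(** Peetre's inequality recentres both bumps at the origin, and the decay of the truncated symbol
    pays for it. The variables then separate: the bound is that of a rank-one operator, a function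
    of xi times a number depending on [W]. *)
Lemma off_diagonal_pointwise (M : nat) : exists C : R, 0 <= C /\
  forall lam lam' mu nu (W : V -> R) xi, 0 < lam <= mu -> 0 < lam' <= mu -> 0 < nu ->
  shells_apart lam lam' mu -> shell_localised lam' W ->
  ((`|loc_conv lam (annulus nu) W xi|)%:E <=
   (C * gain (mu * nu) * mu ^- n * bump_kernel M lam xi)%:E *
   eint (fun z => bump_kernel M lam' z * `|W z|)%R)%E.
Proof.
(* [M] brackets for recentring the kernel of the output cut-off, [M] for recentring the reproducing
   bump, and [n.+1] for integrating in eta. *)
pose P := (M + M + n.+1)%N.
have [C1 [C10 h1]] := @annulus_decay R n phi Hphi M.
have [C2 [C20 h2]] := truncated_symbol n_gt0 Hphi P.
have [C3 [C30 h3]] := shell_localised_reproducing n_gt0 Hphi M.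
exists (C1 * C2 * C3 * 2 ^+ M * 2 ^+ M * weight_int (n := n) 0).
have wi := weight_int_ge0 (n := n) (0 : R).
split; first by rewrite !mulr_ge0 ?exprn_ge0.
move=> lam lam' mu nu W xi lm lm' v0 sep lW.
have /andP[l0 lmu] := lm; have /andP[l0' lmu'] := lm'; have m0 := lt_le_trans l0 lmu.
have [b [ib eb hb bb]] := h2 mu nu m0 v0.
rewrite (loc_conv_truncate xi l0 m0 v0 sep ib eb hb lW).
have [MW WM] := shell_localised_bounded lW; have mW := shell_localised_meas lW.
have ii := integrable_loc_conv xi l0 ib mW WM.
apply: le_trans (normr_Rint_eint ii) _.
set E := eint (fun z => bump_kernel M lam' z * `|W z|)%R.
have E0 : (0 <= E)%E by apply: eint_ge0 => z; rewrite mulr_ge0 ?bump_kernel_ge0.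
have mE : meas_rV (fun z => bump_kernel M lam' z * `|W z|).
  by apply: meas_rVM; [exact: meas_bump_kernel|exact: meas_rV_norm].
have g0 := gain_ge0 (mulr_gt0 m0 v0).
have J0 (x : V) : 0 <= bracket (mu *: x) by exact/ltW/bracket_gt0.
have Wb eta : ((`|W eta|)%:E <= (C3 * (2 ^+ M * bracket (mu *: eta) ^+ M))%:E * E)%E.
  apply: le_trans (h3 lam' W eta l0' lW) _; rewrite EFinM -muleA lee_wpmul2l ?lee_fin//.
  rewrite -eintZ//; first last.
  - by move=> z; rewrite mulr_ge0 ?bump_kernel_ge0.
  - by rewrite mulr_ge0 ?exprn_ge0.
  apply: le_eint.
  - by apply: meas_rVM; [exact: (meas_rV_sub eta (meas_bump_kernel _ _))|exact: meas_rV_norm].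
  - exact: meas_rVZ.
  move=> z; rewrite mulr_ge0 ?bump_kernel_ge0//= mulrA ler_wpM2r//.
  by rewrite bump_kernelB; exact: bump_kernel_peetre.
pose D := C1 * C2 * C3 * 2 ^+ M * 2 ^+ M * gain (mu * nu) * bump_kernel M lam xi * mu ^- n.
have D0 : 0 <= D.
  rewrite /D; have mn0 : 0 <= mu ^- n by rewrite invr_ge0 exprn_ge0// ltW.
  have := bump_kernel_ge0 M xi l0; move: (bump_kernel M lam xi) => u u0.
  by rewrite !mulr_ge0 ?exprn_ge0.
pose w0 (x : V) := mu ^+ n * weight 0 n.+1 (mu *: (0 - x)).
have mw0 : meas_rV w0.
  apply: meas_rVZ; apply: (meas_rV_sub (f := fun x => weight 0 n.+1 (mu *: x))).
  exact: (meas_rV_scale mu (@meas_weight R n 0 n.+1)).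
have w00 x : 0 <= w0 x by rewrite mulr_ge0 ?weight_ge0// exprn_ge0// ltW.
have key eta : ((`|b eta * ctrans (annulus lam) 0 (xi - eta) * W eta|)%:E <=
    (D * w0 eta)%:E * E)%E.
  rewrite normrM EFinM.
  have c0 : 0 <= `|b eta * ctrans (annulus lam) 0 (xi - eta)| by [].
  apply: le_trans (lee_wpmul2l _ (Wb eta)) _; first by rewrite lee_fin.
  rewrite muleA -EFinM lee_wpmul2r// lee_fin normrM.
  have k1 := h1 lam 0 (xi - eta) l0; have k2 := bump_kernel_peetre M xi eta lm.
  have k3 : `|ctrans (annulus lam) 0 (xi - eta)| <=
      C1 * (2 ^+ M * bracket (mu *: eta) ^+ M * bump_kernel M lam xi).
    by apply: le_trans k1 _; rewrite ler_wpM2l.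
  apply: (@le_trans _ _ ((C2 * gain (mu * nu) * bracket (mu *: eta) ^- P) *
    (C1 * (2 ^+ M * bracket (mu *: eta) ^+ M * bump_kernel M lam xi)) *
    (C3 * (2 ^+ M * bracket (mu *: eta) ^+ M)))).
    rewrite ler_wpM2r ?mulr_ge0 ?exprn_ge0//; apply: ler_pM => //; exact: bb.
  rewrite /w0 /weight powRr0 mul1r sub0r scalerN bracketN.
  have bq : bracket (mu *: eta) != 0 by rewrite gt_eqF ?bracket_gt0.
  have mq : mu != 0 by rewrite gt_eqF.
  have -> : bracket (mu *: eta) ^- P = bracket (mu *: eta) ^- M * bracket (mu *: eta) ^- M *
      bracket (mu *: eta) ^- n.+1 by rewrite -!invfM -!exprD /P addnC addnA.
  have bM : bracket (mu *: eta) ^+ M != 0 by rewrite expf_neq0.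
  have mn : mu ^+ n != 0 by rewrite expf_neq0.
  rewrite /D le_eqVlt; apply/orP; left; apply/eqP.
  move: bM mn; move: (bracket _ ^+ M) (mu ^+ n) (bracket _ ^- n.+1) (2 ^+ M) (gain _) (bump_kernel _ _ _).
  by move=> a m p q g u a0 m0'; field; rewrite a0 m0'.
have -> : (C1 * C2 * C3 * 2 ^+ M * 2 ^+ M * weight_int (n := n) 0 * gain (mu * nu) *
   mu ^- n * bump_kernel M lam xi) = D * weight_int (n := n) 0 by rewrite /D; ring.
have nn0 : - n%:R < 0 :> R by rewrite oppr_lt0 ltr0n.
rewrite EFinM -(weight_intE n_gt0 nn0 (ler0n R 2)).
rewrite -(eint_dilate 0 m0 (meas_weight 0 n.+1) (weight_ge0 0 n.+1)) -(eintZ D0 mw0 w00).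
have mDw : measurable_fun [set: T] (fun t => (D * w0 (X t))%:E).
  by apply/measurable_EFinP; exact: (meas_rVZ D mw0).
have Dw0 t : [set: T] t -> (0 <= (D * w0 (X t))%:E)%E by rewrite lee_fin mulr_ge0.
rewrite /eint -(ge0_integralZr _ measurableT mDw Dw0 E0).
apply: ge0_le_integral => //.
- by have [mi _] := (integrable_rVP _).1 ii; apply/measurable_EFinP; exact: (meas_rV_norm mi).
- exact: emeasurable_funM.
Qed.

Lemma wnorm_bump_kernel (s lam : R) : `|s| <= 1 -> 2 * `|s| < n%:R -> 0 < lam ->
  (wnorm s (@bump_kernel R n n.+1 lam) <=
   (lam ^+ n * lam `^ (- (2 * s)) * weight_int (n := n) (2 * s))%:E)%E.
Proof.
move=> s1 sn l0; pose w (x : V) := lam ^+ n * weight (2 * s) n.+1 (lam *: (0 - x)).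
have mw : meas_rV w.
  apply: meas_rVZ; apply: (meas_rV_sub (f := fun x => weight (2 * s) n.+1 (lam *: x))).
  exact: (meas_rV_scale lam (@meas_weight R n _ n.+1)).
have w0 x : 0 <= w x by rewrite mulr_ge0 ?weight_ge0// exprn_ge0// ltW.
have l1 : 0 <= lam ^+ n * lam `^ (- (2 * s)) by rewrite mulr_ge0 ?powR_ge0// exprn_ge0// ltW.
have ns : - n%:R < 2 * s by have := ler_norm (- s); rewrite normrN; lra.
have s2 : 2 * s <= 2 by have := ler_norm s; lra.
rewrite EFinM -(weight_intE n_gt0 ns s2) -(eint_dilate 0 l0 (meas_weight _ n.+1) (weight_ge0 _ n.+1)).
rewrite -(eintZ l1 mw w0); apply: le_eint.
- exact: (meas_wnorm s (meas_bump_kernel n.+1 lam)).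
- exact: meas_rVZ.
move=> x; rewrite mulr_ge0 ?powR_ge0 ?sqr_ge0//= /w /weight /bump_kernel.
rewrite sub0r scalerN enormN bracketN enormZ (gtr0_norm l0).
have lx : enorm x `^ (2 * s) = lam `^ (- (2 * s)) * (lam * enorm x) `^ (2 * s).
  by rewrite powRM ?(ltW l0) ?enorm_ge0// mulrA powRN mulVf ?mul1r// gt_eqF ?powR_gt0.
rewrite lx; have b0 := bracket_gt0 (lam *: x).
have bb : (bracket (lam *: x) ^- n.+1) ^+ 2 <= bracket (lam *: x) ^- n.+1.
  rewrite expr2 ler_piMr ?invr_ge0 ?exprn_ge0 ?(ltW b0)// invf_le1 ?exprn_gt0//.
  by rewrite exprn_ege1// bracket_ge1.
rewrite exprMn.
have -> : lam `^ (- (2 * s)) * (lam * enorm x) `^ (2 * s) *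
    ((lam ^+ n) ^+ 2 * (bracket (lam *: x) ^- n.+1) ^+ 2) =
  lam ^+ n * lam `^ (- (2 * s)) * (lam ^+ n * (lam * enorm x) `^ (2 * s)) *
    (bracket (lam *: x) ^- n.+1) ^+ 2 by ring.
by rewrite -!mulrA !ler_wpM2l ?exprn_ge0 ?(ltW l0) ?powR_ge0.
Qed.

(* Cauchy-Schwarz against the dual weight; the origin, where [0 `^ _] is a junk
   value, is a null set. *)
Lemma eint_bump_kernel_le (s lam : R) (W : V -> R) : `|s| <= 1 -> 2 * `|s| < n%:R -> 0 < lam ->
  meas_rV W ->
  (eint (fun z => bump_kernel n.+1 lam z * `|W z|)%R *
   eint (fun z => bump_kernel n.+1 lam z * `|W z|)%R <=
   (lam ^+ n * lam `^ (2 * s) * weight_int (n := n) (- (2 * s)))%:E * wnorm s W)%E.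
Proof.
move=> s1 sn l0 mW; pose f (z : V) := enorm z `^ (- s) * bump_kernel n.+1 lam z.
pose g z := enorm z `^ s * W z.
have mf : meas_rV f by apply: meas_rVM; [exact: meas_enorm_powR|exact: meas_bump_kernel].
have mg : meas_rV g by apply: meas_rVM; first exact: meas_enorm_powR.
have b0 (z : V) : 0 <= bump_kernel n.+1 lam z by exact: bump_kernel_ge0.
set I := eint _.
have I0 : (0 <= I)%E by apply: eint_ge0 => z; rewrite mulr_ge0.
have If : (I <= eint (fun z => `|f z * g z|)%R)%E.
  apply: (ae_le_eint n_gt0).
  - by apply: meas_rVM; [exact: meas_bump_kernel|exact: meas_rV_norm].
  - by apply: meas_rV_norm; exact: meas_rVM.
  - by move=> z; rewrite mulr_ge0.
  - by [].
  move=> z z0; rewrite /f /g mulrACA powRN mulVf ?mul1r; last first.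
    by rewrite gt_eqF// powR_gt0// enorm_gt0.
  by rewrite normrM (ger0_norm (b0 z)).
apply: le_trans (lee_pmul I0 I0 If If) _.
apply: le_trans (cauchy_schwarz_eint mf mg) _.
have -> : eint (fun z => g z ^+ 2)%R = wnorm s W.
  by apply: eq_integral => t _; rewrite /g exprMn powR_sqr.
apply: lee_wpmul2r; first exact: wnorm_ge0.
have -> : eint (fun z => f z ^+ 2)%R = wnorm (- s) (@bump_kernel R n n.+1 lam).
  by apply: eq_integral => t _; rewrite /f exprMn powR_sqr.
have := @wnorm_bump_kernel (- s) lam; rewrite normrN mulrN opprK; exact.
Qed.

Lemma wnormZ (s c : R) (f : V -> R) : meas_rV f ->
  wnorm s (fun x => c * f x) = ((c ^+ 2)%:E * wnorm s f)%E.
Proof.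
move=> mf; rewrite -(eintZ (sqr_ge0 c) (meas_wnorm s mf)); last first.
  by move=> x; rewrite mulr_ge0 ?powR_ge0 ?sqr_ge0.
by apply: eq_integral => t _; rewrite exprMn mulrCA.
Qed.

(** The rank-one bound splits into the norm of a bump at scale [lam] and, for the number depending
    on [W], a Cauchy-Schwarz inequality against the dual weight. Scaling yields the powers of [lam]
    and [lam']; the square of [mu ^- n] is the size of the truncated kernel. *)
Lemma off_diagonal_bound (s : R) : `|s| <= 1 -> 2 * `|s| < n%:R -> exists C : R, 0 <= C /\
  forall lam lam' mu nu (W : V -> R), 0 < lam <= mu -> 0 < lam' <= mu -> 0 < nu ->
  shells_apart lam lam' mu -> shell_localised lam' W -> meas_rV (loc_conv lam (annulus nu) W) ->
  (wnorm s (loc_conv lam (annulus nu) W) <=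
   (C * gain (mu * nu) ^+ 2 * ((lam * lam' / mu ^+ 2) ^+ n * (lam' / lam) `^ (2 * s)))%:E *
   wnorm s W)%E.
Proof.
move=> s1 sn; have [C [C0 hC]] := off_diagonal_pointwise n.+1.
pose w1 := weight_int (n := n) (2 * s); pose w2 := weight_int (n := n) (- (2 * s)).
have w10 : 0 <= w1 by exact: weight_int_ge0.
have w20 : 0 <= w2 by exact: weight_int_ge0.
exists (C ^+ 2 * w1 * w2); split.
  exact: (mulr_ge0 (mulr_ge0 (sqr_ge0 C) w10) w20).
move=> lam lam' mu nu W lm lm' v0 sep lW mL.
have /andP[l0 lmu] := lm; have /andP[l0' lmu'] := lm'; have m0 := lt_le_trans l0 lmu.
have mW := shell_localised_meas lW.
pose a := C * gain (mu * nu) * mu ^- n.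
have a0 : 0 <= a.
  rewrite /a !mulr_ge0 ?gain_ge0 ?mulr_gt0//.
  by rewrite invr_ge0 exprn_ge0// ltW.
have bk0 (z : V) : 0 <= bump_kernel n.+1 lam z by exact: bump_kernel_ge0.
set I := eint (fun z => bump_kernel n.+1 lam' z * `|W z|)%R.
have I0 : (0 <= I)%E by apply: eint_ge0 => z; rewrite mulr_ge0 ?bump_kernel_ge0.
have II := eint_bump_kernel_le s1 sn l0' mW; rewrite -/I in II.
have mb := meas_wnorm s (@meas_bump_kernel R n n.+1 lam).
apply: (@le_trans _ _ ((a ^+ 2)%:E * wnorm s (@bump_kernel R n n.+1 lam) * (I * I))%E).
  have e0 (x : V) : 0 <= a ^+ 2 * (enorm x `^ (2 * s) * bump_kernel n.+1 lam x ^+ 2).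
    by apply: mulr_ge0; rewrite ?sqr_ge0//; apply: mulr_ge0; rewrite ?sqr_ge0 ?powR_ge0.
  rewrite -(eintZ (sqr_ge0 a) mb); last by move=> x; rewrite mulr_ge0 ?powR_ge0 ?sqr_ge0.
  have mab : measurable_fun [set: T]
      (fun t => (a ^+ 2 * (enorm (X t) `^ (2 * s) * bump_kernel n.+1 lam (X t) ^+ 2))%:E).
    by apply/measurable_EFinP; exact: (meas_rVZ _ mb).
  have e0E t : [set: T] t ->
      (0 <= (a ^+ 2 * (enorm (X t) `^ (2 * s) * bump_kernel n.+1 lam (X t) ^+ 2))%:E)%E.
    by rewrite lee_fin.
  have II0 : (0 <= I * I)%E by exact: mule_ge0.
  rewrite /eint -(ge0_integralZr _ measurableT mab e0E II0).
  apply: ge0_le_integral => //.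
  - by move=> t _; rewrite lee_fin mulr_ge0 ?powR_ge0 ?sqr_ge0.
  - by apply/measurable_EFinP; exact: meas_wnorm.
  - exact: emeasurable_funM.
  move=> t _; have h := hC lam lam' mu nu W (X t) lm lm' v0 sep lW.
  rewrite -/I -/a in h.
  have -> : a ^+ 2 * (enorm (X t) `^ (2 * s) * bump_kernel n.+1 lam (X t) ^+ 2) =
     enorm (X t) `^ (2 * s) * (a * bump_kernel n.+1 lam (X t)) ^+ 2 by ring.
  rewrite EFinM [in leRHS]EFinM -muleA; apply: lee_wpmul2l; first by rewrite lee_fin powR_ge0.
  rewrite -real_normK ?num_real// !expr2 !EFinM muleACA.
  by apply: lee_pmul; rewrite ?lee_fin// -?EFinM.
apply: (@le_trans _ _ ((a ^+ 2)%:E * (lam ^+ n * lam `^ (- (2 * s)) * w1)%:E *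
   ((lam' ^+ n * lam' `^ (2 * s) * w2)%:E * wnorm s W))%E).
  apply: lee_pmul; [|exact: mule_ge0| |exact: II].
    by rewrite mule_ge0 ?lee_fin ?sqr_ge0// wnorm_ge0.
  by apply: lee_wpmul2l; [rewrite lee_fin sqr_ge0|exact: wnorm_bump_kernel].
rewrite muleA -!EFinM; apply: lee_wpmul2r; first exact: wnorm_ge0.
rewrite lee_fin le_eqVlt; apply/orP; left; apply/eqP.
rewrite powRM ?invr_ge0 ?(ltW l0) ?(ltW l0')//.
have -> : lam^-1 `^ (2 * s) = lam `^ (- (2 * s)) by rewrite -powR_inv1 ?(ltW l0)// -powRrM mulN1r.
have e : (mu ^+ 2)^-1 ^+ n = (mu ^- n) ^+ 2 by rewrite !exprVn -!exprM mulnC.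
rewrite /a !exprMn e.
move: (lam `^ _) (lam' `^ _) (mu ^- n) (lam ^+ n) (lam' ^+ n) (gain _) => p q r u v g.
by ring.
Qed.

End off_diagonal_bound.

(** * Summation over the shells *)

Section geometric_sums.
Context {R : realType}.

(** Each value of |k - j| is taken by at most two integers k. *)
Lemma sum_expr_absz (r : R) (s : seq int) (j : int) : 0 <= r < 1 -> uniq s ->
  \sum_(k <- s) r ^+ `|k - j|%N <= 2 / (1 - r).
Proof.
move=> /andP[r0 r1] us; have r10 : 0 < 1 - r by rewrite subr_gt0.
pose N := (\max_(k <- s) `|k - j|%N).+1.
have geo : \sum_(0 <= i < N) r ^+ i <= (1 - r)^-1.
  rewrite -[leRHS]mul1r ler_pdivlMr// mulrC.
  rewrite (_ : (1 - r) * _ = 1 - r ^+ N); first by rewrite gerBl exprn_ge0.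
  by rewrite -[1 in RHS](expr1n _ N) subrXX; congr (_ * _);
    rewrite big_mkord; apply: eq_bigr => i _; rewrite expr1n mul1r.
apply: (@le_trans _ _ (\sum_(0 <= i < N) 2 * r ^+ i)); last first.
  by rewrite -big_distrr ler_wpM2l.
have -> : \sum_(k <- s) r ^+ `|k - j|%N =
    \sum_(k <- s) \sum_(0 <= i < N) (if `|k - j|%N == i then r ^+ i else 0).
  apply: eq_big_seq => k ks; have kN : `|k - j|%N \in index_iota 0 N.
    by rewrite mem_index_iota /N ltnS (big_rem k)//= leq_max leqnn.
  rewrite (bigD1_seq `|k - j|%N) ?iota_uniq//= eqxx big1 ?addr0// => i.
  by rewrite eq_sym => /negbTE ->.
rewrite exchange_big/=; apply: ler_sum => i _.
rewrite -big_mkcond/= big_const_seq iter_addr_0 -[leLHS]mulr_natl ler_wpM2r ?exprn_ge0//.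
rewrite ler_nat -size_filter.
apply: (@uniq_leq_size _ _ [:: j + i%:Z; j - i%:Z]); first exact: filter_uniq.
move=> k; rewrite mem_filter !inE => /andP[/eqP <- _].
by rewrite abszE; case: (lerP 0 (k - j)) => h; [rewrite ger0_norm|rewrite ltr0_norm] => //;
  apply/orP; [left|right]; lia.
Qed.

Lemma sum_powR_absz (e : R) (s : seq int) (j : int) : 0 < e -> uniq s ->
  \sum_(k <- s) 2 `^ (- (e * `|k - j|%N%:R)) <= 2 / (1 - 2 `^ (- e)).
Proof.
move=> e0 us; under eq_bigr do rewrite -mulNr powRrM powR_mulrn ?powR_ge0//.
apply: sum_expr_absz => //; rewrite powR_ge0/= powRN invf_lt1 ?powR_gt0//.
have h : (1 : R) `^ e < 2 `^ e by rewrite gt0_ltr_powR// ?nnegrE// ltr1n.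
by move: h; rewrite powR1.
Qed.

Lemma gain_exprz (t : int) : gain ((2 : R) ^ t) = (2^-1) ^+ `|t|%N.
Proof.
have one k : (1 : R) <= 2 ^+ k by rewrite exprn_ege1// ler1n.
rewrite /gain exprVn; case: t => k.
  apply/min_idPr; rewrite -exprnP (le_trans _ (one k))// invf_le1// (lt_le_trans ltr01)//.
rewrite NegzE abszN/= -exprnN invrK; apply/min_idPl.
by rewrite (le_trans _ (one _))// invf_le1// (lt_le_trans ltr01).
Qed.

Lemma sum_gain (ls : seq int) (m : int) : uniq ls ->
  \sum_(l <- ls) gain ((2 : R) ^ m * 2 ^ l) ^+ 2 <= 4.
Proof.
move=> us; have h : 0 <= (2^-1 : R) < 1 by rewrite invr_ge0 ler0n invf_lt1 ?ltr1n.
apply: (@le_trans _ _ (\sum_(l <- ls) (2^-1 : R) ^+ `|l - - m|%N)).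
  apply: ler_sum => l _; rewrite -expfzDr ?pnatr_eq0// gain_exprz opprK addrC.
  by rewrite expr2 ler_piMl ?exprn_ge0 ?invr_ge0// exprn_ile1 ?invr_ge0// invf_le1 ?ler1n.
apply: le_trans (sum_expr_absz _ h us) _.
by rewrite ler_pdivrMr; lra.
Qed.

End geometric_sums.

(** * Estimates of a single block *)

Section block_estimate.
Context {R : realType} {n : nat}.
Local Notation T := (n.-tuple (measurableTypeR R)).
Local Notation X := (@rV_of_tuple R n).
Local Notation V := 'rV[R]_n.
Local Notation lebn := (lebn R n).
Hypothesis n_gt0 : (0 < n)%N.
Variable phi : R -> R.
Hypothesis Hphi : dyadic_generator phi.
Local Notation annulus := (@annulus R n phi).
Local Notation loc_conv := (@loc_conv R n phi).
Let test_annulus lam : 0 < lam -> test_fun (annulus lam) := @test_fun_annulus R n phi Hphi lam.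

(** The formula for the cosine of a difference separates xi from the integration variable, so that
    [loc_conv] becomes a sum of cosine transforms of test functions. This gives its
    measurability. *)
Lemma loc_convE lam (b W : V -> R) : 0 < lam -> ccs b -> continuous W ->
  loc_conv lam b W = fun xi =>
   ctrans (fun y => annulus lam y * ctrans (fun x => b x * W x) 0 y) 0 xi +
   ctrans (fun y => annulus lam y * ctrans (fun x => b x * W x) (- (pi / 2)) y) (- (pi / 2)) xi.
Proof.
move=> l0 cb cW; apply/funext => xi; pose a x := b x * W x.
have ca : ccs a by have := ccsM cW cb; rewrite /a; under eq_fun do rewrite mulrC.
have ia := ccs_integrable ca; have tA := test_annulus l0; have iA := test_fun_integrable tA.
have tt th : test_fun (fun y => annulus lam y * ctrans a th y).
  by have := test_funMr (smooth_ctrans th ca) tA; under eq_fun do rewrite mulrC.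
have mk : measurable_fun [set: T * T] (fun st => cos (dot (X st.2) (xi - X st.1) + 0)).
  apply: measurable_cos_comp; apply: measurable_funD => //.
  under eq_fun do rewrite dotDr dotNr; apply: measurable_funB.
    have mx := continuous_meas_rV (@continuous_dot_addr R n xi 0).
    have := measurableT_comp mx (@measurable_snd _ _ T T).
    by rewrite /comp; under eq_fun do rewrite addr0.
  by under eq_fun do rewrite dotC; exact: measurable_dot2.
have sw := Rint_swap (k := fun x y => cos (dot y (xi - x) + 0)) ia iA mk
  (fun x y => norm_cos_le1 _).
apply: (etrans (y := \int[lebn]_t (a (X t) * ctrans (annulus lam) 0 (xi - X t)))).
  by apply: eq_Rintegral => t _; rewrite mulrAC.
apply: (etrans sw) => {sw}.
have i1 := integrable_cos xi 0 (test_fun_integrable (tt 0)).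
have i2 := integrable_cos xi (- (pi / 2)) (test_fun_integrable (tt (- (pi / 2)))).
rewrite /ctrans -(Rint_rVD i1 i2); apply: eq_Rintegral => y _.
rewrite -!mulrA -mulrDr; congr (_ * _).
have j1 := integrable_cos (X y) 0 ia; have j2 := integrable_cos (X y) (- (pi / 2)) ia.
pose p := cos (dot (X y) xi + 0); pose q := cos (dot (X y) xi + - (pi / 2)).
apply: (etrans (y := \int[lebn]_t (p * (a (X t) * cos (dot (X t) (X y) + 0)) +
    q * (a (X t) * cos (dot (X t) (X y) + - (pi / 2)))))); last first.
  rewrite (Rint_rVD (integrable_rVZ p j1) (integrable_rVZ q j2)).
  by rewrite (Rint_rVZ p j1) (Rint_rVZ q j2) [p * _]mulrC [q * _]mulrC.
apply: eq_Rintegral => t _; rewrite /p /q !addr0 dotDr dotNr (dotC (X t)).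
have cp (r : R) : cos (r - pi / 2) = sin r.
  by rewrite cosB cos_pihalf sin_pihalf mulr0 add0r mulr1.
by rewrite !cp cosB; ring.
Qed.

Lemma meas_loc_conv lam (b W : V -> R) : 0 < lam -> ccs b -> continuous W ->
  meas_rV (loc_conv lam b W).
Proof.
move=> l0 cb cW; rewrite loc_convE//.
have ca : ccs (fun x => b x * W x).
  by have := ccsM cW cb; under eq_fun do rewrite mulrC.
have tt th : test_fun (fun y => annulus lam y * ctrans (fun x => b x * W x) th y).
  by have := test_funMr (smooth_ctrans th ca) (test_annulus l0); under eq_fun do rewrite mulrC.
by apply: meas_rVD; apply: meas_ctrans.
Qed.

Lemma shell_localised_continuous lam (W : V -> R) : shell_localised lam W -> continuous W.
Proof.
move=> [w1 [w2 [t1 [t2 [[h1 h2] _ _ ->]]]]].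
have c1 := @continuous_ctrans _ _ _ t1 (test_fun_ccs h1).
have c2 := @continuous_ctrans _ _ _ t2 (test_fun_ccs h2).
by move=> x; exact: (cvgD (c1 x) (c2 x)).
Qed.

Lemma near_diagonal_bound (s : R) : `|s| <= 1 -> 2 * `|s| < n%:R -> exists C : R, 0 <= C /\
  forall lam (ls : seq int) (W : V -> R), 0 < lam -> uniq ls -> continuous W ->
  (\sum_(l <- ls) wnorm s (loc_conv lam (annulus (2 ^ l)) W) <= C%:E * wnorm s W)%E.
Proof.
move=> s1 sn; have [C1 [C10 h1]] := schur_bound n_gt0 s1 sn.
have [C2 [C20 h2]] := @annulus_decay R n phi Hphi n.+2.
exists (C1 * C2 ^+ 2); split; first by rewrite mulr_ge0 ?sqr_ge0.
move=> lam ls W l0 us cW; have mW := continuous_meas_rV cW.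
have p2 l : 0 < (2 : R) ^ l by rewrite exprz_gt0.
(* The symbol of P_l stays in the input of the Schur test, so that the squares can afterwards be
   summed over l pointwise. *)
pose z l (x : V) := C2 * (annulus (2 ^ l) x * `|W x|).
have mA l : meas_rV (annulus (2 ^ l)).
  exact: (continuous_meas_rV (test_fun_continuous (test_annulus (p2 l)))).
have mz l : meas_rV (z l).
  by apply: meas_rVZ; apply: meas_rVM; [exact: mA|exact: meas_rV_norm].
have A0 l x : 0 <= annulus (2 ^ l) x by exact: (annulus_ge0 Hphi).
have bnd l : (wnorm s (loc_conv lam (annulus (2 ^ l)) W) <= C1%:E * wnorm s (z l))%E.
  have cA := test_fun_ccs (test_annulus (p2 l)).
  have mL := meas_loc_conv l0 cA cW.
  apply: (h1 lam) => //; first by move=> x; rewrite !mulr_ge0.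
    by rewrite /z (annulus0 Hphi) mul0r mulr0.
  move=> xi; have ii : integrable_rV (fun x => annulus (2 ^ l) x * W x *
      ctrans (annulus lam) 0 (xi - x)).
    have ca : ccs (fun x => annulus (2 ^ l) x * W x).
      by have := ccsM cW cA; under eq_fun do rewrite mulrC.
    apply: (integrable_rV_bounded (ccs_integrable ca)
      (meas_rV_sub xi (meas_ctrans 0 (test_annulus l0)))) => x.
    by apply: ctrans_bounded; exact: test_annulus.
  have -> : loc_conv lam (annulus (2 ^ l)) W xi =
      \int[lebn]_t (annulus (2 ^ l) (X t) * W (X t) * ctrans (annulus lam) 0 (xi - X t)).
    by apply: eq_Rintegral => t _; rewrite mulrAC.
  apply: le_trans (normr_Rint_eint ii) _; apply: le_eint.
  - by have [mi _] := (integrable_rVP _).1 ii; exact: meas_rV_norm.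
  - by apply: meas_rVM => //; exact: (meas_rV_sub xi (meas_bump_kernel _ _)).
  move=> x; rewrite normr_ge0/= !normrM (ger0_norm (A0 l x)) /z.
  rewrite [X in _ <= X]mulrA [X in X <= _]mulrC; apply: ler_wpM2r; first by rewrite mulr_ge0.
  by rewrite [X in _ <= X]mulrC; exact: h2.
apply: (@le_trans _ _ (\sum_(l <- ls) (C1%:E * wnorm s (z l)))%E).
  by apply: lee_sum => l _; exact: bnd.
rewrite -ge0_sume_distrr; last by move=> l _; exact: wnorm_ge0.
rewrite EFinM -muleA; apply: lee_wpmul2l; first by rewrite lee_fin.
rewrite -(eintZ (sqr_ge0 C2) (meas_wnorm s mW)); last first.
  by move=> x; rewrite mulr_ge0 ?powR_ge0 ?sqr_ge0.
have nn l x : 0 <= enorm x `^ (2 * s) * z l x ^+ 2 by rewrite mulr_ge0 ?powR_ge0 ?sqr_ge0.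
rewrite /wnorm -(eint_sum ls (fun l => meas_wnorm s (mz l)) nn); apply: le_eint.
- rewrite /meas_rV /comp; apply: measurable_sum => l; exact: (meas_wnorm s (mz l)).
- exact: (meas_rVZ _ (meas_wnorm s mW)).
move=> x; rewrite sumr_ge0//= -mulr_sumr mulrCA ler_wpM2l ?powR_ge0//.
under eq_bigr do rewrite /z exprMn.
rewrite -mulr_sumr ler_wpM2l ?sqr_ge0//.
under eq_bigr do rewrite exprMn real_normK ?num_real//.
rewrite -mulr_suml ler_piMl ?sqr_ge0//.
apply: le_trans (generator_sum_le1 Hphi (enorm x) us); apply: ler_sum => l _.
by rewrite expr2 ler_piMl// ?A0// (annulus_le1 Hphi).
Qed.

Lemma expz_ratio (j k : int) : (2 : R) ^ j / 2 ^ k = 2 `^ ((j - k)%:~R).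
Proof. by rewrite powR_intmul// expfzDr ?pnatr_eq0// invr_expz. Qed.

Lemma expz_le8 (k j : int) : k + 3 <= j -> 8 * (2 : R) ^ k <= 2 ^ j.
Proof.
move=> kj; have -> : 8 * (2 : R) ^ k = 2 ^ (k + 3).
  by rewrite expfzDr ?pnatr_eq0// mulrC; congr (_ * _); rewrite -exprnP; ring.
by rewrite ler_eXz2l// ltr1n.
Qed.

(** With m = max(k, j) the quotient 2^k 2^j / 2^(2 m) is 2^(-|k - j|), and the ratio of the two
    scales to the power 2 s costs at most 2^(2 |s| |k - j|). *)
Lemma block_scale (k j m : int) (s : R) : m = k \/ m = j -> k <= m -> j <= m ->
  ((2 : R) ^ k * 2 ^ j / (2 ^ m) ^+ 2) ^+ n * (2 ^ j / 2 ^ k) `^ (2 * s) <=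
  2 `^ (- ((n%:R - 2 * `|s|) * `|k - j|%N%:R)).
Proof.
move=> mkj km jm; pose D : R := `|k - j|%N%:R.
have D0 : 0 <= D by [].
have p2 l : (2 : R) ^ l != 0 by rewrite gt_eqF// exprz_gt0.
have -> : (2 : R) ^ k * 2 ^ j / (2 ^ m) ^+ 2 = 2 `^ (- D).
  have -> : (2 : R) ^ k * 2 ^ j / (2 ^ m) ^+ 2 = (2 ^ k / 2 ^ m) * (2 ^ j / 2 ^ m).
    by field; exact: p2.
  rewrite !expz_ratio -powRD ?pnatr_eq0 ?implybT//; congr (_ `^ _).
  rewrite -intrD /D -[in RHS]mulrz_nat natz abszE -mulrNz; congr (_%:~R).
  by case: mkj => mE; rewrite mE; [rewrite ger0_norm|rewrite ler0_norm]; lia.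
rewrite expz_ratio -powR_mulrn ?powR_ge0// -!powRrM -powRD ?pnatr_eq0 ?implybT//.
apply: ler_powR; first by rewrite ler1n.
have jk : `|(j - k)%:~R * s| <= D * `|s| :> R.
  rewrite normrM ler_wpM2r// /D -[leRHS]mulrz_nat natz abszE -intr_norm distrC//.
have := ler_norm ((j - k)%:~R * s); move: jk => /[swap] h1 h2.
have h3 := le_trans h1 h2.
by have -> : (j - k)%:~R * (2 * s) = 2 * ((j - k)%:~R * s) :> R; [ring|rewrite -/D; lra].
Qed.

(** The threshold 3 is what gives the lower bound: the larger shell starts at 2^m / 2, the smaller
    one ends at 2 * 2^(m - 3), and the difference is 2^m / 4, the edge of the region where the
    cut-off is 1. *)
Lemma block_separated (k j m : int) : (3 <= `|k - j|)%N -> m = k \/ m = j -> k <= m -> j <= m ->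
  @shells_apart R n (2 ^ k) (2 ^ j) (2 ^ m).
Proof.
move=> kj mkj km jm x y /andP[x1 x2] /andP[y1 y2].
have h1 := enorm_sub_ge x y; have h2 := enorm_sub_ge y x; have h3 := enorm_subr_le x y.
rewrite (enormB y) in h2.
case: mkj => mE; rewrite mE.
  have e8 : 8 * (2 : R) ^ j <= 2 ^ k by apply: expz_le8; lia.
  by apply/andP; split; lra.
have e8 : 8 * (2 : R) ^ k <= 2 ^ j by apply: expz_le8; lia.
by apply/andP; split; lra.
Qed.

Lemma block_bound (s : R) : `|s| <= 1 -> 2 * `|s| < n%:R -> exists C : R, 0 <= C /\
  forall (k j : int) (ls : seq int) (W : V -> R), uniq ls -> shell_localised (2 ^ j) W ->
  (\sum_(l <- ls) wnorm s (loc_conv (2 ^ k) (annulus (2 ^ l)) W) <=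
   (C * 2 `^ (- ((n%:R - 2 * `|s|) * `|k - j|%N%:R)))%:E * wnorm s W)%E.
Proof.
move=> s1 sn; have [C1 [C10 h1]] := near_diagonal_bound s1 sn.
have [C2 [C20 h2]] := off_diagonal_bound n_gt0 Hphi s1 sn.
pose d := n%:R - 2 * `|s|; have d0 : 0 < d by rewrite subr_gt0.
(* For |k - j| <= 2 the factor 2^(2 d) compensates the decay demanded on the right; the 4 is the
   bound of [sum_gain] for the sum over l. *)
exists (C1 * 2 `^ (d * 2) + C2 * 4); split.
  by rewrite addr_ge0 ?mulr_ge0 ?powR_ge0.
move=> k j ls W us lW; rewrite -/d; set D : R := `|k - j|%N%:R.
have p2 l : 0 < (2 : R) ^ l by rewrite exprz_gt0.
have cW := shell_localised_continuous lW.
have wW := wnorm_ge0 s W.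
have pd := powR_ge0 2 (- (d * D)).
have [kj|kj] := leqP `|k - j|%N 2.
  apply: le_trans (h1 (2 ^ k) ls W (p2 k) us cW) _; apply: lee_wpmul2r => //.
  rewrite lee_fin mulrDl; apply: ler_wpDr; first by rewrite !mulr_ge0.
  rewrite -mulrA -powRD ?pnatr_eq0 ?implybT// ler_peMr//.
  rewrite -[leLHS](powRr0 2) ler_powR ?ler1n// -mulrBr mulr_ge0 ?(ltW d0)//.
  by rewrite subr_ge0 /D ler_nat.
pose m := if k <= j then j else k.
have [mkj km jm] : [/\ m = k \/ m = j, k <= m & j <= m].
  by rewrite /m; case: (leP k j) => h; split; rewrite ?lexx ?(ltW h)//; [right|left].
have sep := block_separated kj mkj km jm.
have le2 (a b : int) : a <= b -> (2 : R) ^ a <= 2 ^ b by move=> ab; rewrite ler_eXz2l// ltr1n.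
have lm : 0 < (2 : R) ^ k <= 2 ^ m by rewrite p2 le2.
have lm' : 0 < (2 : R) ^ j <= 2 ^ m by rewrite p2 le2.
have sc := block_scale s mkj km jm; rewrite -/d -/D in sc.
apply: (@le_trans _ _ (\sum_(l <- ls)
   ((C2 * gain ((2 : R) ^ m * 2 ^ l) ^+ 2 * 2 `^ (- (d * D)))%:E * wnorm s W))%E).
  apply: lee_sum => l _.
  have mL := meas_loc_conv (p2 k) (test_fun_ccs (test_annulus (p2 l))) cW.
  apply: le_trans (h2 _ _ _ _ _ lm lm' (p2 l) sep lW mL) _.
  by apply: lee_wpmul2r => //; rewrite lee_fin ler_wpM2l// mulr_ge0 ?sqr_ge0.
rewrite -ge0_sume_distrl; last first.
  by move=> l _; rewrite lee_fin (mulr_ge0 (mulr_ge0 C20 (sqr_ge0 _)) pd).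
apply: lee_wpmul2r => //; rewrite sumEFin lee_fin -mulr_suml -mulr_sumr ler_wpM2r//.
apply: ler_wpDl; first by rewrite mulr_ge0 ?powR_ge0.
by rewrite ler_wpM2l// sum_gain.
Qed.

End block_estimate.

(** * Discrete inequalities of Young and Minkowski type *)

Section discrete_norms.
Context {R : realType}.

(** One inequality suffices: applied to the inverse of [c] it gives the converse. *)
Lemma esumZl (I : choiceType) (c : R) (f : I -> \bar R) : 0 <= c -> (forall i, 0 <= f i)%E ->
  \esum_(i in [set: I]) (c%:E * f i)%E = (c%:E * \esum_(i in [set: I]) f i)%E.
Proof.
move=> c0 f0; have le (b : R) (g : I -> \bar R) : 0 <= b -> (forall i, 0 <= g i)%E ->
    (\esum_(i in [set: I]) (b%:E * g i) <= b%:E * \esum_(i in [set: I]) g i)%E.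
  move=> b0 g0; apply: esum_le_sum => s us; rewrite -ge0_sume_distrr//.
  by apply: lee_wpmul2l; [rewrite lee_fin|exact: sum_le_esum].
apply/eqP; rewrite eq_le le//=.
have [->|c1] := eqVneq c 0; first by rewrite mul0e esum_ge0// => i _; rewrite mul0e.
have cp : 0 < c by rewrite lt_neqAle eq_sym c1.
have ci : 0 <= c^-1 by rewrite invr_ge0.
have cf0 i : (0 <= c%:E * f i)%E by rewrite mule_ge0.
have := le _ _ ci cf0.
rewrite (eq_esum (b := f)); last by move=> i _; rewrite muleA -EFinM mulVf// mul1e.
by move=> h; rewrite muleC -lee_pdivlMr// muleC.
Qed.

Lemma exchange_esum (I J : choiceType) (f : I -> J -> \bar R) : (forall i j, 0 <= f i j)%E ->
  \esum_(i in [set: I]) \esum_(j in [set: J]) f i j =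
  \esum_(j in [set: J]) \esum_(i in [set: I]) f i j.
Proof.
move=> f0; apply/eqP; rewrite eq_le; apply/andP; split; apply: esum_le_sum => s us.
  rewrite -(esum_sum s (P := xpredT) (I := [set: J]) (a := fun j i => f i j))//.
  by apply: le_esum => j _; exact: sum_le_esum.
rewrite -(esum_sum s (P := xpredT) (I := [set: I]) (a := fun i j => f i j))//.
by apply: le_esum => i _; exact: sum_le_esum.
Qed.

(** Young's inequality with second factor 1. It provides the tangent of t^p at t = 1 for
    [minkowski_esum]. *)
Lemma bernoulli_powR (p t : R) : 1 <= p -> 0 <= t -> p * t <= t `^ p + (p - 1).
Proof.
move=> p1 t0; have [->|pn] := eqVneq p 1; first by rewrite mul1r powRr1// subrr addr0.
have pg : 1 < p by rewrite lt_neqAle eq_sym pn.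
have pp : 0 < p by lra.
have q0 : 0 < p / (p - 1) by rewrite divr_gt0//; lra.
have pn0 : p != 0 by rewrite gt_eqF.
have pm : p - 1 != 0 by rewrite gt_eqF//; lra.
have pq : p^-1 + (p / (p - 1))^-1 = 1 by rewrite invf_div; field.
have := conjugate_powR t0 (ler01 : 0 <= (1 : R)) pp q0 pq.
rewrite mulr1 powR1 mul1r invf_div => h.
have -> : t `^ p + (p - 1) = p * (t `^ p / p + (p - 1) / p) by field.
by rewrite ler_wpM2l// ltW.
Qed.

Lemma powR_le_cancel (p x y : R) : 0 < p -> 0 <= x -> 0 <= y -> x `^ p <= y `^ p -> x <= y.
Proof.
move=> p0 x0 y0; apply: contraTT; rewrite -!ltNge => yx.
by rewrite gt0_ltr_powR// nnegrE.
Qed.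

(* The dual weights [c k] replace the norms [(\sum_l x k l ^ p) ^ (1 / p)] in
   Jensen's inequality, which is summed from its tangent lines. *)
Lemma minkowski_esum (I L : choiceType) (p S : R) (x : I -> L -> R) (c : I -> R)
    (ls : seq L) : 1 <= p -> (forall k l, 0 <= x k l) -> (forall k, 0 <= c k) ->
  \esum_(k in [set: I]) (c k)%:E = S%:E ->
  (forall k, \sum_(l <- ls) x k l `^ p <= c k `^ p) ->
  (\sum_(l <- ls) (\esum_(k in [set: I]) (x k l)%:E) `^ p <= (S `^ p)%:E)%E.
Proof.
move=> p1 x0 c0 cS xc; have p0 : 0 < p by rewrite (lt_le_trans ltr01).
have pn : p != 0 by rewrite gt_eqF.
have S0 : 0 <= S by rewrite -lee_fin -cS esum_ge0// => k _; rewrite lee_fin.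
have xlc k l : l \in ls -> x k l <= c k.
  move=> ll; apply: (powR_le_cancel p0) => //; apply: le_trans (xc k).
  by rewrite (big_rem l)//= lerDl sumr_ge0// => i _; exact: powR_ge0.
pose E l := \esum_(k in [set: I]) (c k * (x k l / c k) `^ p)%:E.
have y0 k l : 0 <= c k * (x k l / c k) `^ p by rewrite mulr_ge0 ?powR_ge0.
have E0 l : (0 <= E l)%E by apply: esum_ge0 => k _; rewrite lee_fin.
have SS : 0 <= S `^ p / S by rewrite divr_ge0 ?powR_ge0.
have tangent l : l \in ls ->
    ((\esum_(k in [set: I]) (x k l)%:E) `^ p <= (S `^ p / S)%:E * E l)%E.
  move=> ll; have XS : (\esum_(k in [set: I]) (x k l)%:E <= S%:E)%E.
    by rewrite -cS; apply: le_esum => k _; rewrite lee_fin xlc.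
  have X0 : (0 <= \esum_(k in [set: I]) (x k l)%:E)%E.
    by apply: esum_ge0 => k _; rewrite lee_fin.
  have : exists2 r : R, 0 <= r <= S & \esum_(k in [set: I]) (x k l)%:E = r%:E.
    move: X0 XS; case: (esum _ _) => // r; rewrite !lee_fin => r0 rS.
    by exists r => //; rewrite r0.
  move=> [r /andP[r0 rS] xr]; rewrite xr poweR_EFin.
  have [rz|rn] := eqVneq r 0; first by rewrite rz powR0// mule_ge0.
  have rp : 0 < r by rewrite lt_neqAle eq_sym rn.
  have Sp : 0 < S by exact: lt_le_trans rS.
  (* Bernoulli's inequality at t = (S / r) (x k l / c k), multiplied by [c k]. The factor S / r
     normalises the mean of t with respect to the weights [c k] to 1, the point of tangency. *)
  have pw k : p * (S / r) * x k l <=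
      (S / r) `^ p * (c k * (x k l / c k) `^ p) + (p - 1) * c k.
    have [cz|cn] := eqVneq (c k) 0.
      have -> : x k l = 0 by apply/eqP; rewrite eq_le x0 andbT -cz xlc.
      by rewrite cz !mulr0 mul0r mulr0 addr0.
    have t0 : 0 <= (S / r) * (x k l / c k) by rewrite mulr_ge0// divr_ge0.
    have := ler_wpM2l (c0 k) (bernoulli_powR p1 t0).
    rewrite powRM ?divr_ge0//; have -> : c k * (p * (S / r * (x k l / c k))) = p * (S / r) * x k l.
      by field; rewrite rn cn.
    by rewrite mulrDr [c k * (_ `^ p * _)]mulrCA [c k * (p - 1)]mulrC.
  have : (\esum_(k in [set: I]) ((p * (S / r))%:E * (x k l)%:E) <=
     \esum_(k in [set: I]) (((S / r) `^ p)%:E * (c k * (x k l / c k) `^ p)%:E +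
       (p - 1)%:E * (c k)%:E))%E.
    by apply: le_esum => k _; rewrite -!EFinM -EFinD lee_fin pw.
  have p10 : 0 <= p - 1 by rewrite subr_ge0.
  rewrite esumD; first last.
  - by move=> k _; rewrite -EFinM lee_fin mulr_ge0.
  - by move=> k _; rewrite -EFinM lee_fin mulr_ge0 ?powR_ge0.
  have pS0 : 0 <= p * (S / r) by rewrite mulr_ge0 ?(ltW p0)// divr_ge0.
  have x0E k : (0 <= (x k l)%:E)%E by rewrite lee_fin.
  have y0E k : (0 <= (c k * (x k l / c k) `^ p)%:E)%E by rewrite lee_fin.
  have c0E k : (0 <= (c k)%:E)%E by rewrite lee_fin.
  rewrite (esumZl pS0 x0E) (esumZl (powR_ge0 (S / r) p) y0E) (esumZl p10 c0E) xr cS -/(E l).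
  have := E0 l; case: (E l) => [e| |]//; last first.
    by move=> _ _; rewrite gt0_muley ?leey// lte_fin divr_gt0 ?powR_gt0.
  rewrite lee_fin => e0; rewrite -!EFinM -EFinD !lee_fin => h.
  have {}h : S <= (S / r) `^ p * e.
    by have e1 : p * (S / r) * r = p * S; [field|lra].
  have rp0 : 0 < r `^ p by rewrite powR_gt0.
  rewrite mulrAC ler_pdivlMr//.
  have -> : S `^ p * e = r `^ p * ((S / r) `^ p * e).
    rewrite powRM ?invr_ge0// -(powR_inv1 r0) -powRrM mulN1r powRN.
    by field; rewrite gt_eqF.
  by rewrite ler_wpM2l// ltW.
apply: (@le_trans _ _ (\sum_(l <- ls) (S `^ p / S)%:E * E l)%E).
  by rewrite big_seq [leRHS]big_seq; apply: lee_sum => l ll; exact: tangent.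
rewrite -ge0_sume_distrr//.
have -> : (\sum_(l <- ls) E l =
    \esum_(k in [set: I]) \sum_(l <- ls) (c k * (x k l / c k) `^ p)%:E)%E.
  by rewrite (esum_sum ls (P := xpredT))// => k l _ _; rewrite lee_fin.
apply: (@le_trans _ _ ((S `^ p / S)%:E * S%:E)%E).
  apply: lee_wpmul2l; first by rewrite lee_fin.
  rewrite -cS; apply: le_esum => k _; rewrite sumEFin lee_fin.
  have [cz|cn] := eqVneq (c k) 0; first by rewrite big1 ?cz// => l _; rewrite mul0r.
  have cp : 0 < c k by rewrite lt_neqAle eq_sym cn c0.
  rewrite -mulr_sumr -[leRHS]mulr1 ler_wpM2l//.
  under eq_bigr do rewrite powRM ?invr_ge0// -(powR_inv1 (c0 k)) -powRrM mulN1r powRN.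
  by rewrite -mulr_suml ler_pdivrMr ?powR_gt0// mul1r.
rewrite -EFinM lee_fin; have [->|Sn] := eqVneq S 0; first by rewrite mulr0 powR_ge0.
by rewrite divfK.
Qed.

(** The embedding of l^th in l^1: every y^th is at most [Y], so that y <= y^th Y^(1/th - 1), which
    can be summed. *)
Lemma esum_powR_subadditive (I : choiceType) (th Y : R) (y : I -> R) : 0 < th <= 1 ->
  (forall i, 0 <= y i) -> \esum_(i in [set: I]) (y i `^ th)%:E = Y%:E ->
  (\esum_(i in [set: I]) (y i)%:E <= (Y `^ th^-1)%:E)%E.
Proof.
move=> /andP[t0 t1] y0 hY; have tn : th != 0 by rewrite gt_eqF.
have Y0 : 0 <= Y by rewrite -lee_fin -hY esum_ge0// => k _; rewrite lee_fin powR_ge0.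
have yY i : y i `^ th <= Y.
  rewrite -lee_fin -hY; have := @sum_le_esum R I (fun i => (y i `^ th)%:E) [:: i].
  by rewrite big_seq1; apply => // k; rewrite lee_fin powR_ge0.
have i1 : 0 <= th^-1 - 1 by rewrite subr_ge0 -[leLHS]invr1 lef_pV2 ?posrE.
have Yth : Y * Y `^ (th^-1 - 1) = Y `^ th^-1.
  by apply: mulr_powRB1 => //; rewrite invr_gt0.
rewrite -Yth EFinM muleC -hY -esumZl ?powR_ge0//; last by move=> i; rewrite lee_fin powR_ge0.
apply: le_esum => i _; rewrite -EFinM lee_fin.
have {1}-> : y i = y i `^ th * (y i `^ th) `^ (th^-1 - 1).
  rewrite mulr_powRB1 ?powR_ge0 ?invr_gt0//.
  by rewrite -powRrM mulfV// powRr1.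
by rewrite mulrC ler_wpM2r ?powR_ge0// ge0_ler_powR ?nnegrE ?powR_ge0.
Qed.

Lemma le_poweR (r : R) (x y : \bar R) : 0 <= r -> (0 <= x)%E -> (x <= y)%E ->
  (x `^ r <= y `^ r)%E.
Proof.
by move=> r0 x0 xy; apply: gt0_ler_poweR; rewrite // in_itv/= ?leey ?andbT// (le_trans x0).
Qed.

(** Put th = q / 2 <= 1. The embedding of l^th in l^1 turns the sum of w B^2 over j into a power of
    a sum of w^th B^q. Moving the weight 2^(k q a) from k to j leaves the decay 2^(-e |k - j|) with
    e = q (d / 2 - |a|) > 0, which is summable in k. Minkowski's inequality with exponent 1 / th
    then exchanges the sums over k and l. Finiteness of the right-hand side makes all the entries
    real numbers. *)
Lemma discrete_bound (q a d C : R) : 1 <= q <= 2 -> 2 * `|a| < d -> 0 <= C ->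
  exists D : R, 0 <= D /\ forall (A : int -> int -> \bar R) (B : int -> \bar R),
    (forall k l, 0 <= A k l)%E -> (forall j, 0 <= B j)%E ->
    (forall k ls, uniq ls -> \sum_(l <- ls) A k l `^ 2 <=
       C%:E * \esum_(j in [set: int]) ((2 `^ (- (d * `|k - j|%N%:R)))%:E * B j `^ 2))%E ->
    (\esum_(j in [set: int]) ((2 `^ (j%:~R * q * a))%:E * B j `^ q) < +oo)%E ->
    ((\esum_(l in [set: int]) ((\esum_(k in [set: int])
        ((2 `^ (k%:~R * q * a))%:E * A k l `^ q)) `^ q^-1) `^ 2) `^ 2^-1 <=
     D%:E * (\esum_(j in [set: int]) ((2 `^ (j%:~R * q * a))%:E * B j `^ q)) `^ q^-1)%E.
Proof.
move=> /andP[q1 q2] ad C0; have q0 : 0 < q by lra.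
have qn : q != 0 by rewrite gt_eqF.
pose e := q * (d / 2 - `|a|); have e0 : 0 < e by rewrite mulr_gt0//; lra.
pose K := 2 / (1 - 2 `^ (- e)).
have K0 : 0 <= K by have := sum_powR_absz 0 e0 (isT : uniq [::]); rewrite big_nil.
pose th := q / 2; have th1 : 0 < th <= 1 by rewrite /th; lra.
have [th0 _] := andP th1; have thn : th != 0 by rewrite gt_eqF.
have thi : th^-1 = q^-1 * 2 by rewrite /th invf_div mulrC.
exists ((C `^ th * K) `^ q^-1); split; first exact: powR_ge0.
move=> A B A0 B0 hAB; set Y := \esum_(j in _) _ => Yoo.
have YB0 j : (0 <= (2 `^ (j%:~R * q * a))%:E * B j `^ q)%E.
  by rewrite mule_ge0 ?poweR_ge0// lee_fin powR_ge0.
have Y0 : (0 <= Y)%E by exact: esum_ge0.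
have Bfin j : B j \is a fin_num.
  rewrite ge0_fin_numE//; apply: (@lty_poweRy _ _ q qn).
  have : ((2 `^ (j%:~R * q * a))%:E * B j `^ q < +oo)%E.
    apply: le_lt_trans Yoo; have := @sum_le_esum R _ _ [:: j] YB0 isT.
    by rewrite big_seq1.
  have := poweR_ge0 (B j) q; case: (B j `^ q)%E => [r _ _|_|]; [by rewrite ltry| |by []].
  by rewrite gt0_muley// lte_fin powR_gt0.
pose b j := fine (B j); have bE j : B j = (b j)%:E by rewrite fineK.
have b0 j : 0 <= b j by rewrite -lee_fin -bE.
pose w (k j : int) : R := 2 `^ (- (d * `|k - j|%N%:R)).
have w0 k j : 0 <= w k j by exact: powR_ge0.
pose Z k := \esum_(j in [set: int]) ((w k j * b j ^+ 2) `^ th)%:E.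
have Z0 k : (0 <= Z k)%E by apply: esum_ge0 => j _; rewrite lee_fin powR_ge0.
pose g (k : int) : R := 2 `^ (k%:~R * q * a).
have g0 k : 0 <= g k by exact: powR_ge0.
have gw k j : g k * (w k j * b j ^+ 2) `^ th <=
    2 `^ (- (e * `|k - j|%N%:R)) * (g j * b j `^ q).
  rewrite powRM ?sqr_ge0// -(powR_mulrn 2 (b0 j)) -[(b j `^ _) `^ _]powRrM.
  have -> : 2%:R * th = q by rewrite /th mulrC divfK.
  rewrite !mulrA ler_wpM2r ?powR_ge0// /g /w -powRrM -!powRD ?pnatr_eq0 ?implybT//.
  apply: ler_powR; first by rewrite ler1n.
  have jk : (k - j)%:~R * a <= `|k - j|%N%:R * `|a| :> R.
    apply: le_trans (ler_norm _) _; rewrite normrM ler_wpM2r//.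
    by rewrite -[leRHS]mulrz_nat natz abszE -intr_norm.
  have := ler_wpM2l (ltW q0) jk; rewrite intrB /e /th => h.
  move: h; move: (k%:~R : R) (j%:~R : R) (`|k - j|%N%:R : R) `|a| => x y D a' h; lra.
have gZ : (\esum_(k in [set: int]) ((g k)%:E * Z k) <= K%:E * Y)%E.
  apply: (@le_trans _ _ (\esum_(k in [set: int]) \esum_(j in [set: int])
      (2 `^ (- (e * `|k - j|%N%:R)) * (g j * b j `^ q))%:E)%E).
    apply: le_esum => k _; rewrite /Z -esumZl//; last by move=> j; rewrite lee_fin powR_ge0.
    by apply: le_esum => j _; rewrite -EFinM lee_fin.
  rewrite exchange_esum; last by move=> k j; rewrite lee_fin !mulr_ge0 ?powR_ge0.
  rewrite -esumZl//; apply: le_esum => j _; rewrite bE poweR_EFin -EFinM.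
  apply: esum_le_sum => s us; rewrite sumEFin lee_fin -mulr_suml.
  by rewrite ler_wpM2r ?mulr_ge0 ?powR_ge0// sum_powR_absz.
have KYoo : (K%:E * Y < +oo)%E by rewrite lte_mul_pinfty// lee_fin.
have gZ0 k : (0 <= (g k)%:E * Z k)%E by rewrite mule_ge0// lee_fin.
have Zfin k : Z k \is a fin_num.
  have : ((g k)%:E * Z k < +oo)%E.
    apply: le_lt_trans (le_lt_trans gZ KYoo).
    by have := @sum_le_esum R _ _ [:: k] gZ0 isT; rewrite big_seq1.
  have := Z0 k; case: (Z k) => [r| |]//.
  by rewrite gt0_muley// lte_fin powR_gt0.
pose z k := fine (Z k); have zE k : Z k = (z k)%:E by rewrite fineK.
have z0 k : 0 <= z k by rewrite -lee_fin -zE.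
have V k : (\esum_(j in [set: int]) (w k j * b j ^+ 2)%:E <= (z k `^ th^-1)%:E)%E.
  by apply: (esum_powR_subadditive th1) => [j|]; [rewrite mulr_ge0 ?sqr_ge0|rewrite -zE].
have AV k ls : uniq ls -> (\sum_(l <- ls) A k l `^ 2 <= (C * z k `^ th^-1)%:E)%E.
  move=> us; apply: le_trans (hAB k ls us) _; rewrite EFinM; apply: lee_wpmul2l => //.
  apply: le_trans (V k); apply: le_esum => j _.
  by rewrite bE poweR_EFin -EFinM lee_fin powR_mulrn.
have Afin k l : A k l \is a fin_num.
  rewrite ge0_fin_numE//; apply: (@lty_poweRy _ _ 2); first by rewrite pnatr_eq0.
  by have := AV k [:: l] isT; rewrite big_seq1 => h; apply: le_lt_trans h _; rewrite ltry.
pose al k l := fine (A k l); have aE k l : A k l = (al k l)%:E by rewrite fineK.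
have al0 k l : 0 <= al k l by rewrite -lee_fin -aE.
pose c k := C `^ th * (g k * z k).
have c0 k : 0 <= c k by rewrite !mulr_ge0 ?powR_ge0.
have cs : (\esum_(k in [set: int]) (c k)%:E <= (C `^ th * K)%:E * Y)%E.
  rewrite EFinM -muleA; apply: le_trans (lee_wpmul2l _ gZ); last by rewrite lee_fin powR_ge0.
  rewrite -esumZl ?powR_ge0//; apply: le_esum => k _.
  by rewrite zE -!EFinM.
have CK0 : 0 <= C `^ th * K by rewrite mulr_ge0 ?powR_ge0.
have cfin : \esum_(k in [set: int]) (c k)%:E \is a fin_num.
  rewrite ge0_fin_numE; last by apply: esum_ge0 => k _; rewrite lee_fin.
  by apply: le_lt_trans cs _; rewrite lte_mul_pinfty// lee_fin.
pose S := fine (\esum_(k in [set: int]) (c k)%:E).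
have cS : \esum_(k in [set: int]) (c k)%:E = S%:E by rewrite fineK.
have S0 : 0 <= S by rewrite -lee_fin -cS esum_ge0// => k _; rewrite lee_fin.
pose x k l := g k * al k l `^ q.
have x0 k l : 0 <= x k l by rewrite mulr_ge0 ?powR_ge0.
have p1 : 1 <= th^-1 by rewrite -[leLHS]invr1 lef_pV2 ?posrE//; case/andP: th1.
have main ls : uniq ls ->
    (\sum_(l <- ls) (\esum_(k in [set: int]) (x k l)%:E) `^ th^-1 <= (S `^ th^-1)%:E)%E.
  move=> us; apply: (minkowski_esum p1 x0 c0 cS) => k.
  have := AV k ls us; under eq_bigr do rewrite aE poweR_EFin.
  rewrite sumEFin lee_fin => h.
  rewrite /x /c; under eq_bigr do rewrite powRM ?powR_ge0// -[(_ `^ q) `^ _]powRrM.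
  have -> : q * th^-1 = 2 by rewrite thi mulrA mulfV// mul1r.
  rewrite -mulr_sumr powRM ?mulr_ge0 ?powR_ge0// -powRrM mulfV// powRr1//.
  by rewrite powRM// mulrCA ler_wpM2l ?powR_ge0.
apply: (@le_trans _ _ (((S `^ th^-1)%:E) `^ 2^-1)%E).
  apply: le_poweR; first by rewrite invr_ge0.
    by apply: esum_ge0 => l _; exact: poweR_ge0.
  apply: esum_le_sum => ls us; apply: le_trans (main ls us).
  apply: lee_sum => l _; rewrite -poweRrM thi; apply: le_poweR.
  - by rewrite mulr_ge0 ?invr_ge0 ?(ltW q0).
  - by apply: esum_ge0 => k _; rewrite mule_ge0 ?poweR_ge0// lee_fin.
  by apply: le_esum => k _; rewrite aE poweR_EFin -EFinM.
rewrite poweR_EFin -powRrM thi mulfK ?pnatr_eq0// -poweR_EFin.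
have -> : (((C `^ th * K) `^ q^-1)%:E = (C `^ th * K)%:E `^ q^-1)%E by [].
rewrite -poweRM ?lee_fin//; apply: le_poweR; rewrite ?invr_ge0 ?(ltW q0)//.
by rewrite -cS.
Qed.

End discrete_norms.

(** * From operators to kernels *)

Section fourier_formulas.
Context {R : realType} {n : nat}.
Local Notation T := (n.-tuple (measurableTypeR R)).
Local Notation X := (@rV_of_tuple R n).
Local Notation V := 'rV[R]_n.
Local Notation lebn := (lebn R n).
Local Notation Re := (@complex.Re R).
Local Notation Im := (@complex.Im R).
Local Notation cabs := (@ComplexField.Normc.normc R).
Local Notation cst := (@fourier_cst R n).
Hypothesis n_gt0 : (0 < n)%N.
Variable phi : R -> R.
Hypothesis Hphi : dyadic_generator phi.
Local Notation annulus := (@annulus R n phi).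
Local Notation loc_conv := (@loc_conv R n phi).
Let test_annulus lam : 0 < lam -> test_fun (annulus lam) := @test_fun_annulus R n phi Hphi lam.

Lemma complex_ReM (z w : R[i]) : Re (z * w) = Re z * Re w - Im z * Im w.
Proof. by case: z w => a b [c d]. Qed.

Lemma complex_ImM (z w : R[i]) : Im (z * w) = Re z * Im w + Im z * Re w.
Proof. by case: z w => a b [c d]. Qed.

Lemma complex_ext (z w : R[i]) : Re z = Re w -> Im z = Im w -> z = w.
Proof. by case: z w => a b [c d] /= -> ->. Qed.

Lemma cosBpihalf (r : R) : cos (r - pi / 2) = sin r.
Proof. by rewrite cosB cos_pihalf sin_pihalf mulr0 add0r mulr1. Qed.

(* Real part of the Fourier transform of [u1 + i u2]; its imaginary part is
   [fourier_re u2 (- u1)]. *)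
Definition fourier_re (u1 u2 : V -> R) (xi : V) : R :=
  ctrans u1 0 xi + ctrans u2 (- (pi / 2)) xi.

Lemma exp_annulus_re k xi (x : V) :
  Re ((dyadic phi k x)%:C%C * expi (- dot x xi)) = annulus (2 ^ k) x * cos (dot x xi + 0).
Proof. by rewrite complex_ReM /= mul0r subr0 cosN addr0. Qed.

Lemma exp_annulus_im k xi (x : V) :
  Im ((dyadic phi k x)%:C%C * expi (- dot x xi)) =
  - (annulus (2 ^ k) x * cos (dot x xi + - (pi / 2))).
Proof. by rewrite complex_ImM /= mul0r addr0 sinN cosBpihalf mulrN. Qed.

Lemma dfourier_regular (u : V -> R[i]) k xi :
  test_fun (Re \o u) -> test_fun (Im \o u) ->
  dfourier (Qk phi k (regular u)) xi = cst%:C%C *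
   (fourier_re (fun x => annulus (2 ^ k) x * Re (u x)) (fun x => annulus (2 ^ k) x * Im (u x)) xi +i*
    fourier_re (fun x => annulus (2 ^ k) x * Im (u x)) (fun x => - (annulus (2 ^ k) x * Re (u x))) xi)%C.
Proof.
move=> t1 t2; have p2 : 0 < (2 : R) ^ k by rewrite exprz_gt0.
have sA : smooth (annulus (2 ^ k)) by case: (test_annulus p2).
have i1 := test_fun_integrable (test_funMr sA t1).
have i2 := test_fun_integrable (test_funMr sA t2).
have i3 := test_fun_integrable (test_funZ (-1) (test_funMr sA t1)).
rewrite /dfourier /Qk /regular /cint; congr (_ * (_ +i* _)%C).
  rewrite /fourier_re /ctrans -(Rint_rVD (integrable_cos xi 0 i1) (integrable_cos xi (- (pi / 2)) i2)).
  by apply: eq_Rintegral => t _; rewrite complex_ReM exp_annulus_re exp_annulus_im /=; ring.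
have -> : (fun x => - (annulus (2 ^ k) x * Re (u x))) =
    (fun x => -1 * (annulus (2 ^ k) x * (Re \o u) x)).
  by apply/funext => x; rewrite mulN1r.
rewrite /fourier_re /ctrans -(Rint_rVD (integrable_cos xi 0 i2) (integrable_cos xi (- (pi / 2)) i3)).
by apply: eq_Rintegral => t _; rewrite complex_ImM exp_annulus_re exp_annulus_im /=; ring.
Qed.

(** As P_l acts by transposition, it has to be applied to the test function in the definition of
    [dfourier] for Q_k. Up to a constant this is the Fourier transform, in eta, of the result. *)
Definition symbol_kernel (k l : int) (xi eta : V) : R :=
  annulus (2 ^ l) eta * ctrans (annulus (2 ^ k)) 0 (xi + eta).

Lemma test_fun_symbol_kernel k l xi : test_fun (symbol_kernel k l xi).
Proof.
have p2 m : 0 < (2 : R) ^ m by rewrite exprz_gt0.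
have sC := smooth_affine 1 xi (smooth_ctrans 0 (test_fun_ccs (test_annulus (p2 k)))).
have := test_funMr sC (test_annulus (p2 l)); rewrite /symbol_kernel.
by under eq_fun do rewrite mulrC scale1r addrC.
Qed.

Lemma fourier_exp_annulus k xi eta :
  fourier (fun x => (dyadic phi k x)%:C%C * expi (- dot x xi)) eta =
  (cst * ctrans (annulus (2 ^ k)) 0 (xi + eta))%:C%C.
Proof.
have p2 : 0 < (2 : R) ^ k by rewrite exprz_gt0.
have iA := test_fun_integrable (test_annulus p2).
rewrite /fourier /cint; apply: complex_ext; rewrite ?complex_ReM ?complex_ImM /= ?mul0r ?subr0 ?addr0.
  congr (_ * _); apply: eq_Rintegral => t _.
  by rewrite !annulus_phi /dyadic addr0 !cosN !sinN dotDr cosD; ring.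
rewrite [X in _ * X](_ : _ = - ctrans (annulus (2 ^ k)) (- (pi / 2)) (xi + eta)).
  by rewrite ctrans_even ?cosN ?cos_pihalf ?mul0r ?oppr0 ?mulr0//; exact: annulusN.
rewrite -mulN1r -(Rint_rVZ _ (integrable_cos _ _ iA)); apply: eq_Rintegral => t _.
by rewrite !annulus_phi /dyadic cosBpihalf !cosN !sinN dotDr sinD; ring.
Qed.

Lemma PkD_fun_exp_annulus k l xi :
  PkD_fun phi l (fun x => (dyadic phi k x)%:C%C * expi (- dot x xi)) =
  fun x => ((cst ^+ 2 * ctrans (symbol_kernel k l xi) 0 x)%R +i*
            (cst ^+ 2 * ctrans (symbol_kernel k l xi) (- (pi / 2)) x)%R)%C.
Proof.
have iG := test_fun_integrable (test_fun_symbol_kernel k l xi).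
have E : (fun eta => (dyadic phi l eta)%:C%C *
      fourier (fun x => (dyadic phi k x)%:C%C * expi (- dot x xi)) eta) =
    (fun eta => (cst * symbol_kernel k l xi eta)%:C%C).
  apply/funext => eta; rewrite fourier_exp_annulus.
  apply: complex_ext; rewrite ?complex_ReM ?complex_ImM /= ?mulr0 ?mul0r ?addr0 ?subr0//.
  by rewrite /symbol_kernel !annulus_phi /dyadic mulrCA.
apply/funext => x; rewrite /PkD_fun E /inv_fourier /cint.
apply: complex_ext; rewrite ?complex_ReM ?complex_ImM /= ?mul0r ?subr0 ?addr0 expr2 -mulrA; congr (_ * _).
  rewrite -(Rint_rVZ _ (integrable_cos x 0 iG)); apply: eq_Rintegral => t _.
  by rewrite addr0 (dotC x); ring.
rewrite -(Rint_rVZ _ (integrable_cos x _ iG)); apply: eq_Rintegral => t _.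
by rewrite cosBpihalf (dotC x); ring.
Qed.

(** The multiplication formula moves the transform from the symbol to [a] and [b], and the
    reflection eta -> -eta turns xi + eta into xi - eta, that is, the pairing into a convolution. *)
Lemma symbol_kernel_pairing (a b : V -> R) k l xi : test_fun a -> test_fun b ->
  \int[lebn]_t (a (X t) * ctrans (symbol_kernel k l xi) 0 (X t) +
                b (X t) * ctrans (symbol_kernel k l xi) (- (pi / 2)) (X t)) =
  loc_conv (2 ^ k) (annulus (2 ^ l)) (fourier_re a (fun x => - b x)) xi.
Proof.
move=> ta tb; set G := symbol_kernel k l xi; have tG := test_fun_symbol_kernel k l xi.
have p2 m : 0 < (2 : R) ^ m by rewrite exprz_gt0.
have iG := test_fun_integrable tG.
have ia := test_fun_integrable ta; have ib := test_fun_integrable tb.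
have bd f th : test_fun f -> integrable_rV f -> integrable_rV (fun x => f x * ctrans G th x).
  by move=> tf jf; apply: (integrable_rV_bounded jf (meas_ctrans th tG)) => x; exact: ctrans_bounded.
have dd f th : test_fun f -> integrable_rV (fun x => G x * ctrans f th x).
  move=> tf; apply: (integrable_rV_bounded iG (meas_ctrans th tf)) => x; exact: ctrans_bounded.
have s1 := Rint_swap (k := fun x y => cos (dot y x + 0)) ia iG (measurable_dot_cosC 0)
  (fun x y => norm_cos_le1 _).
have s2 := Rint_swap (k := fun x y => cos (dot y x + - (pi / 2))) ib iG
  (measurable_dot_cosC (- (pi / 2))) (fun x y => norm_cos_le1 _).
rewrite (Rint_rVD (bd a 0 ta ia) (bd b (- (pi / 2)) tb ib)).
have e1 : \int[lebn]_t (a (X t) * ctrans G 0 (X t)) = \int[lebn]_t (G (X t) * ctrans a 0 (X t)).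
  apply: (etrans s1); apply: eq_Rintegral => t _; congr (_ * _).
  by apply: eq_Rintegral => s _; rewrite dotC.
have e2 : \int[lebn]_t (b (X t) * ctrans G (- (pi / 2)) (X t)) =
    \int[lebn]_t (G (X t) * ctrans b (- (pi / 2)) (X t)).
  apply: (etrans s2); apply: eq_Rintegral => t _; congr (_ * _).
  by apply: eq_Rintegral => s _; rewrite dotC.
move: e1 e2 => -> -> {s1 s2}.
rewrite -(Rint_rVD (dd a 0 ta) (dd b (- (pi / 2)) tb)).
have := integrable_rVD (dd a 0 ta) (dd b (- (pi / 2)) tb) => iS.
apply: (etrans (esym (Rint_opp iS))) => {iS}; apply: eq_Rintegral => t _.
rewrite -mulrDr /G /symbol_kernel annulusN /fourier_re ctransN; congr (_ * (_ + _)).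
by apply: eq_Rintegral => s _; rewrite dotNr !cosBpihalf sinN; ring.
Qed.

Lemma dfourier_PkD_regular (u : V -> R[i]) k l xi :
  test_fun (Re \o u) -> test_fun (Im \o u) ->
  dfourier (Qk phi k (PkD phi l (regular u))) xi = cst%:C%C *
   ((cst ^+ 2 * loc_conv (2 ^ k) (annulus (2 ^ l)) (fourier_re (Re \o u) (Im \o u)) xi)%R +i*
    (cst ^+ 2 * loc_conv (2 ^ k) (annulus (2 ^ l))
       (fourier_re (Im \o u) (fun x => - Re (u x))) xi)%R)%C.
Proof.
move=> t1 t2; rewrite /dfourier /Qk /PkD PkD_fun_exp_annulus /regular /cint.
have t3 : test_fun (fun x => - Im (u x)).
  by have := test_funZ (-1) t2; under eq_fun do rewrite mulN1r.
have tG := test_fun_symbol_kernel k l xi.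
have bd f th : test_fun f -> integrable_rV (fun x => f x * ctrans (symbol_kernel k l xi) th x).
  move=> tf; apply: (integrable_rV_bounded (test_fun_integrable tf) (meas_ctrans th tG)) => x.
  exact: ctrans_bounded.
congr (_ * (_ +i* _)%C).
  have := symbol_kernel_pairing k l xi t1 t3.
  have -> : (fun x => - - Im (u x)) = Im \o u by apply/funext => x; rewrite opprK.
  move=> <-; rewrite -(Rint_rVZ _ (integrable_rVD (bd _ 0 t1) (bd _ (- (pi / 2)) t3))).
  by apply: eq_Rintegral => t _; rewrite complex_ReM /=; ring.
have <- := symbol_kernel_pairing k l xi t2 t1.
rewrite -(Rint_rVZ _ (integrable_rVD (bd _ 0 t2) (bd _ (- (pi / 2)) t1))).
by apply: eq_Rintegral => t _; rewrite complex_ImM /=; ring.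
Qed.

End fourier_formulas.

(** * The estimate for test functions *)

Section test_functions_estimate.
Context {R : realType} {n : nat}.
Local Notation T := (n.-tuple (measurableTypeR R)).
Local Notation X := (@rV_of_tuple R n).
Local Notation V := 'rV[R]_n.
Local Notation lebn := (lebn R n).
Local Notation Re := (@complex.Re R).
Local Notation Im := (@complex.Im R).
Local Notation cabs := (@ComplexField.Normc.normc R).
Local Notation cst := (@fourier_cst R n).
Hypothesis n_gt0 : (0 < n)%N.
Variable phi : R -> R.
Hypothesis Hphi : dyadic_generator phi.
Local Notation annulus := (@annulus R n phi).
Local Notation loc_conv := (@loc_conv R n phi).
Let test_annulus lam : 0 < lam -> test_fun (annulus lam) := @test_fun_annulus R n phi Hphi lam.

Lemma sqr_cabs (z : R[i]) : cabs z ^+ 2 = Re z ^+ 2 + Im z ^+ 2.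
Proof. by case: z => a b /=; rewrite sqr_sqrtr// addr_ge0 ?sqr_ge0. Qed.

Lemma Hdot_sqr s (F : functional R n) :
  (Hdot s F `^ 2)%E = wnorm s (fun xi => cabs (dfourier F xi)).
Proof.
rewrite /Hdot unlock -poweRrM mulVf ?pnatr_eq0// poweRe1; last first.
  by apply: integral_ge0 => t _; exact: poweR_ge0.
apply: eq_integral => t _ /=.
by rewrite powR_mulrn// real_normK ?num_real// exprMn powR_sqr.
Qed.

Lemma Hdot_ge0 s (F : functional R n) : (0 <= Hdot s F)%E.
Proof. by rewrite /Hdot unlock; exact: poweR_ge0. Qed.

Lemma wnorm_cabs s (c : R) (p q : V -> R) : meas_rV p -> meas_rV q ->
  wnorm s (fun xi => cabs (c%:C%C * (p xi +i* q xi)%C)) =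
  ((c ^+ 2)%:E * (wnorm s p + wnorm s q))%E.
Proof.
move=> mp mq.
have n0 (f : V -> R) x : 0 <= enorm x `^ (2 * s) * f x ^+ 2.
  by rewrite mulr_ge0 ?powR_ge0 ?sqr_ge0.
rewrite /wnorm -(eintD (meas_wnorm s mp) (meas_wnorm s mq) (n0 p) (n0 q)).
rewrite -(eintZ (sqr_ge0 c) (meas_rVD (meas_wnorm s mp) (meas_wnorm s mq))); last first.
  by move=> x; exact: addr_ge0.
apply: eq_integral => t _; congr EFin.
rewrite sqr_cabs complex_ReM complex_ImM /= !mul0r subr0 addr0; ring.
Qed.

Lemma wnorm_cabsZ s (c a : R) (p q : V -> R) : meas_rV p -> meas_rV q ->
  wnorm s (fun xi => cabs (c%:C%C * ((a * p xi)%R +i* (a * q xi)%R)%C)) =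
  ((c ^+ 2 * a ^+ 2)%:E * (wnorm s p + wnorm s q))%E.
Proof.
move=> mp mq; rewrite (wnorm_cabs s c (meas_rVZ a mp) (meas_rVZ a mq)).
rewrite (wnormZ s a mp) (wnormZ s a mq); move: (wnorm_ge0 s p) (wnorm_ge0 s q).
move: (wnorm s p) (wnorm s q) => x y x0 y0.
by rewrite [in RHS]EFinM -muleA; congr (_ * _)%E; rewrite ge0_muleDr.
Qed.

Lemma sqr_sum_weighted (I : Type) (J : seq I) (w f : I -> R) (K : R) :
  (forall j, 0 < w j) -> \sum_(j <- J) w j <= K -> 0 < K ->
  (\sum_(j <- J) f j) ^+ 2 <= K * \sum_(j <- J) (w j)^-1 * f j ^+ 2.
Proof.
move=> w0 wK K0; set F := \sum_(j <- J) f j; set G := \sum_(j <- J) (w j)^-1 * _.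
(* The minimiser of G - 2 c F + c^2 K, an expression that dominates a sum of nonnegative terms. *)
pose c := F / K.
have : 0 <= \sum_(j <- J) (w j)^-1 * (f j - w j * c) ^+ 2.
  by apply: sumr_ge0 => j _; rewrite mulr_ge0 ?sqr_ge0// invr_ge0 ltW.
have -> : \sum_(j <- J) (w j)^-1 * (f j - w j * c) ^+ 2 =
    G - 2 * c * F + c ^+ 2 * \sum_(j <- J) w j.
  rewrite /G /F !mulr_sumr -sumrB -big_split/=; apply: eq_bigr => j _.
  by field; rewrite gt_eqF.
have h : c ^+ 2 * \sum_(j <- J) w j <= c ^+ 2 * K by rewrite ler_wpM2l ?sqr_ge0.
move=> h1; have h2 : 0 <= G - 2 * c * F + c ^+ 2 * K by lra.
have -> : F ^+ 2 = K * (2 * c * F - c ^+ 2 * K) by rewrite /c; field; rewrite gt_eqF.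
by rewrite ler_wpM2l ?(ltW K0)//; lra.
Qed.

(** The weights 2^(-e |k - j|) have a bounded sum, so adding shells costs only the factor 2^(e |k -
    j|) on shell j, whatever the number of shells. *)
Lemma wnorm_sum_weighted (s e : R) (J : seq int) (k : int) (f : int -> V -> R) : 0 < e ->
  uniq J -> (forall j, meas_rV (f j)) ->
  (wnorm s (fun x => \sum_(j <- J) f j x)%R <=
   \sum_(j <- J) (2 / (1 - 2 `^ (- e)) * 2 `^ (e * `|k - j|%N%:R))%:E * wnorm s (f j))%E.
Proof.
move=> e0 uJ mf; set K := 2 / (1 - 2 `^ (- e)).
have K0 : 0 < K.
  rewrite divr_gt0// subr_gt0 powRN invf_lt1 ?powR_gt0//.
  have h : (1 : R) `^ e < 2 `^ e by rewrite gt0_ltr_powR// ?nnegrE// ltr1n.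
  by move: h; rewrite powR1.
have n0 (g : V -> R) x : 0 <= enorm x `^ (2 * s) * g x ^+ 2.
  by rewrite mulr_ge0 ?powR_ge0 ?sqr_ge0.
have c0 j : 0 <= K * 2 `^ (e * `|k - j|%N%:R) by rewrite mulr_ge0 ?powR_ge0// ltW.
have -> : (\sum_(j <- J) (K * 2 `^ (e * `|k - j|%N%:R))%:E * wnorm s (f j) =
    \sum_(j <- J) eint (fun x => K * 2 `^ (e * `|k - j|%N%:R) *
      (enorm x `^ (2 * s) * f j x ^+ 2))%R)%E.
  by apply: eq_bigr => j _; rewrite (eintZ (c0 j) (meas_wnorm s (mf j)) (n0 (f j))).
rewrite -eint_sum; first last.
- by move=> j x; rewrite mulr_ge0.
- by move=> j; apply: meas_rVZ; exact: meas_wnorm.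
apply: le_eint.
- by apply: meas_wnorm; rewrite /meas_rV /comp; apply: measurable_sum => j; exact: mf.
- by rewrite /meas_rV /comp; apply: measurable_sum => j; exact: (meas_rVZ _ (meas_wnorm s (mf j))).
move=> x; rewrite mulr_ge0 ?powR_ge0 ?sqr_ge0//=.
have := @sqr_sum_weighted _ J (fun j => 2 `^ (- (e * `|k - j|%N%:R))) (f ^~ x) K _ _ K0.
have w0 (j : int) : 0 < (2 : R) `^ (- (e * `|k - j|%N%:R)) by rewrite powR_gt0.
have ws : \sum_(j <- J) (2 : R) `^ (- (e * `|k - j|%N%:R)) <= K.
  apply: le_trans (sum_powR_absz k e0 uJ); apply: ler_sum => j _; by rewrite distnC.
move=> /(_ w0 ws) h; apply: le_trans (ler_wpM2l (powR_ge0 _ _) h) _.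
rewrite mulrA [_ * K]mulrC -mulrA !mulr_sumr le_eqVlt; apply/orP; left; apply/eqP.
apply: eq_bigr => j _; rewrite powRN invrK; ring.
Qed.

Lemma ctrans_sum (J : seq int) (F : int -> V -> R) th xi : (forall j, test_fun (F j)) ->
  ctrans (fun x => \sum_(j <- J) F j x) th xi = \sum_(j <- J) ctrans (F j) th xi.
Proof.
move=> tF; have iF j := integrable_cos xi th (test_fun_integrable (tF j)).
rewrite /ctrans -(Rint_rV_sum J iF).
by apply: eq_Rintegral => t _; rewrite mulr_suml.
Qed.

Lemma test_fun_annulusM j (v : V -> R) : test_fun v -> test_fun (fun x => annulus (2 ^ j) x * v x).
Proof.
by move=> tv; apply: test_funMr => //; apply: (test_annulus _).1; rewrite exprz_gt0.
Qed.

Lemma fourier_re_shell j (v1 v2 : V -> R) : test_fun v1 -> test_fun v2 ->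
  shell_localised (2 ^ j)
    (fourier_re (fun x => annulus (2 ^ j) x * v1 x) (fun x => annulus (2 ^ j) x * v2 x)).
Proof.
move=> t1 t2; exists (fun x => annulus (2 ^ j) x * v1 x), (fun x => annulus (2 ^ j) x * v2 x).
have p2 : 0 < (2 : R) ^ j by rewrite exprz_gt0.
exists 0, (- (pi / 2)); split => //.
- by split; exact: test_fun_annulusM.
- by move=> x; rewrite mulf_eq0 negb_or => /andP[/(annulus_supp Hphi p2)].
- by move=> x; rewrite mulf_eq0 negb_or => /andP[/(annulus_supp Hphi p2)].
Qed.

Lemma loc_conv_sum (J : seq int) lam b (W : int -> V -> R) xi : 0 < lam ->
  integrable_rV b -> (forall j, meas_rV (W j)) -> (forall j, exists M : R, forall x, `|W j x| <= M) ->
  loc_conv lam b (fun x => \sum_(j <- J) W j x) xi = \sum_(j <- J) loc_conv lam b (W j) xi.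
Proof.
move=> l0 ib mW bW.
have iW j : integrable_rV (fun x => b x * ctrans (annulus lam) 0 (xi - x) * W j x).
  by have [M WM] := bW j; exact: (integrable_loc_conv Hphi xi l0 ib (mW j) WM).
under [RHS]eq_bigr do rewrite loc_conv_unfold.
rewrite loc_conv_unfold -(Rint_rV_sum J iW).
by apply: eq_Rintegral => t _; rewrite mulr_sumr.
Qed.

Lemma shell_decomposition_bound (s d : R) : `|s| <= 1 -> 2 * `|s| < n%:R ->
  d < n%:R - 2 * `|s| -> exists C : R, 0 <= C /\
  forall (k : int) (ls J : seq int) (v1 v2 : V -> R), uniq ls -> uniq J ->
  test_fun v1 -> test_fun v2 ->
  (forall x, v1 x = \sum_(j <- J) annulus (2 ^ j) x * v1 x) ->
  (forall x, v2 x = \sum_(j <- J) annulus (2 ^ j) x * v2 x) ->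
  (\sum_(l <- ls) wnorm s (loc_conv (2 ^ k) (annulus (2 ^ l)) (fourier_re v1 v2)) <=
   \sum_(j <- J) (C * 2 `^ (- (d * `|k - j|%N%:R)))%:E *
     wnorm s (fourier_re (fun x => annulus (2 ^ j) x * v1 x)%R
                         (fun x => annulus (2 ^ j) x * v2 x)%R))%E.
Proof.
move=> s1 sn dn; have [C [C0 hC]] := block_bound n_gt0 Hphi s1 sn.
(* The decay n - 2 |s| of a block is shared: [e] is spent on adding the shells, [d] remains. *)
pose e := n%:R - 2 * `|s| - d; have e0 : 0 < e by rewrite subr_gt0.
pose K := 2 / (1 - 2 `^ (- e)).
have K0 : 0 <= K by have := sum_powR_absz 0 e0 (isT : uniq [::]); rewrite big_nil.
exists (K * C); split; first exact: mulr_ge0.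
move=> k ls J v1 v2 uls uJ t1 t2 h1 h2.
have p2 m : 0 < (2 : R) ^ m by rewrite exprz_gt0.
pose W j := fourier_re (fun x => annulus (2 ^ j) x * v1 x) (fun x => annulus (2 ^ j) x * v2 x).
have lW j : shell_localised (2 ^ j) (W j) by exact: fourier_re_shell.
have WE : fourier_re v1 v2 = fun xi => \sum_(j <- J) W j xi.
  apply/funext => xi; rewrite big_split/= /fourier_re -!ctrans_sum; first last.
  - by move=> j; exact: test_fun_annulusM.
  - by move=> j; exact: test_fun_annulusM.
  have f1 : v1 = fun x => \sum_(j <- J) annulus (2 ^ j) x * v1 x by apply/funext.
  have f2 : v2 = fun x => \sum_(j <- J) annulus (2 ^ j) x * v2 x by apply/funext.
  by rewrite {1}f1 {1}f2.
have mL l j : meas_rV (loc_conv (2 ^ k) (annulus (2 ^ l)) (W j)).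
  apply: (meas_loc_conv Hphi (p2 k) (test_fun_ccs (test_annulus (p2 l)))).
  exact: shell_localised_continuous (lW j).
have LE l : loc_conv (2 ^ k) (annulus (2 ^ l)) (fourier_re v1 v2) =
    fun xi => \sum_(j <- J) loc_conv (2 ^ k) (annulus (2 ^ l)) (W j) xi.
  apply/funext => xi; rewrite WE loc_conv_sum//.
  - exact/test_fun_integrable/test_annulus.
  - by move=> j; exact: shell_localised_meas (lW j).
  - by move=> j; exact: shell_localised_bounded (lW j).
under eq_bigr do rewrite LE.
apply: (@le_trans _ _ (\sum_(l <- ls) \sum_(j <- J)
    (K * 2 `^ (e * `|k - j|%N%:R))%:E * wnorm s (loc_conv (2 ^ k) (annulus (2 ^ l)) (W j)))%E).
  by apply: lee_sum => l _; exact: wnorm_sum_weighted.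
rewrite exchange_big/=; apply: lee_sum => j _.
rewrite -ge0_sume_distrr; last by move=> l _; exact: wnorm_ge0.
have c0 : 0 <= K * 2 `^ (e * `|k - j|%N%:R) by rewrite mulr_ge0 ?powR_ge0.
apply: le_trans (lee_wpmul2l _ (hC k j ls (W j) uls (lW j))) _; first by rewrite lee_fin.
rewrite muleA -EFinM; apply: lee_wpmul2r; first exact: wnorm_ge0.
rewrite lee_fin mulrACA -powRD ?pnatr_eq0 ?implybT// le_eqVlt; apply/orP; left; apply/eqP.
by congr (_ * _ `^ _); rewrite /e; ring.
Qed.

Definition int_range (a b : int) : seq int := [seq a + i%:Z | i <- iota 0 (absz (b - a)).+1].

Lemma int_range_uniq a b : uniq (int_range a b).
Proof. by rewrite map_inj_uniq ?iota_uniq// => i j /addrI[]. Qed.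

Lemma mem_int_range a b j : a < j -> j < b -> j \in int_range a b.
Proof.
clear; move=> aj jb; apply/mapP; exists (absz (j - a)); last by lia.
by rewrite mem_iota; lia.
Qed.

(** A compact range of radii in (0, +oo) meets only finitely many annuli, so one finite list serves
    for all points of the support of a test function. *)
Lemma exists_shell_cover (r1 r2 : R) : 0 < r1 -> exists J : seq int, uniq J /\
  forall r, r1 <= r <= r2 -> \sum_(j <- J) phi (r / 2 ^ j) = 1.
Proof.
move=> r10; pose r3 := Num.max r1 r2; have r30 : 0 < r3 by rewrite lt_max r10.
have [k1 /andP[hk1 _]] := exists_dyadic (divr_gt0 r10 (ltr0n R 2)).
have [k2 /andP[_ hk2]] := exists_dyadic (mulr_gt0 (ltr0n R 2) r30).
exists (int_range k1 (k2 + 1)); have uJ := int_range_uniq k1 (k2 + 1).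
split => // r /andP[hr1 hr2]; have r0 : 0 < r by exact: lt_le_trans hr1.
have r3r : r <= r3 by rewrite le_max hr2 orbT.
case: Hphi => _ _ _ /(_ r r0); rewrite (esum_seqE (s := int_range k1 (k2 + 1)))//.
- by rewrite sumEFin => -[].
- by move=> j; rewrite lee_fin (generator_ge0 Hphi).
move=> j jn; congr EFin; apply/eqP; apply: contraNT jn => /(generator_lt Hphi).
have p2 : (0 : R) < 2 ^ j by rewrite exprz_gt0.
rewrite ltr_pdivrMr// ltr_pdivlMr// => /andP[h1 h2].
have ln2 : (1 : R) < 2 by rewrite ltr1n.
have u : j < k2 + 1 by rewrite -(ltr_eXz2l ln2); lra.
have l : k1 < j by rewrite -(ltr_eXz2l ln2); lra.
exact: mem_int_range.
Qed.

Lemma meas_fourier_re (v1 v2 : V -> R) : test_fun v1 -> test_fun v2 -> meas_rV (fourier_re v1 v2).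
Proof. by move=> t1 t2; apply: meas_rVD; exact: meas_ctrans. Qed.

Lemma continuous_fourier_re (v1 v2 : V -> R) : test_fun v1 -> test_fun v2 ->
  continuous (fourier_re v1 v2).
Proof.
move=> t1 t2 x.
exact: (cvgD (@continuous_ctrans _ _ _ 0 (test_fun_ccs t1) x)
  (@continuous_ctrans _ _ _ (- (pi / 2)) (test_fun_ccs t2) x)).
Qed.

Lemma test_function_parts (u : V -> R[i]) : test_function_off0 u ->
  test_fun (Re \o u) /\ test_fun (Im \o u).
Proof.
move=> [[s1 s2] [r1 [r2 [_ h]]]]; split; split => //; exists r2 => x /= ux;
  have /h/andP[_]// : u x != 0 by apply: contra_neq ux => ->.
Qed.

(** Adds the contributions of the real and imaginary parts. Here [c] is the square of the Fourier
    constant: it occurs once on the right and three times on the left, where P_l brings a direct and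
    an inverse transform. *)
Lemma combine_parts (I L : choiceType) (ls : seq L) (J : seq I) (c C : R) (w : I -> R)
    (P P' HL : L -> \bar R) (N N' HJ : I -> \bar R) : 0 <= c -> 0 <= C -> (forall j, 0 <= w j) ->
  (forall l, 0 <= P l)%E -> (forall l, 0 <= P' l)%E ->
  (forall j, 0 <= N j)%E -> (forall j, 0 <= N' j)%E ->
  (forall l, HL l = (c * c ^+ 2)%:E * (P l + P' l))%E ->
  (forall j, HJ j = c%:E * (N j + N' j))%E -> uniq J ->
  (\sum_(l <- ls) P l <= \sum_(j <- J) (C * w j)%:E * N j)%E ->
  (\sum_(l <- ls) P' l <= \sum_(j <- J) (C * w j)%:E * N' j)%E ->
  (\sum_(l <- ls) HL l <= (c ^+ 2 * C)%:E * \esum_(j in [set: I]) ((w j)%:E * HJ j))%E.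
Proof.
move=> c0 C0 w0 P0 P'0 N0 N'0 E1 E2 uJ H1 H2.
rewrite (eq_bigr _ (fun l _ => E1 l)) -ge0_sume_distrr; last by move=> l _; rewrite adde_ge0.
rewrite big_split/=.
have cc0 : 0 <= c * c ^+ 2 by rewrite mulr_ge0 ?sqr_ge0.
apply: le_trans (lee_wpmul2l _ (leeD H1 H2)) _; first by rewrite lee_fin.
rewrite -big_split/=.
have nn j : (0 <= (w j)%:E * (N j + N' j))%E by rewrite mule_ge0 ?lee_fin// adde_ge0.
rewrite (eq_bigr (fun j => C%:E * ((w j)%:E * (N j + N' j)))%E); last first.
  by move=> j _; rewrite -ge0_muleDr// EFinM muleA.
rewrite -ge0_sume_distrr; last by move=> j _; exact: nn.
apply: (@le_trans _ _ ((c ^+ 2 * C)%:E * (c%:E * \sum_(j <- J) (w j)%:E * (N j + N' j)))%E).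
  rewrite !muleA -!EFinM le_eqVlt; apply/orP; left; apply/eqP.
  by congr (_%:E * _)%E; ring.
apply: lee_wpmul2l; first by rewrite lee_fin mulr_ge0 ?sqr_ge0.
rewrite ge0_sume_distrr; last by move=> j _; exact: nn.
apply: le_trans (sum_le_esum _ uJ); last first.
  by move=> j; rewrite E2 !mule_ge0 ?lee_fin// adde_ge0.
by apply: lee_sum => j _; rewrite E2 muleCA.
Qed.

Lemma test_function_bound (s d : R) : `|s| <= 1 -> 2 * `|s| < n%:R ->
  d < n%:R - 2 * `|s| -> exists C : R, 0 <= C /\
  forall (k : int) (ls : seq int) (u : V -> R[i]), uniq ls -> test_function_off0 u ->
  (\sum_(l <- ls) Hdot s (Qk phi k (PkD phi l (regular u))) `^ 2 <=
   C%:E * \esum_(j in [set: int])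
     ((2 `^ (- (d * `|k - j|%N%:R)))%:E * Hdot s (Qk phi j (regular u)) `^ 2))%E.
Proof.
move=> s1 sn dn; have [C [C0 hC]] := shell_decomposition_bound s1 sn dn.
exists ((cst ^+ 2) ^+ 2 * C); split; first by rewrite mulr_ge0 ?sqr_ge0.
move=> k ls u us tu; have [t1 t2] := test_function_parts tu.
have p2 m : 0 < (2 : R) ^ m by rewrite exprz_gt0.
have t3 : test_fun (fun x => - Re (u x)).
  by have := test_funZ (-1) t1; under eq_fun do rewrite mulN1r.
have [J [uJ hJ]] : exists J : seq int, uniq J /\
    forall x, u x != 0 -> \sum_(j <- J) annulus (2 ^ j) x = 1.
  have [_ [r1 [r2 [r10 hr]]]] := tu; have [J [uJ hJ]] := exists_shell_cover r2 r10.
  by exists J; split => // x /hr /hJ.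
have cov (f : R[i] -> R) : f 0 = 0 -> forall x,
    f (u x) = \sum_(j <- J) annulus (2 ^ j) x * f (u x).
  move=> f0 x; rewrite -mulr_suml; have [->|ux] := eqVneq (u x) 0; first by rewrite f0 mulr0.
  by rewrite hJ// mul1r.
have c1 := cov Re erefl; have c2 := cov Im erefl.
have c3 : forall x, - Re (u x) = \sum_(j <- J) annulus (2 ^ j) x * - Re (u x).
  by apply: (cov (fun z => - Re z)); rewrite oppr0.
have H1 := hC k ls J _ _ us uJ t1 t2 c1 c2.
have H2 := hC k ls J _ _ us uJ t2 t3 c2 c3.
have mL l (v1 v2 : V -> R) : test_fun v1 -> test_fun v2 ->
    meas_rV (loc_conv (2 ^ k) (annulus (2 ^ l)) (fourier_re v1 v2)).
  move=> tv1 tv2; apply: (meas_loc_conv Hphi (p2 k) (test_fun_ccs (test_annulus (p2 l)))).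
  exact: continuous_fourier_re.
pose P l := wnorm s (loc_conv (2 ^ k) (annulus (2 ^ l)) (fourier_re (Re \o u) (Im \o u))).
pose P' l := wnorm s (loc_conv (2 ^ k) (annulus (2 ^ l)) (fourier_re (Im \o u) (fun x => - Re (u x)))).
have P0 l : (0 <= P l)%E by exact: wnorm_ge0.
have P'0 l : (0 <= P' l)%E by exact: wnorm_ge0.
have E1 l : (Hdot s (Qk phi k (PkD phi l (regular u))) `^ 2 =
    (cst ^+ 2 * (cst ^+ 2) ^+ 2)%:E * (P l + P' l))%E.
  rewrite Hdot_sqr; under eq_fun do rewrite (dfourier_PkD_regular Hphi k l _ t1 t2).
  exact: (wnorm_cabsZ s cst (cst ^+ 2) (mL l _ _ t1 t2) (mL l _ _ t2 t3)).
pose N j := wnorm s (fourier_re (fun x => annulus (2 ^ j) x * Re (u x))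
                                (fun x => annulus (2 ^ j) x * Im (u x))).
pose N' j := wnorm s (fourier_re (fun x => annulus (2 ^ j) x * Im (u x))
                                (fun x => annulus (2 ^ j) x * - Re (u x))).
have E2 j : (Hdot s (Qk phi j (regular u)) `^ 2 = (cst ^+ 2)%:E * (N j + N' j))%E.
  rewrite Hdot_sqr; under eq_fun do rewrite (dfourier_regular Hphi j _ t1 t2).
  have a1 := test_fun_annulusM j t1; have a2 := test_fun_annulusM j t2.
  have a3 := test_fun_annulusM j t3.
  have -> : (fun x => - (annulus (2 ^ j) x * Re (u x))) = (fun x => annulus (2 ^ j) x * - Re (u x)).
    by apply/funext => x; rewrite mulrN.
  by rewrite wnorm_cabs; [|exact: meas_fourier_re|exact: meas_fourier_re].
have w0 (j : int) : 0 <= (2 : R) `^ (- (d * `|k - j|%N%:R)) by exact: powR_ge0.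
exact: (combine_parts (sqr_ge0 cst) C0 w0 P0 P'0 (fun j => wnorm_ge0 s _)
  (fun j => wnorm_ge0 s _) E1 E2 uJ H1 H2).
Qed.

End test_functions_estimate.

(** * Passage to the limit *)

Section passage_to_the_limit.
Context {R : realType} {n : nat}.
Local Notation T := (n.-tuple (measurableTypeR R)).
Local Notation X := (@rV_of_tuple R n).
Local Notation V := 'rV[R]_n.
Local Notation lebn := (lebn R n).
Local Notation Re := (@complex.Re R).
Local Notation Im := (@complex.Im R).
Local Notation cabs := (@ComplexField.Normc.normc R).
Local Notation cst := (@fourier_cst R n).
Hypothesis n_gt0 : (0 < n)%N.
Variable phi : R -> R.
Hypothesis Hphi : dyadic_generator phi.
Local Notation annulus := (@annulus R n phi).
Local Notation loc_conv := (@loc_conv R n phi).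
Let test_annulus lam : 0 < lam -> test_fun (annulus lam) := @test_fun_annulus R n phi Hphi lam.

Lemma eint_fatou (g : nat -> V -> R) (h : V -> R) (B : \bar R) :
  (forall m, meas_rV (g m)) -> (forall m x, 0 <= g m x) ->
  (forall x, g m x @[m --> \oo] --> h x) ->
  (\forall m \near \oo, (eint (g m) <= B)%E) -> (eint h <= B)%E.
Proof.
move=> mg g0 gh gB.
have mgE m : measurable_fun [set: T] (fun t => (g m (X t))%:E).
  by apply/measurable_EFinP; exact: mg.
have gE0 m t : [set: T] t -> (0 <= (g m (X t))%:E)%E by rewrite lee_fin.
have := fatou lebn measurableT mgE gE0.
have -> : (\int[lebn]_(x in setT) limn_einf (fun m => (g m (X x))%:E) = eint h)%E.
  apply: eq_integral => t _; apply: (cvg_limn_einf_sup _).1.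
  by apply: cvg_EFin; [exact: nearW|exact: gh].
move=> /le_trans; apply; rewrite limn_einf_lim; apply: lime_le; first exact: is_cvg_einfs.
apply: filterS gB => m; apply: le_trans.
by apply: ereal_inf_lbound; exists m => //; exact: leqnn.
Qed.

Lemma normr_Re_le (z : R[i]) : `|Re z| <= cabs z.
Proof.
by case: z => a b /=; rewrite -sqrtr_sqr ler_sqrt ?addr_ge0 ?sqr_ge0// lerDl sqr_ge0.
Qed.

Lemma normr_Im_le (z : R[i]) : `|Im z| <= cabs z.
Proof.
by case: z => a b /=; rewrite -sqrtr_sqr ler_sqrt ?addr_ge0 ?sqr_ge0// lerDr sqr_ge0.
Qed.

Lemma sqr_cabs_le (z w : R[i]) : cabs z ^+ 2 <= 2 * cabs w ^+ 2 + 2 * cabs (z - w) ^+ 2.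
Proof.
rewrite !sqr_cabs; case: z w => a b [c d] /=.
have := sqr_ge0 (a - 2 * c); have := sqr_ge0 (b - 2 * d); rewrite !expr2.
by move: a b c d => a b c d; lra.
Qed.

Lemma cvg_dist0 (x : nat -> R) (e : nat -> R) (l : R) :
  (forall m, `|x m - l| <= e m) -> e @ \oo --> (0 : R) -> x @ \oo --> l.
Proof.
move=> xe e0; apply/cvgrPdist_le => eps eps0.
move/cvgrPdist_le : e0 => /(_ eps eps0); apply: filterS => m.
rewrite sub0r normrN => h; rewrite distrC; apply: le_trans (xe m) _.
exact: le_trans (ler_norm _) h.
Qed.

Lemma cvg_Re (z : nat -> R[i]) (w : R[i]) : (fun m => cabs (z m - w)) @ \oo --> (0 : R) ->
  (fun m => Re (z m)) @ \oo --> Re w.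
Proof.
apply: cvg_dist0 => m; have := normr_Re_le (z m - w).
by case: (z m) w => a b [c d].
Qed.

Lemma cvg_Im (z : nat -> R[i]) (w : R[i]) : (fun m => cabs (z m - w)) @ \oo --> (0 : R) ->
  (fun m => Im (z m)) @ \oo --> Im w.
Proof.
apply: cvg_dist0 => m; have := normr_Im_le (z m - w).
by case: (z m) w => a b [c d].
Qed.

Lemma complex_ReB (z w : R[i]) : Re (z - w) = Re z - Re w.
Proof. by case: z w => a b [c d]. Qed.

Lemma complex_ImB (z w : R[i]) : Im (z - w) = Im z - Im w.
Proof. by case: z w => a b [c d]. Qed.

Lemma complex_ReZ (c : R) (z : R[i]) : Re (c%:C%C * z) = c * Re z.
Proof. by rewrite complex_ReM /= mul0r subr0. Qed.

Lemma complex_ImZ (c : R) (z : R[i]) : Im (c%:C%C * z) = c * Im z.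
Proof. by rewrite complex_ImM /= mul0r addr0. Qed.

Lemma schwartz_exp_annulus k xi :
  schwartz (fun x : V => (dyadic phi k x)%:C%C * expi (- dot x xi)).
Proof.
have p2 : 0 < (2 : R) ^ k by rewrite exprz_gt0.
have tf a : test_fun (fun x : V => annulus (2 ^ k) x * cos (dot x xi + a)).
  by have := test_funMr (smooth_cos xi a) (test_annulus p2); under eq_fun do rewrite mulrC.
apply: schwartz_test_fun.
  rewrite (_ : _ \o _ = (fun x => annulus (2 ^ k) x * cos (dot x xi + 0))); first exact: tf.
  by apply/funext => x; exact: exp_annulus_re.
rewrite (_ : _ \o _ = (fun x => -1 * (annulus (2 ^ k) x * cos (dot x xi + - (pi / 2))))).
  by apply: test_funZ; exact: tf.
by apply/funext => x; rewrite mulN1r; exact: exp_annulus_im.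
Qed.

Lemma schwartz_PkD_exp_annulus k l xi :
  schwartz (PkD_fun phi l (fun x : V => (dyadic phi k x)%:C%C * expi (- dot x xi))).
Proof.
have tG := test_fun_symbol_kernel Hphi k l xi; have iG := test_fun_integrable tG.
have tcG := test_funZ (cst ^+ 2) tG.
apply: (schwartz_ctrans (a1 := 0) (a2 := - (pi / 2)) tcG tcG); rewrite (PkD_fun_exp_annulus Hphi).
  by apply/funext => x /=; rewrite ctransZ.
by apply/funext => x /=; rewrite ctransZ.
Qed.

Section approximation.
Variables (F : functional R n) (u : nat -> V -> R[i]).
Hypothesis u_test : forall m, test_function_off0 (u m).
Hypothesis u_cvg : forall psi, schwartz psi ->
  (fun m => cabs (regular (u m) psi - F psi)) @ \oo --> (0 : R).

Lemma cvg_dfourier_Re k xi :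
  (fun m => Re (dfourier (Qk phi k (regular (u m))) xi)) @ \oo --> Re (dfourier (Qk phi k F) xi).
Proof.
rewrite /dfourier complex_ReZ; under eq_fun do rewrite complex_ReZ.
by apply: cvgM; [exact: cvg_cst|apply: cvg_Re; apply: u_cvg; exact: schwartz_exp_annulus].
Qed.

Lemma cvg_dfourier_Im k xi :
  (fun m => Im (dfourier (Qk phi k (regular (u m))) xi)) @ \oo --> Im (dfourier (Qk phi k F) xi).
Proof.
rewrite /dfourier complex_ImZ; under eq_fun do rewrite complex_ImZ.
by apply: cvgM; [exact: cvg_cst|apply: cvg_Im; apply: u_cvg; exact: schwartz_exp_annulus].
Qed.

Lemma cvg_dfourier_PkD k l xi :
  (fun m => cabs (dfourier (Qk phi k (PkD phi l (regular (u m)))) xi) ^+ 2) @ \oo -->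
  cabs (dfourier (Qk phi k (PkD phi l F)) xi) ^+ 2.
Proof.
rewrite sqr_cabs; under eq_fun do rewrite sqr_cabs.
have h := u_cvg (schwartz_PkD_exp_annulus k l xi).
have h1 : (fun m => Re (dfourier (Qk phi k (PkD phi l (regular (u m)))) xi)) @ \oo -->
    Re (dfourier (Qk phi k (PkD phi l F)) xi).
  rewrite /dfourier complex_ReZ; under eq_fun do rewrite complex_ReZ.
  by apply: cvgM; [exact: cvg_cst|exact: cvg_Re h].
have h2 : (fun m => Im (dfourier (Qk phi k (PkD phi l (regular (u m)))) xi)) @ \oo -->
    Im (dfourier (Qk phi k (PkD phi l F)) xi).
  rewrite /dfourier complex_ImZ; under eq_fun do rewrite complex_ImZ.
  by apply: cvgM; [exact: cvg_cst|exact: cvg_Im h].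
by rewrite !expr2; apply: cvgD; apply: cvgM.
Qed.

End approximation.

Lemma meas_dfourier_regular k (u : V -> R[i]) : test_function_off0 u ->
  meas_rV (fun xi => Re (dfourier (Qk phi k (regular u)) xi)) /\
  meas_rV (fun xi => Im (dfourier (Qk phi k (regular u)) xi)).
Proof.
move=> tu; have [t1 t2] := test_function_parts tu.
have a1 := test_fun_annulusM Hphi k t1; have a2 := test_fun_annulusM Hphi k t2.
have a3 : test_fun (fun x => - (annulus (2 ^ k) x * Re (u x))).
  by have := test_funZ (-1) a1; under eq_fun do rewrite mulN1r.
split; rewrite /meas_rV /comp; under eq_fun do rewrite (dfourier_regular Hphi k _ t1 t2).
  under eq_fun do rewrite complex_ReZ /=.
  exact: (meas_rVZ cst (meas_fourier_re a1 a2)).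
under eq_fun do rewrite complex_ImZ /=.
exact: (meas_rVZ cst (meas_fourier_re a2 a3)).
Qed.

Lemma meas_dfourier_PkD k l (u : V -> R[i]) : test_function_off0 u ->
  meas_rV (fun xi => cabs (dfourier (Qk phi k (PkD phi l (regular u))) xi) ^+ 2).
Proof.
move=> tu; have [t1 t2] := test_function_parts tu.
have p2 m : 0 < (2 : R) ^ m by rewrite exprz_gt0.
have t3 : test_fun (fun x => - Re (u x)).
  by have := test_funZ (-1) t1; under eq_fun do rewrite mulN1r.
have mL (v1 v2 : V -> R) : test_fun v1 -> test_fun v2 ->
    meas_rV (loc_conv (2 ^ k) (annulus (2 ^ l)) (fourier_re v1 v2)).
  move=> tv1 tv2; apply: (meas_loc_conv Hphi (p2 k) (test_fun_ccs (test_annulus (p2 l)))).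
  exact: continuous_fourier_re.
have m1 := meas_rVZ cst (meas_rVZ (cst ^+ 2) (mL _ _ t1 t2)).
have m2 := meas_rVZ cst (meas_rVZ (cst ^+ 2) (mL _ _ t2 t3)).
have := meas_rVD (meas_rVX 2 m1) (meas_rVX 2 m2); rewrite /meas_rV /comp; congr measurable_fun.
apply/funext => t; rewrite sqr_cabs (dfourier_PkD_regular Hphi k l _ t1 t2).
by rewrite complex_ReZ complex_ImZ.
Qed.

(** A single term of the sum is at most the whole; thus convergence in [lx] controls every shell,
    with an explicit weight. *)
Lemma Hdot_le_lx (q a s : R) (F : functional R n) j : 0 < q ->
  (Hdot s (Qk phi j F) `^ 2 <=
   (2 `^ (- (2 * (j%:~R * a))))%:E * lx phi q a (Hdot s) F `^ 2)%E.
Proof.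
move=> q0; have qn : q != 0 by rewrite gt_eqF.
set H := Hdot s (Qk phi j F); have H0 : (0 <= H)%E by exact: Hdot_ge0.
have t0 k : (0 <= (2 `^ (k%:~R * q * a))%:E * Hdot s (Qk phi k F) `^ q)%E.
  by rewrite mule_ge0 ?lee_fin ?powR_ge0 ?poweR_ge0.
have h : ((2 `^ (j%:~R * a))%:E * H <= lx phi q a (Hdot s) F)%E.
  rewrite /lx.
  have -> : ((2 `^ (j%:~R * a))%:E * H = ((2 `^ (j%:~R * q * a))%:E * H `^ q) `^ q^-1)%E.
    rewrite poweRM ?lee_fin ?powR_ge0 ?poweR_ge0// -poweRrM mulfV// poweRe1//.
    by rewrite poweR_EFin -powRrM; congr ((_ `^ _)%:E * _)%E; field.
  apply: le_poweR; [by rewrite invr_ge0 ltW|exact: t0|].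
  by have := @sum_le_esum R _ _ [:: j] t0 isT; rewrite big_seq1.
have p0 : 0 < 2 `^ (j%:~R * a) :> R by rewrite powR_gt0.
have {}h := le_poweR (ler0n R 2) (mule_ge0 (ltW p0 : (0 <= (2 `^ (j%:~R * a))%:E)%E) H0) h.
apply: le_trans (lee_wpmul2l _ h); last by rewrite lee_fin powR_ge0.
rewrite poweRM ?lee_fin ?(ltW p0)// poweR_EFin muleA -EFinM -powRrM -powRD ?pnatr_eq0 ?implybT//.
by rewrite (_ : _ + _ = 0) ?powRr0 ?mul1e//; ring.
Qed.

(** On the left, Fatou's lemma is applied along the pointwise convergence of the transforms, which
    are values of the distributions at Schwartz functions. On the right, |z|^2 <= 2 |w|^2 + 2 |z -
    w|^2 separates the norm of [F] from that of the error, whence the factor 2; the error is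
    controlled shell by shell through [Hdot_le_lx]. *)
Lemma limit_bound (q a s d C : R) (F : functional R n) : 0 < q -> 2 * `|a| < d -> 0 <= C ->
  (forall (k : int) (ls : seq int) (u : V -> R[i]), uniq ls -> test_function_off0 u ->
    (\sum_(l <- ls) Hdot s (Qk phi k (PkD phi l (regular u))) `^ 2 <=
     C%:E * \esum_(j in [set: int])
       ((2 `^ (- (d * `|k - j|%N%:R)))%:E * Hdot s (Qk phi j (regular u)) `^ 2))%E) ->
  lx_Hdot_space phi q a s F -> forall k ls, uniq ls ->
    (\sum_(l <- ls) Hdot s (Qk phi k (PkD phi l F)) `^ 2 <=
     (2 * C)%:E * \esum_(j in [set: int])
       ((2 `^ (- (d * `|k - j|%N%:R)))%:E * Hdot s (Qk phi j F) `^ 2))%E.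
Proof.
move=> q0 ad C0 hC [_ [u [u_test u_cvg u_lx]]] k ls us.
pose D m : functional R n := fun psi => regular (u m) psi - F psi.
pose w j : R := 2 `^ (- (d * `|k - j|%N%:R)); have w0 j : 0 <= w j by exact: powR_ge0.
(* [F] is merely a functional; its transform is measurable as a pointwise limit. *)
have mRe j : meas_rV (fun xi => Re (dfourier (Qk phi j F) xi)).
  apply: (@measurable_fun_cvg _ _ _ setT (fun m t => Re (dfourier (Qk phi j (regular (u m))) (X t)))).
    by move=> m; exact: (meas_dfourier_regular j (u_test m)).1.
  by move=> t _; exact: (cvg_dfourier_Re u_cvg).
have mIm j : meas_rV (fun xi => Im (dfourier (Qk phi j F) xi)).
  apply: (@measurable_fun_cvg _ _ _ setT (fun m t => Im (dfourier (Qk phi j (regular (u m))) (X t)))).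
    by move=> m; exact: (meas_dfourier_regular j (u_test m)).2.
  by move=> t _; exact: (cvg_dfourier_Im u_cvg).
have mc (z : V -> R[i]) : meas_rV (fun xi => Re (z xi)) -> meas_rV (fun xi => Im (z xi)) ->
    meas_rV (fun xi => enorm xi `^ (2 * s) * cabs (z xi) ^+ 2).
  move=> m1 m2; have := meas_rVM (meas_enorm_powR (2 * s)) (meas_rVD (meas_rVX 2 m1) (meas_rVX 2 m2)).
  rewrite /meas_rV /comp; congr measurable_fun.
  by apply/funext => t; rewrite sqr_cabs.
have split_ m j : (Hdot s (Qk phi j (regular (u m))) `^ 2 <=
    2%:E * Hdot s (Qk phi j F) `^ 2 + 2%:E * Hdot s (Qk phi j (D m)) `^ 2)%E.
  have [m1 m2] := meas_dfourier_regular j (u_test m).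
  have DE xi : dfourier (Qk phi j (D m)) xi =
      dfourier (Qk phi j (regular (u m))) xi - dfourier (Qk phi j F) xi.
    by rewrite /dfourier -mulrBr.
  have m3 : meas_rV (fun xi => Re (dfourier (Qk phi j (D m)) xi)).
    have := measurable_funB m1 (mRe j); rewrite /meas_rV /comp; congr measurable_fun.
    by apply/funext => t; rewrite DE complex_ReB.
  have m4 : meas_rV (fun xi => Im (dfourier (Qk phi j (D m)) xi)).
    have := measurable_funB m2 (mIm j); rewrite /meas_rV /comp; congr measurable_fun.
    by apply/funext => t; rewrite DE complex_ImB.
  have c1 := mc _ m1 m2; have c2 := mc _ (mRe j) (mIm j); have c3 := mc _ m3 m4.
  have n0 (z : V -> R[i]) xi : 0 <= enorm xi `^ (2 * s) * cabs (z xi) ^+ 2.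
    by rewrite mulr_ge0 ?powR_ge0 ?sqr_ge0.
  rewrite !Hdot_sqr /wnorm -(eintZ (ler0n R 2) c2 (n0 _)) -(eintZ (ler0n R 2) c3 (n0 _)).
  rewrite -eintD; [|exact: meas_rVZ|exact: meas_rVZ|by move=> x; rewrite mulr_ge0
    |by move=> x; rewrite mulr_ge0].
  apply: le_eint; [exact: c1|by apply: meas_rVD; exact: meas_rVZ|].
  move=> xi; apply/andP; split; first exact: n0.
  rewrite DE.
  apply: le_trans (ler_wpM2l (powR_ge0 _ _) (sqr_cabs_le _ (dfourier (Qk phi j F) xi))) _.
  by rewrite mulrDr mulrCA [X in _ + X]mulrCA.
pose S := \esum_(j in [set: int]) ((w j)%:E * Hdot s (Qk phi j F) `^ 2)%E.
pose e := d - 2 * `|a|; have e0 : 0 < e by rewrite subr_gt0.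
pose K := 2 `^ (- (2 * (k%:~R * a))) * (2 / (1 - 2 `^ (- e))).
have K0 : 0 <= K.
  apply: mulr_ge0; first exact: powR_ge0.
  by have := sum_powR_absz 0 e0 (isT : uniq [::]); rewrite big_nil.
(* The weights of [Hdot_le_lx] may grow like 2^(2 |a| |k - j|) as j moves away from k. Their sum
   against the block decay converges because d > 2 |a|. *)
have wK : (\esum_(j in [set: int]) (w j * 2 `^ (- (2 * (j%:~R * a))))%:E <= K%:E)%E.
  apply: esum_le_sum => J uJ; rewrite sumEFin lee_fin.
  apply: le_trans (_ : 2 `^ (- (2 * (k%:~R * a))) * \sum_(j <- J) 2 `^ (- (e * `|j - k|%N%:R)) <= _).
    rewrite mulr_sumr; apply: ler_sum => j _; rewrite /w -!powRD ?pnatr_eq0 ?implybT//.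
    apply: ler_powR; first by rewrite ler1n.
    have jk : (k - j)%:~R * a <= `|k - j|%N%:R * `|a| :> R.
      apply: le_trans (ler_norm _) _; rewrite normrM ler_wpM2r//.
      by rewrite -[leRHS]mulrz_nat natz abszE -intr_norm.
    rewrite (distnC j k) /e; move: jk; rewrite intrB.
    by move: (k%:~R : R) (j%:~R : R) (`|k - j|%N%:R : R) `|a| => x y z a'; lra.
  by rewrite ler_wpM2l ?powR_ge0// sum_powR_absz.
clearbody K.
(* [t] bounds the square of the [lx] norm of the error. It is made small at the end, for fixed k and
   [ls]. *)
have step (t : R) : 0 < t ->
    (\sum_(l <- ls) Hdot s (Qk phi k (PkD phi l F)) `^ 2 <=
     C%:E * (2%:E * S + (2 * K * t)%:E))%E.
  move=> t0; pose g m xi : R := \sum_(l <- ls)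
    enorm xi `^ (2 * s) * cabs (dfourier (Qk phi k (PkD phi l (regular (u m)))) xi) ^+ 2.
  pose h xi : R := \sum_(l <- ls)
    enorm xi `^ (2 * s) * cabs (dfourier (Qk phi k (PkD phi l F)) xi) ^+ 2.
  have mg1 l m : meas_rV (fun xi => enorm xi `^ (2 * s) *
      cabs (dfourier (Qk phi k (PkD phi l (regular (u m)))) xi) ^+ 2).
    by apply: meas_rVM; [exact: meas_enorm_powR|exact: meas_dfourier_PkD].
  have cF l xi := @cvg_dfourier_PkD _ _ u_cvg k l xi.
  have mF l : meas_rV (fun xi => cabs (dfourier (Qk phi k (PkD phi l F)) xi) ^+ 2).
    apply: (@measurable_fun_cvg _ _ _ setT (fun m t =>
      cabs (dfourier (Qk phi k (PkD phi l (regular (u m)))) (X t)) ^+ 2)).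
      by move=> m; exact: meas_dfourier_PkD.
    by move=> x _; exact: cF.
  have mh1 l : meas_rV (fun xi => enorm xi `^ (2 * s) *
      cabs (dfourier (Qk phi k (PkD phi l F)) xi) ^+ 2).
    by apply: meas_rVM; first exact: meas_enorm_powR.
  have n0 (z : V -> R[i]) xi : 0 <= enorm xi `^ (2 * s) * cabs (z xi) ^+ 2.
    by rewrite mulr_ge0 ?powR_ge0 ?sqr_ge0.
  have gE m : eint (g m) = (\sum_(l <- ls) Hdot s (Qk phi k (PkD phi l (regular (u m)))) `^ 2)%E.
    rewrite /g (eint_sum ls (fun l => mg1 l m) (fun l x => n0 _ x)).
    by apply: eq_bigr => l _; rewrite Hdot_sqr.
  have hE : eint h = (\sum_(l <- ls) Hdot s (Qk phi k (PkD phi l F)) `^ 2)%E.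
    rewrite /h (eint_sum ls mh1 (fun l x => n0 _ x)).
    by apply: eq_bigr => l _; rewrite Hdot_sqr.
  rewrite -hE; apply: (@eint_fatou g).
  - by move=> m; rewrite /meas_rV /comp; apply: measurable_sum => l; exact: mg1.
  - by move=> m x; apply: sumr_ge0 => l _; exact: n0.
  - move=> x; rewrite /g /h; elim: (ls) => [|l ms IH].
      by rewrite big_nil; under eq_fun do rewrite big_nil; exact: cvg_cst.
    rewrite big_cons; under eq_fun do rewrite big_cons.
    by apply: cvgD => //; apply: cvgM; [exact: cvg_cst|exact: cF].
  have st0 : 0 < Num.sqrt t by rewrite sqrtr_gt0.
  have [fin_lx lx0] := (fine_cvgP _ _).1 u_lx.
  move/cvgr_lt : lx0 => /(_ _ st0) lx0; near=> m.
  have lxt : (lx phi q a (Hdot s) (D m) `^ 2 <= t%:E)%E.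
    have fm : lx phi q a (Hdot s) (D m) \is a fin_num by near: m.
    have lm : fine (lx phi q a (Hdot s) (D m)) < Num.sqrt t by near: m.
    have l0 : 0 <= fine (lx phi q a (Hdot s) (D m)) by apply/fine_ge0/poweR_ge0.
    rewrite -(fineK fm) poweR_EFin lee_fin powR_mulrn// -[leRHS]sqr_sqrtr ?(ltW t0)//.
    by rewrite lerXn2r ?nnegrE ?(ltW lm) ?(ltW st0).
  rewrite gE; apply: le_trans (hC k ls (u m) us (u_test m)) _.
  apply: lee_wpmul2l => //.
  have wF0 j : (0 <= (w j)%:E * Hdot s (Qk phi j F) `^ 2)%E.
    by rewrite mule_ge0 ?lee_fin ?poweR_ge0.
  have wt0 j : (0 <= (w j * 2 `^ (- (2 * (j%:~R * a))))%:E)%E.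
    by rewrite lee_fin mulr_ge0 ?powR_ge0.
  have tt0 : 0 <= 2 * t by rewrite mulr_ge0 ?(ltW t0).
  apply: (@le_trans _ _ (\esum_(j in [set: int])
      (2%:E * ((w j)%:E * Hdot s (Qk phi j F) `^ 2) +
       (2 * t)%:E * (w j * 2 `^ (- (2 * (j%:~R * a))))%:E))%E).
    apply: le_esum => j _; rewrite -/(w j).
    apply: le_trans (lee_wpmul2l _ (split_ m j)) _; first by rewrite lee_fin.
    rewrite ge0_muleDr ?mule_ge0 ?poweR_ge0 ?lee_fin//.
    apply: leeD; first by rewrite muleCA.
    have hD := le_trans (Hdot_le_lx a s (D m) j q0) (lee_wpmul2l _ lxt).
    have {}hD : (Hdot s (Qk phi j (D m)) `^ 2 <= (2 `^ (- (2 * (j%:~R * a))) * t)%:E)%E.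
      by rewrite EFinM; apply: hD; rewrite lee_fin powR_ge0.
    apply: le_trans (_ : ((w j)%:E * (2%:E * (2 `^ (- (2 * (j%:~R * a))) * t)%:E) <= _)%E).
      by apply: lee_wpmul2l; rewrite ?lee_fin//; apply: lee_wpmul2l; rewrite ?lee_fin.
    by rewrite -!EFinM lee_fin le_eqVlt; apply/orP; left; apply/eqP; ring.
  rewrite esumD; [|by move=> j _; apply: mule_ge0; [rewrite lee_fin|exact: wF0]
    |by move=> j _; apply: mule_ge0; [rewrite lee_fin|exact: wt0]].
  rewrite (esumZl (ler0n R 2) wF0) (esumZl tt0 wt0) -/S; apply: leeD => //.
  have -> : 2 * K * t = 2 * t * K by ring.
  by rewrite [X in (_ <= X)%E]EFinM; apply: lee_wpmul2l; rewrite ?lee_fin.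
apply/lee_addgt0Pr => r r0; have c1 : 0 < 2 * C * K + 1.
  by rewrite ltr_wpDl// !mulr_ge0.
apply: le_trans (step _ (divr_gt0 r0 c1)) _.
have S0 : (0 <= S)%E by apply: esum_ge0 => j _; rewrite mule_ge0 ?lee_fin ?poweR_ge0.
rewrite ge0_muleDr ?mule_ge0 ?lee_fin ?mulr_ge0 ?invr_ge0 ?(ltW r0) ?(ltW c1)//.
apply: leeD; first by rewrite muleA -EFinM mulrC.
rewrite -EFinM lee_fin.
have -> : C * (2 * K * (r / (2 * C * K + 1))) = r * (2 * C * K) / (2 * C * K + 1) by ring.
by rewrite ler_pdivrMr// ler_wpM2l ?(ltW r0)//; lra.
Unshelve. all: by end_near. Qed.

End passage_to_the_limit.

Theorem theorem1p5 (R : realType) (n : nat) (phi : R -> R) (q a s : R) :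
  (3 <= n)%N -> dyadic_generator phi ->
  1 <= q <= 2 -> `|s| <= 1 -> `|a| + `|s| < n%:R / 2 ->
  exists C : R, forall f : functional R n, lx_Hdot_space phi q a s f ->
    (lD phi 2 0 (lx phi q a (Hdot s)) f <= C%:E * lx phi q a (Hdot s) f)%E.
Proof.
move=> n3 Hphi hq s1 asn; have n0 : (0 < n)%N by apply: leq_trans n3.
have q0 : 0 < q by lra.
have a0 := normr_ge0 a; have sn : 2 * `|s| < n%:R by lra.
(* The midpoint between 2 |a| and n - 2 |s|: both strict inequalities are needed, the upper one for
   adding the shells, the lower one for the sums in k - j. *)
pose d := (2 * `|a| + (n%:R - 2 * `|s|)) / 2.
have ad : 2 * `|a| < d by rewrite /d; lra.
have dn : d < n%:R - 2 * `|s| by rewrite /d; lra.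
have [C [C0 hC]] := test_function_bound n0 Hphi s1 sn dn.
have C20 : 0 <= 2 * C by rewrite mulr_ge0.
have [D [D0 hD]] := discrete_bound hq ad C20.
(* A positive constant is required when the norm of [f] is infinite, since 0 times +oo is 0. *)
exists (D + 1) => f hf; have D1 : 0 < D + 1 by rewrite ltr_wpDl.
pose Y := (\esum_(j in [set: int]) ((2 `^ (j%:~R * q * a))%:E * Hdot s (Qk phi j f) `^ q))%E.
have lxY : lx phi q a (Hdot s) f = (Y `^ q^-1)%E by [].
have Y0 : (0 <= Y)%E.
  by apply: esum_ge0 => j _; rewrite mule_ge0 ?lee_fin ?powR_ge0 ?poweR_ge0.
have [Yoo|Yoo] := ltP Y +oo%E; last first.
  have -> : lx phi q a (Hdot s) f = +oo%E.
    by rewrite lxY; apply: eqy_poweR; rewrite ?invr_gt0//; apply/eqP; rewrite -leye_eq.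
  by rewrite gt0_muley ?leey.
have lDE : lD phi 2 0 (lx phi q a (Hdot s)) f =
    ((\esum_(l in [set: int]) (lx phi q a (Hdot s) (PkD phi l f)) `^ 2) `^ 2^-1)%E.
  by congr (_ `^ _)%E; apply: eq_esum => l _; rewrite mulr0 powRr0 mul1e.
rewrite lDE; apply: le_trans (hD (fun k l => Hdot s (Qk phi k (PkD phi l f)))
  (fun j => Hdot s (Qk phi j f)) _ _ _ Yoo) _.
- by move=> k l; exact: Hdot_ge0.
- by move=> j; exact: Hdot_ge0.
- exact: (limit_bound Hphi q0 ad C0 hC hf).
rewrite -/Y -lxY; apply: lee_wpmul2r; last by rewrite lee_fin lerDl.
by rewrite lxY poweR_ge0.
Qed.
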